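(* Let $R$ be an associative ring with identity such that $\mathcal{P}(R)\subseteq\mathcal{SFI}^{\vee}$ and $\mathrm{spli}(R):=\mathrm{pd}(\mathcal{I}(R))<\infty$. Then: (i) $\mathrm{spli}(R)=\mathrm{silp}(R)$. (ii) If additionally $R$ is an Artin algebra, then the Gorenstein Symmetry Conjecture holds for $R$, i.e. the injective dimension of $R$ as a left $R$-module equals the injective dimension of $R$ as a right $R$-module.
   Context: Modules are left $R$-modules unless specified; $\mathcal{P}(R)$ and $\mathcal{I}(R)$ are the classes of projective and injective left $R$-modules. $\mathrm{spli}(R)=\mathrm{pd}(\mathcal{I}(R)):=\sup\{\mathrm{pd}(I):I\in\mathcal{I}(R)\}$ and $\mathrm{silp}(R)=\mathrm{id}(\mathcal{P}(R)):=\sup\{\mathrm{id}(P):P\in\mathcal{P}(R)\}$. $\mathcal{SFI}$ is the class of strongly FP-injective modules, i.e. left modules $E$ with $\mathrm{Ext}^k_R(F,E)=0$ for all $k\ge1$ and all finitely presented left modules $F$. $\mathcal{SFI}^{\vee}$ is the class of modules $M$ for which there exist $m\ge0$ and an exact sequence $0\to M\to E^0\to\cdots\to E^m\to0$ with all $E^i\in\mathcal{SFI}$. The Gorenstein Symmetry Conjecture states that for an Artin algebra the left and the right injective dimensions of the regular module coincide. *)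

(* Defs.v *)
From HB Require Import structures.
From mathcomp Require Import all_boot all_order all_algebra.
From mathcomp Require Import boolp classical_sets constructive_ereal ereal.
Set Implicit Arguments.
Unset Strict Implicit.
Unset Printing Implicit Defensive.
Import Order.TTheory GRing.Theory Num.Theory.
Local Open Scope ring_scope.

(* Rings are [pzRingType]s: associative, unital, possibly zero.  Left
   R-modules are [lmodType R]; right R-modules are left modules over the
   opposite ring R^c. *)

Section Modules.
Variable R : pzRingType.

Definition surjective_map (U V : Type) (f : U -> V) : Prop :=
  forall y, exists x, f x = y.

Definition exact_at (U V W : lmodType R)
    (f : {linear U -> V}) (g : {linear V -> W}) : Prop :=
  forall y : V, g y = 0 <-> exists x : U, f x = y.

Definition zero_module (M : lmodType R) : Prop := forall x : M, x = 0.

Definition projective_module (P : lmodType R) : Prop :=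
  forall (B C : lmodType R) (p : {linear B -> C}) (f : {linear P -> C}),
    surjective_map p -> exists g : {linear P -> B}, p \o g =1 f.

Definition injective_module (I : lmodType R) : Prop :=
  forall (A B : lmodType R) (i : {linear A -> B}) (f : {linear A -> I}),
    injective i -> exists g : {linear B -> I}, g \o i =1 f.

Definition finitely_presented (F : lmodType R) : Prop :=
  exists (m n : nat) (r : {linear 'rV[R]_m -> 'rV[R]_n})
         (p : {linear 'rV[R]_n -> F}),
    exact_at r p /\ surjective_map p.

(* Exact sequences ... -> M_1 -> M_0 -> M -> 0. *)
Record resolution (M : lmodType R) := Resolution {
  res_obj :> nat -> lmodType R;
  res_diff : forall i, {linear res_obj i.+1 -> res_obj i};
  res_aug : {linear res_obj 0%N -> M};
  res_aug_surj : surjective_map res_aug;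
  res_exact0 : exact_at (res_diff 0) res_aug;
  res_exactS : forall i, exact_at (res_diff i.+1) (res_diff i) }.

(* Exact sequences 0 -> M -> M^0 -> M^1 -> ... *)
Record coresolution (M : lmodType R) := Coresolution {
  cores_obj :> nat -> lmodType R;
  cores_diff : forall i, {linear cores_obj i -> cores_obj i.+1};
  cores_aug : {linear M -> cores_obj 0%N};
  cores_aug_inj : injective cores_aug;
  cores_exact0 : exact_at cores_aug (cores_diff 0);
  cores_exactS : forall i, exact_at (cores_diff i) (cores_diff i.+1) }.

(* An exact sequence 0 -> M_n -> ... -> M_0 -> M -> 0 with all M_i in X,
   padded by zero modules in degrees > n; dually for coresolutions. *)
Definition has_resolution (X : lmodType R -> Prop) (M : lmodType R)
    (n : nat) : Prop :=
  exists C : resolution M,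
    (forall i, (i <= n)%N -> X (C i)) /\
    (forall i, (n < i)%N -> zero_module (C i)).

Definition has_coresolution (X : lmodType R -> Prop) (M : lmodType R)
    (n : nat) : Prop :=
  exists C : coresolution M,
    (forall i, (i <= n)%N -> X (C i)) /\
    (forall i, (n < i)%N -> zero_module (C i)).

(* Dimensions live in N u {+oo}, embedded in \bar rat: infima and suprema of
   sets of extended naturals exist there, and the infimum of the empty set is
   +oo.  The zero module has dimension 0. *)
Definition proj_dim (M : lmodType R) : \bar rat :=
  ereal_inf [set n%:R%:E | n in has_resolution projective_module M].

Definition inj_dim (M : lmodType R) : \bar rat :=
  ereal_inf [set n%:R%:E | n in has_coresolution injective_module M].

Definition spli : \bar rat :=
  ereal_sup [set d | exists2 I : lmodType R,
                       injective_module I & d = proj_dim I].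

Definition silp : \bar rat :=
  ereal_sup [set d | exists2 P : lmodType R,
                       projective_module P & d = inj_dim P].

(* Image of Hom(P_(k-1), E) in Hom(P_k, E), with P_(-1) = 0. *)
Definition coboundary (M E : lmodType R) (P : resolution M) (k : nat) :
    {linear P k -> E} -> Prop :=
  match k return {linear P k -> E} -> Prop with
  | 0%N => fun f => forall x, f x = 0
  | j.+1 => fun f => exists g : {linear P j -> E}, f =1 g \o res_diff P j
  end.

(* Ext^k_R(M, E) = 0, i.e. H^k(Hom_R(P, E)) = 0 for projective resolutions
   P -> M.  As H^k(Hom_R(P, E)) does not depend on P up to isomorphism and
   every module has a free resolution, quantifying over all P is the same as
   fixing one. *)
Definition Ext_vanishes (k : nat) (M E : lmodType R) : Prop :=
  forall P : resolution M, (forall i, projective_module (P i)) ->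
  forall f : {linear P k -> E},
    (forall x, f (res_diff P k x) = 0) -> coboundary f.

Definition strongly_FP_injective (E : lmodType R) : Prop :=
  forall (k : nat) (F : lmodType R),
    (1 <= k)%N -> finitely_presented F -> Ext_vanishes k F E.

Definition SFI_vee (M : lmodType R) : Prop :=
  exists m : nat, has_coresolution strongly_FP_injective M m.

End Modules.

Arguments spli R : clear implicits.
Arguments silp R : clear implicits.

(* Ideals of k are the submodules of the regular module k^o. *)
Definition artinian_ring (k : comPzRingType) : Prop :=
  forall I : nat -> {pred k^o},
    (forall n, submod_closed (I n)) ->
    (forall n, {subset I n.+1 <= I n}) ->
    exists N : nat, forall n, (N <= n)%N -> I n =i I N.

(* R is an algebra, finitely generated as a module, over a commutative
   artinian ring k; the algebra structure is a ring morphism from k to the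
   centre of R. *)
Definition artin_algebra (R : pzRingType) : Prop :=
  exists (k : comPzRingType) (phi : {rmorphism k -> R}),
    [/\ artinian_ring k,
        forall c x, phi c * x = x * phi c
      & exists (n : nat) (a : 'I_n -> R),
          forall x, exists c : 'I_n -> k, x = \sum_(i < n) phi (c i) * a i].

Definition left_self_inj_dim (R : pzRingType) : \bar rat :=
  inj_dim (R^o : lmodType R).

Definition right_self_inj_dim (R : pzRingType) : \bar rat :=
  inj_dim (R^c^o : lmodType R^c).

(* Main.v *)
Require Import Defs.
From HB Require Import structures.
From mathcomp Require Import all_boot all_order all_algebra.
From mathcomp Require Import boolp classical_sets constructive_ereal ereal.

(** Write n for spli(R), the supremum of the projective dimensions of the
    injective modules, which is assumed to be finite.

    The heart of part (i) is that a strongly FP-injective module E has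
    projective dimension at most n.  All cosyzygies of E are again strongly
    FP-injective, so an injective coresolution of E is pure exact; its terms
    have projective dimension at most n.  Taking n-th syzygies of the whole
    coresolution, which preserves purity ([pure_horseshoe]), produces a pure
    exact sequence 0 -> F -> Q_0 -> Q_1 -> ... with all Q_j projective, where F
    is an n-th syzygy of E.  Such an F is projective: this is the theorem of
    Benson-Goodearl and Neeman ([pure_projective_coresolution]).  It is proved
    by contracting the complex: purity yields contractions of finite rank
    ([local_contraction]), countably many of them are patched into a contraction
    of a countably generated subcomplex ([countable_section]), dividing by a
    contracted subcomplex leaves a complex of the same kind
    ([extend_section]), and Zorn's lemma does the rest
    ([boundary_splitting]).

    Once the cosyzygies of E all have projective dimension at most n, dimension
    shifting shows that the n-th one is injective, so E has injective dimension
    at most n ([sfi_id]).  Hence every projective module P, having a finite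
    coresolution by strongly FP-injective modules, has finite injective
    dimension; since Ext^j(I, P) = 0 for I injective and j > n, embedding modules
    in injective ones lowers that dimension to n ([SFI_vee_id]).  So
    silp(R) <= n, and spli(R) <= silp(R) because the top Ext of an injective
    module is right exact and thus detected by projectives
    ([pd_le_descend]).

    For part (ii), an Artin algebra R is Noetherian on both sides
    ([dcc_noetherian]).  Therefore silp(R) is the left injective dimension of R
    ([noetherian_id_projective]).  For an injective left module I and a finitely
    generated right module X, Tor(X, I) vanishes for all I exactly when
    Ext(X, R) does in the same degree ([coext_zero_injective]).  So the right
    injective dimension of R is at most spli(R), which is the left one by part
    (i) ([id_right_le]).  Conversely, let the right injective dimension
    be m.  Then the m-th syzygies of injective left modules are flat; as R is
    pure-injective over itself ([pure_extension], by the descending chain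
    condition over the scalars), Ext^j(I, R) = 0 for I injective and j > m, and
    since the left injective dimension is finite it is at most m
    ([id_left_le]).

    Vanishing of Ext is handled through the predicate [ext_zero], by dimension
    shifting on both sides, and Tor through matrices of relations; neither
    cohomology groups nor tensor products are formed. *)
Set Implicit Arguments.
Unset Strict Implicit.
Unset Printing Implicit Defensive.
Import Order.TTheory GRing.Theory Num.Theory.
Local Open Scope ring_scope.


(** * Modules: linear maps, submodules, quotients, direct sums *)

Definition lin_pack (R : pzRingType) (U V : lmodType R) (f : U -> V)
    (lf : linear f) : {linear U -> V} :=
  HB.pack f (GRing.isLinear.Build R U V *:%R f lf).

Lemma linear_ex (R : pzRingType) (U V : lmodType R) (f : U -> V) :
  linear f -> exists g : {linear U -> V}, forall x, g x = f x.
Proof. by move=> lf; exists (lin_pack lf). Qed.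

Definition submodP (R : pzRingType) (M : lmodType R) (N : M -> Prop) : Prop :=
  N 0 /\ forall a x y, N x -> N y -> N (a *: x + y).

Section SubmodP.
Variables (R : pzRingType) (M : lmodType R) (N : M -> Prop).
Hypothesis clN : submodP N.

Lemma submodP0 : N 0. Proof. by case: clN. Qed.

Lemma submodPD x y : N x -> N y -> N (x + y).
Proof. by move=> Nx Ny; rewrite -[x]scale1r; apply clN.2. Qed.

Lemma submodPZ a x : N x -> N (a *: x).
Proof. by move=> Nx; rewrite -[_ *: _]addr0; apply: clN.2 => //; apply: clN.1. Qed.

Lemma submodPN x : N x -> N (- x).
Proof. by move=> Nx; rewrite -scaleN1r; apply: submodPZ. Qed.

Lemma submodPB x y : N x -> N y -> N (x - y).
Proof. by move=> Nx Ny; apply: submodPD => //; apply: submodPN. Qed.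

Lemma submodP_sum (I : Type) (r : seq I) (P : pred I) (F : I -> M) :
  (forall i, P i -> N (F i)) -> N (\sum_(i <- r | P i) F i).
Proof. by move=> NF; elim/big_rec: _ => [|i x Pi]; [apply: submodP0|apply/submodPD/NF]. Qed.

Definition sub_pred : {pred M} := fun x => `[< N x >].

Definition sub_of & submodP N := {x | sub_pred x}.

End SubmodP.

Section Submodule.
Variables (R : pzRingType) (M : lmodType R) (N : M -> Prop).
Hypothesis clN : submodP N.

Lemma sub_pred_closed : submod_closed (sub_pred N).
Proof.
split; first by apply/asboolP; apply: submodP0.
move=> a x y /asboolP Nx /asboolP Ny; apply/asboolP.
by apply: submodPD => //; apply: submodPZ.
Qed.

HB.instance Definition _ := SubChoice.on (sub_of clN).
HB.instance Definition _ := GRing.SubChoice_isSubLmodule.Build R M (sub_pred N)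
  (sub_of clN) sub_pred_closed.

Lemma submodule_ex : exists (K : lmodType R) (i : {linear K -> M}),
  injective i /\ forall x, N x <-> exists y, i y = x.
Proof.
exists (sub_of clN : lmodType R), (lin_pack (GRing.linearP \val)).
split; first exact: val_inj.
move=> x; split=> [Nx|[y <-]]; last exact/asboolP/(valP y).
by exists (Sub x (asboolT Nx)).
Qed.

(** Classes modulo a submodule are represented by the elements that are the
    chosen representatives of their own class. *)
Definition quot_repr (x : M) : M := choose (fun y => `[< N (y - x) >]) x.

Lemma quot_reprP x : N (quot_repr x - x).
Proof.
apply/asboolP/(@chooseP _ (fun y => `[< N (y - x) >])).
by apply/asboolP; rewrite subrr; apply: submodP0.
Qed.

Lemma quot_repr_eq x y : N (x - y) -> quot_repr x = quot_repr y.
Proof.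
move=> Nxy; rewrite /quot_repr.
have E : (fun z => `[< N (z - x) >]) =1 (fun z => `[< N (z - y) >]).
  move=> z; apply/asboolP/asboolP => h.
    by rewrite -(subrK x z) -addrA; apply: submodPD.
  by rewrite -(subrK y z) -addrA; apply: submodPD => //; rewrite -opprB; apply: submodPN.
rewrite (eq_choose E); apply: choose_id => //; apply/asboolP => //.
by rewrite subrr; apply: submodP0.
Qed.

Lemma quot_repr_id x : quot_repr (quot_repr x) = quot_repr x.
Proof. exact/quot_repr_eq/quot_reprP. Qed.

Definition quot_of & submodP N := {x | quot_repr x == x}.

Local Notation Q := (quot_of clN).
HB.instance Definition _ := SubChoice.on Q.

Definition quot_pi (x : M) : Q := exist _ (quot_repr x) (introT eqP (quot_repr_id x)).

Lemma quot_pi_eq x y : quot_pi x = quot_pi y <-> N (x - y).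
Proof.
split=> [/(congr1 val) /= E|Nxy]; last by apply: val_inj; apply: quot_repr_eq.
have := submodPB clN (quot_reprP y) (quot_reprP x); rewrite E.
by rewrite opprB addrC addrA subrK.
Qed.

Lemma quot_piK (u : Q) : quot_pi (val u) = u.
Proof. by apply: val_inj; case: u => x /= /eqP. Qed.

Lemma quot_val_pi x : N (val (quot_pi x) - x).
Proof. exact: quot_reprP. Qed.

Definition quot_add (u v : Q) := quot_pi (val u + val v).
Definition quot_opp (u : Q) := quot_pi (- val u).
Definition quot_scale a (u : Q) := quot_pi (a *: val u).

Lemma quot_piD x y : quot_pi (x + y) = quot_add (quot_pi x) (quot_pi y).
Proof.
apply/quot_pi_eq; rewrite opprD addrACA -(opprB _ x) -(opprB _ y).
by apply: submodPD => //; apply: submodPN => //; apply: quot_val_pi.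
Qed.

Lemma quot_piN x : quot_pi (- x) = quot_opp (quot_pi x).
Proof. by apply/quot_pi_eq; rewrite opprK addrC; apply: quot_val_pi. Qed.

Lemma quot_piZ a x : quot_pi (a *: x) = quot_scale a (quot_pi x).
Proof.
apply/quot_pi_eq; rewrite -scalerBr -opprB; apply: submodPZ => //.
by apply: submodPN => //; apply: quot_val_pi.
Qed.

Lemma quot_addA : associative quot_add.
Proof. by move=> u v w; rewrite -(quot_piK u) -(quot_piK v) -(quot_piK w) -!quot_piD addrA. Qed.
Lemma quot_addC : commutative quot_add.
Proof. by move=> u v; rewrite -(quot_piK u) -(quot_piK v) -!quot_piD addrC. Qed.
Lemma quot_add0 : left_id (quot_pi 0) quot_add.
Proof. by move=> u; rewrite -(quot_piK u) -!quot_piD add0r. Qed.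
Lemma quot_addN : left_inverse (quot_pi 0) quot_opp quot_add.
Proof. by move=> u; rewrite -(quot_piK u) -quot_piN -!quot_piD addNr. Qed.

HB.instance Definition _ :=
  GRing.isZmodule.Build Q quot_addA quot_addC quot_add0 quot_addN.

Lemma quot_scaleA a b (u : Q) : quot_scale a (quot_scale b u) = quot_scale (a * b) u.
Proof. by rewrite -(quot_piK u) -!quot_piZ scalerA. Qed.
Lemma quot_scale1 : left_id 1 quot_scale.
Proof. by move=> u; rewrite -(quot_piK u) -!quot_piZ scale1r. Qed.
Lemma quot_scaleDr : right_distributive quot_scale +%R.
Proof.
move=> a u v; rewrite -(quot_piK u) -(quot_piK v) /GRing.add /=.
by rewrite -quot_piD -!quot_piZ scalerDr quot_piD.
Qed.
Lemma quot_scaleDl v : {morph quot_scale^~ v : a b / a + b}.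
Proof.
move=> a b; rewrite /= -(quot_piK v) [RHS]/GRing.add /=.
by rewrite -!quot_piZ scalerDl quot_piD.
Qed.

HB.instance Definition _ := GRing.Zmodule_isLmodule.Build R Q
  quot_scaleA quot_scale1 quot_scaleDr quot_scaleDl.

Lemma quotient_ex : exists (C : lmodType R) (p : {linear M -> C}),
  surjective_map p /\ forall x, p x = 0 <-> N x.
Proof.
have lp : linear quot_pi by move=> a x y; rewrite quot_piD quot_piZ.
exists (Q : lmodType R), (lin_pack lp); split=> [u|x].
  by exists (val u); apply: quot_piK.
have -> : (0 : Q) = quot_pi 0 by [].
by rewrite -[X in _ <-> N X]subr0; apply: quot_pi_eq.
Qed.

End Submodule.

Section FiniteSupport.
Variables (I : eqType) (V : nmodType) (F : I -> V).

Lemma sum_support (r s : seq I) : uniq r -> uniq s ->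
  (forall i, i \notin r -> F i = 0) -> (forall i, i \notin s -> F i = 0) ->
  \sum_(i <- r) F i = \sum_(i <- s) F i.
Proof.
move=> ur us Fr Fs.
have split_sum (t t' : seq I) : (forall i, i \notin t' -> F i = 0) ->
    \sum_(i <- t) F i = \sum_(i <- [seq i <- t | i \in t']) F i.
  move=> Ft'; rewrite big_filter [RHS]big_mkcond /=; apply: eq_bigr => i _.
  by case: ifPn => // /Ft'.
rewrite (split_sum r s) // (split_sum s r) //; apply: perm_big.
apply: uniq_perm; rewrite ?filter_uniq // => i.
by rewrite !mem_filter andbC.
Qed.

End FiniteSupport.

(** Direct sums are the submodules of finitely supported families in the
    product; the index type is arbitrary since supports are given by lists. *)
Section DirectSum.
Variables (R : pzRingType) (X : choiceType) (M : X -> lmodType R).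

Definition dprod := forall x, M x.
HB.instance Definition _ := Choice.on dprod.

Lemma dprod_addA : associative (fun f g : dprod => (fun x => f x + g x) : dprod).
Proof. by move=> f g h; apply: functional_extensionality_dep => x; rewrite addrA. Qed.
Lemma dprod_addC : commutative (fun f g : dprod => (fun x => f x + g x) : dprod).
Proof. by move=> f g; apply: functional_extensionality_dep => x; rewrite addrC. Qed.
Lemma dprod_add0 : left_id ((fun x => 0) : dprod)
  (fun f g : dprod => (fun x => f x + g x) : dprod).
Proof. by move=> f; apply: functional_extensionality_dep => x; rewrite add0r. Qed.
Lemma dprod_addN : left_inverse ((fun x => 0) : dprod) (fun f : dprod => (fun x => - f x) : dprod)
  (fun f g : dprod => (fun x => f x + g x) : dprod).
Proof. by move=> f; apply: functional_extensionality_dep => x; rewrite addNr. Qed.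

HB.instance Definition _ :=
  GRing.isZmodule.Build dprod dprod_addA dprod_addC dprod_add0 dprod_addN.

Definition dprod_scale (a : R) (f : dprod) : dprod := fun x => a *: f x.

Lemma dprod_scaleA a b (f : dprod) :
  dprod_scale a (dprod_scale b f) = dprod_scale (a * b) f.
Proof. by apply: functional_extensionality_dep => x; apply: scalerA. Qed.
Lemma dprod_scale1 : left_id 1 dprod_scale.
Proof. by move=> f; apply: functional_extensionality_dep => x; apply: scale1r. Qed.
Lemma dprod_scaleDr : right_distributive dprod_scale +%R.
Proof. by move=> a f g; apply: functional_extensionality_dep => x; apply: scalerDr. Qed.
Lemma dprod_scaleDl f : {morph dprod_scale^~ f : a b / a + b}.
Proof. by move=> a b; apply: functional_extensionality_dep => x; apply: scalerDl. Qed.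

HB.instance Definition _ := GRing.Zmodule_isLmodule.Build R dprod
  dprod_scaleA dprod_scale1 dprod_scaleDr dprod_scaleDl.

Definition fin_supp (f : dprod) : Prop :=
  exists s : seq X, forall x, x \notin s -> f x = 0.

Lemma fin_supp_submod : submodP fin_supp.
Proof.
split; first by exists [::].
move=> a f g [s fs] [t gt]; exists (s ++ t) => x; rewrite mem_cat negb_or.
case/andP=> xs xt; have -> : (a *: f + g) x = a *: f x + g x by [].
by rewrite (fs _ xs) (gt _ xt) scaler0 add0r.
Qed.

Definition dsum : lmodType R := sub_of fin_supp_submod.

Definition dcoord (x : X) (f : dsum) : M x := val f x.

Lemma dcoord_linear x : linear (@dcoord x).
Proof. by []. Qed.

HB.instance Definition _ x := GRing.isLinear.Build R dsum (M x) *:%R (@dcoord x)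
  (@dcoord_linear x).

Lemma dsum_ext (f g : dsum) : (forall x, dcoord x f = dcoord x g) -> f = g.
Proof. by move=> E; apply/val_inj/functional_extensionality_dep. Qed.

Lemma dsum_make (f : forall x, M x) (s : seq X) :
  (forall x, x \notin s -> f x = 0) -> exists g : dsum, forall x, dcoord x g = f x.
Proof.
move=> fs; have Hf : sub_pred fin_supp f by apply/asboolP; exists s.
by exists (exist _ f Hf).
Qed.

Lemma dsupp_ex (f : dsum) :
  exists s, uniq s /\ forall x, x \notin s -> dcoord x f = 0.
Proof.
have /asboolP[s fs] := valP f; exists (undup s); split; first exact: undup_uniq.
by move=> x; rewrite mem_undup => /fs.
Qed.

Lemma dinj_ex x (m : M x) : exists g : dsum, dcoord x g = m /\
  forall y, y != x -> dcoord y g = 0.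
Proof.
pose f y : M y := if pselect (x = y) is left e then ecast z (M z) e m else 0.
have [y|g gE] := @dsum_make f [:: x].
  by rewrite inE /f; case: pselect => // e yx; exfalso; move: yx; rewrite e eqxx.
exists g; split=> [|y yx]; rewrite gE /f; case: pselect => // e.
  by rewrite (Prop_irrelevance e erefl).
by rewrite e eqxx in yx.
Qed.

Definition dinj x (m : M x) : dsum := projT1 (cid (dinj_ex m)).

Lemma dinj_same x (m : M x) : dcoord x (dinj m) = m.
Proof. by rewrite /dinj; case: cid => g []. Qed.

Lemma dinj_other x y (m : M x) : y != x -> dcoord y (dinj m) = 0.
Proof. by have [_] := projT2 (cid (dinj_ex m)); apply. Qed.

Lemma dinj_linear x : linear (@dinj x).
Proof.
move=> a m n; apply: dsum_ext => y; rewrite linearP /=.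
have [->|yx] := eqVneq y x; first by rewrite !dinj_same.
by rewrite !dinj_other // scaler0 addr0.
Qed.

HB.instance Definition _ x := GRing.isLinear.Build R (M x) dsum *:%R (@dinj x)
  (@dinj_linear x).

Lemma dsumE (f : dsum) (s : seq X) : uniq s ->
  (forall x, x \notin s -> dcoord x f = 0) -> f = \sum_(x <- s) dinj (dcoord x f).
Proof.
move=> us fs; apply: dsum_ext => y; rewrite linear_sum /=.
have [ys|ys] := boolP (y \in s).
  rewrite (bigD1_seq y) //= dinj_same big1_seq ?addr0 // => x /andP[xy _].
  by rewrite dinj_other // eq_sym.
rewrite fs // big1_seq // => x /andP[_ xs]; rewrite dinj_other //.
by apply: contraNneq ys => ->.
Qed.

Lemma dsum_universal (N : lmodType R) (g : forall x, {linear M x -> N}) :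
  exists h : {linear dsum -> N}, forall x m, h (dinj m) = g x m.
Proof.
pose s f := projT1 (cid (dsupp_ex f)).
have us f : uniq (s f) by rewrite /s; case: cid => ? [].
have sP f x : x \notin s f -> dcoord x f = 0.
  by rewrite /s; case: cid => ? [_ H] /=; apply: H.
pose h f := \sum_(x <- s f) g x (dcoord x f).
have hE f t : uniq t -> (forall x, x \notin t -> dcoord x f = 0) ->
    h f = \sum_(x <- t) g x (dcoord x f).
  move=> ut ft; apply: sum_support => // x xs.
    by rewrite sP ?linear0.
  by rewrite ft ?linear0.
have lh : linear h.
  move=> a f f'.
  pose t := undup (s f ++ s f').
  have tf x : x \notin t -> dcoord x f = 0.
    by rewrite mem_undup mem_cat negb_or => /andP[/sP].
  have tf' x : x \notin t -> dcoord x f' = 0.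
    by rewrite mem_undup mem_cat negb_or => /andP[_ /sP].
  have ut : uniq t by apply: undup_uniq.
  rewrite (hE _ t) // ?(hE f t) // ?(hE f' t) //; last first.
    by move=> x xt; rewrite linearP /= tf // tf' // scaler0 addr0.
  rewrite scaler_sumr -big_split; apply: eq_bigr => x _ /=.
  by rewrite !linearP.
exists (lin_pack lh) => x m /=; rewrite (hE _ [:: x]) //.
  by rewrite big_seq1 dinj_same.
by move=> y; rewrite inE => yx; rewrite dinj_other.
Qed.

Lemma dsum_map_ext (N : lmodType R) (h h' : {linear dsum -> N}) :
  (forall x m, h (@dinj x m) = h' (dinj m)) -> forall f, h f = h' f.
Proof.
move=> hh' f; have [s [us sf]] := dsupp_ex f.
by rewrite (dsumE us sf) !linear_sum; apply: eq_bigr => x _; apply: hh'.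
Qed.

End DirectSum.

(** * Short exact sequences and projective modules *)

Section ShortExact.
Variable R : pzRingType.
Implicit Types A B C D M N P : lmodType R.

Definition ses A B C (i : {linear A -> B}) (p : {linear B -> C}) : Prop :=
  [/\ injective i, exact_at i p & surjective_map p].

Lemma lin_inj0 A B (f : {linear A -> B}) :
  (forall x, f x = 0 -> x = 0) -> injective f.
Proof. by move=> f0 x y e; apply/subr0_eq/f0; rewrite linearB /= e subrr. Qed.

Lemma ses_comp0 A B C (i : {linear A -> B}) (p : {linear B -> C}) :
  exact_at i p -> forall x, p (i x) = 0.
Proof. by move=> ex x; apply/ex; exists x. Qed.

Lemma factor_surj B C D (p : {linear B -> C}) (f : {linear B -> D}) :
  surjective_map p -> (forall b, p b = 0 -> f b = 0) ->
  exists g : {linear C -> D}, forall b, g (p b) = f b.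
Proof.
move=> sp kf; have [s sK] := choice sp.
have fE b : f (s (p b)) = f b.
  by apply/subr0_eq; rewrite -linearB kf // linearB /= sK subrr.
suff [g gE] : exists g : {linear C -> D}, forall c, g c = f (s c).
  by exists g => b; rewrite gE fE.
apply: linear_ex => a x y /=; rewrite -linearP -[RHS]fE; congr (f (s _)).
by rewrite linearP /= !sK.
Qed.

Lemma factor_inj A B D (i : {linear A -> B}) (f : {linear D -> B}) :
  injective i -> (forall d, exists a, i a = f d) ->
  exists g : {linear D -> A}, forall d, i (g d) = f d.
Proof.
move=> ii /choice[g gE].
have [|h hE] := @linear_ex R D A g; last by exists h => d; rewrite hE.
by move=> a x y; apply: ii; rewrite linearP /= !gE linearP.
Qed.

Lemma kernel_ex M N (f : {linear M -> N}) : exists (K : lmodType R) (i : {linear K -> M}),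
  injective i /\ exact_at i f.
Proof.
have [|K [i [ii iE]]] := @submodule_ex R M (fun x => f x = 0).
  by split=> [|a x y fx fy]; rewrite ?linear0 // linearP /= fx fy scaler0 addr0.
by exists K, i; split.
Qed.

Lemma cokernel_ex M N (f : {linear M -> N}) : exists (C : lmodType R) (p : {linear N -> C}),
  surjective_map p /\ exact_at f p.
Proof.
have [|C [p [sp pE]]] := @quotient_ex R N (fun y => exists x, f x = y).
  split=> [|a x y [x' <-] [y' <-]]; first by exists 0; rewrite linear0.
  by exists (a *: x' + y'); rewrite linearP.
by exists C, p; split.
Qed.

Lemma projective_retract P M (s : {linear P -> M}) (r : {linear M -> P}) :
  (forall x, r (s x) = x) -> projective_module M -> projective_module P.
Proof.
move=> rs pM B C p f sp; have [g gE] := pM B C p (f \o r) sp.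
by exists (g \o s) => x; have /= -> := gE (s x); rewrite rs.
Qed.

Lemma projective_section B P (p : {linear B -> P}) :
  projective_module P -> surjective_map p ->
  exists s : {linear P -> B}, forall x, p (s x) = x.
Proof. by move=> pP sp; have [s sE] := pP B P p idfun sp; exists s. Qed.

Lemma projective_dsum (X : choiceType) (M : X -> lmodType R) :
  (forall x, projective_module (M x)) -> projective_module (dsum M).
Proof.
move=> pM B C p f sp.
have lift_x x : exists g : {linear M x -> B}, forall m, p (g m) = f (dinj m).
  have [g gE] := pM x B C p (f \o @dinj _ _ M x) sp.
  by exists g => m; apply: gE.
have [h hE] := dsum_universal (fun x => projT1 (cid (lift_x x))).
exists h; apply: (dsum_map_ext (h := p \o h) (h' := f)) => x m /=.
by rewrite hE; case: (cid (lift_x x)) => g /= ->.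
Qed.

Lemma scale_on_linear N (n : N) : linear (fun r : R^o => (r : R) *: n).
Proof. by move=> a x y; rewrite scalerDl -scalerA. Qed.

Definition scale_on N (n : N) : {linear R^o -> N} := lin_pack (scale_on_linear n).

Lemma projective_regular : projective_module (R^o : lmodType R).
Proof.
move=> B C p f sp; have [b pb] := sp (f 1).
exists (scale_on b) => r /=; rewrite linearZ /= pb -linearZ /=.
by rewrite /GRing.scale /= mulr1.
Qed.

Lemma projective_cover_ex M : exists (P : lmodType R) (p : {linear P -> M}),
  projective_module P /\ surjective_map p.
Proof.
have [h hE] := @dsum_universal R M (fun=> R^o : lmodType R) M (fun m => scale_on m).
exists (dsum (fun _ : M => R^o : lmodType R)), h; split.
  by apply: projective_dsum => _; apply: projective_regular.
by move=> m; exists (@dinj R M (fun=> R^o : lmodType R) m 1); rewrite hE /= scale1r.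
Qed.

Lemma syzygy_ex M : exists (K P : lmodType R) (i : {linear K -> P}) (p : {linear P -> M}),
  projective_module P /\ ses i p.
Proof.
have [P [p [pP sp]]] := projective_cover_ex M.
by have [K [i [ii ip]]] := kernel_ex p; exists K, P, i, p.
Qed.

Lemma projective_prod M N : projective_module M -> projective_module N ->
  projective_module (M * N)%type.
Proof.
move=> pM pN B C p f sp.
have inl_lin : linear (fun m : M => (m, 0) : M * N).
  by move=> a x y; congr (_, _); rewrite /= scaler0 addr0.
have inr_lin : linear (fun n : N => (0, n) : M * N).
  by move=> a x y; congr (_, _); rewrite /= scaler0 addr0.
have [g gE] := pM B C p (f \o lin_pack inl_lin) sp.
have [h hE] := pN B C p (f \o lin_pack inr_lin) sp.
have [|k kE] := @linear_ex R (M * N)%type B (fun x => g x.1 + h x.2).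
  by move=> a x y /=; rewrite !linearP scalerDr addrACA.
exists k => x /=; rewrite kE linearD /=.
have /= -> := gE x.1; have /= -> := hE x.2; rewrite -linearD; congr (f _).
by case: x => x y; congr (_, _); rewrite /= ?addr0 ?add0r.
Qed.

(** The free cover has one basis vector for each element of [P], so a section
    of it gives coordinates for which every element is its own basis vector. *)
Lemma dual_basis P : projective_module P ->
  exists phi : P -> {linear P -> R^o},
    (forall q, exists s : seq P, uniq s /\ forall x, x \notin s -> phi x q = 0) /\
    (forall q (s : seq P), uniq s -> (forall x, x \notin s -> phi x q = 0) ->
       q = \sum_(x <- s) (phi x q : R) *: x).
Proof.
move=> pP.
have [h hE] := @dsum_universal R P (fun=> R^o : lmodType R) P (fun m => scale_on m).
have [|s sE] := projective_section (p := h) pP.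
  by move=> m; exists (@dinj R P (fun=> R^o : lmodType R) m 1); rewrite hE /= scale1r.
exists (fun x => @dcoord R P (fun=> R^o : lmodType R) x \o s); split=> [q|q l ul lq].
  exact: dsupp_ex.
rewrite -[LHS]sE (dsumE ul lq) linear_sum; apply: eq_bigr => x _ /=.
by rewrite hE.
Qed.

(** Finitely many elements of a projective module are combinations of finitely
    many elements in such a way that every relation between the former already
    holds between the coefficients: this is flatness in equational form. *)
Lemma projective_coordinates P (t : nat) (u : 'I_t -> P) : projective_module P ->
  exists (m : nat) (b : 'I_t -> 'I_m -> R) (e : 'I_m -> P),
    (forall i, u i = \sum_j b i j *: e j) /\
    forall c : 'I_t -> R, \sum_i c i *: u i = 0 -> forall j, \sum_i c i * b i j = 0.
Proof.
move=> /dual_basis[phi [fin_phi phiE]].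
have [s sE] := choice fin_phi.
pose l := undup (flatten [seq s (u i) | i <- enum 'I_t]).
have lu i x : x \notin l -> phi x (u i) = 0.
  rewrite mem_undup => /flattenP xl; apply: (sE (u i)).2.
  apply/negP => xs; apply: xl; exists (s (u i)) => //.
  by apply/mapP; exists i; rewrite ?mem_enum.
exists (size l), (fun i j => phi (tnth (in_tuple l) j) (u i)), (tnth (in_tuple l)).
split=> [i|c cu j].
  rewrite [LHS](phiE _ l) ?undup_uniq // => [|x /lu //].
  exact: big_tnth.
rewrite -[RHS](linear0 (phi (tnth (in_tuple l) j))) -cu linear_sum.
by apply: eq_bigr => i _; rewrite linearZ.
Qed.

End ShortExact.

(** * Maximal partial functions, Baer's criterion, enough injectives *)

Lemma choice_on (X Y : Type) (g0 : X -> Y) (N : X -> Prop) (G : X -> Y -> Prop) :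
  (forall x, N x -> exists y, G x y) -> exists g : X -> Y, forall x, N x -> G x (g x).
Proof.
move=> NG; have [x|g gE] := @choice X Y (fun x y => N x -> G x y); last by exists g.
have [Nx|nNx] := pselect (N x); first by have [y] := NG x Nx; exists y.
by exists (g0 x).
Qed.

(** The form in which Zorn's lemma is used: a property of partial functions
    that can be checked on finitely many points of the domain at a time passes
    to unions of chains. *)
Lemma maximal_partial (X : choiceType) (Y : Type) (P : (X -> Prop) -> (X -> Y) -> Prop)
    (N0 : X -> Prop) (g0 : X -> Y) :
  P N0 g0 ->
  (forall N g, (forall l : seq X, (forall x, x \in l -> N x) ->
     exists N' g', [/\ P N' g', forall x, N' x -> N x, forall x, x \in l -> N' x
                     & forall x, N' x -> g' x = g x]) -> P N g) ->
  exists N g, [/\ P N g, forall x, N0 x -> N x, forall x, N0 x -> g x = g0 x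
    & forall N' g', P N' g' -> (forall x, N x -> N' x) ->
        (forall x, N x -> g' x = g x) -> forall x, N' x -> N x].
Proof.
move=> P0 Ploc.
pose le (p q : (X -> Prop) * (X -> Y)) :=
  (forall x, p.1 x -> q.1 x) /\ (forall x, p.1 x -> q.2 x = p.2 x).
have le_refl p : le p p by [].
have le_trans p q r : le p q -> le q r -> le p r.
  move=> [pq pqE] [qr qrE]; split=> x px; first exact/qr/pq.
  by rewrite qrE ?pqE //; apply: pq.
pose T := {p : (X -> Prop) * (X -> Y) | P p.1 p.2 /\ le (N0, g0) p}.
have t0 : T by exists (N0, g0).
pose Rle (s t : T) : bool := `[< le (sval s) (sval t) >].
have [s|r s t /asboolP rs /asboolP st|A totA|t tmax] := @ZL_preorder T t0 Rle.
- exact/asboolP.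
- by apply/asboolP; apply: le_trans rs st.
- have [[s0 As0]|A0] := pselect (exists s, A s); last first.
    by exists t0 => s As; case: A0; exists s.
  pose N x := exists2 s, A s & (sval s).1 x.
  have [g gE] : exists g : X -> Y, forall x, N x ->
      exists s, [/\ A s, (sval s).1 x & g x = (sval s).2 x].
    apply: (@choice_on X Y g0 N (fun x y =>
      exists s, [/\ A s, (sval s).1 x & y = (sval s).2 x])) => x [s As sx].
    by exists ((sval s).2 x), s.
  have gA s x : A s -> (sval s).1 x -> g x = (sval s).2 x.
    move=> As sx; have [|t [At tx ->]] := gE x; first by exists s.
    by case: (totA s t As At) => /asboolP[_ E]; rewrite E.
  have chain (l : seq X) : (forall x, x \in l -> N x) ->
      exists2 s, A s & forall x, x \in l -> (sval s).1 x.
    elim: l => [|x l IH] Nl; first by exists s0.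
    have [|s As sl] := IH; first by move=> y yl; apply: Nl; rewrite inE yl orbT.
    have [|t At tx] := Nl x; first by rewrite inE eqxx.
    have [/asboolP[st _]|/asboolP[ts _]] := totA s t As At.
      by exists t => // y; rewrite inE => /predU1P[->//|/sl/st].
    by exists s => // y; rewrite inE => /predU1P[->|/sl//]; apply: ts.
  have PN : P N g.
    apply: Ploc => l /chain[s As sl].
    exists (sval s).1, (sval s).2; split=> //; first exact: (svalP s).1.
      by move=> x sx; exists s.
    by move=> x sx; rewrite (gA s).
  have leN s : A s -> le (sval s) (N, g).
    by move=> As; split=> x sx /=; [exists s|apply: gA].
  have leN0 : le (N0, g0) (N, g) by apply: le_trans (leN s0 As0); apply: (svalP s0).2.
  by exists (exist _ (N, g) (conj PN leN0)) => s As; apply/asboolP/leN.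
case: t tmax => -[N g] [/= PN [NN0 gg0]] tmax; exists N, g; split=> // N' g' PN' NN' gg' x N'x.
have le' : le (N0, g0) (N', g').
  by split=> y Ny /=; [exact: NN' (NN0 y Ny)|rewrite gg'; [exact: gg0 Ny|exact: NN0 Ny]].
have := tmax (exist _ (N', g') (conj PN' le')).
by case/(_ (asboolT (conj NN' gg')))/asboolP => + _; apply.
Qed.

Section Injective.
Variable R : pzRingType.
Implicit Types A B E M : lmodType R.

Definition linear_on B E (N : B -> Prop) (g : B -> E) : Prop :=
  forall a x y, N x -> N y -> g (a *: x + y) = a *: g x + g y.

Definition baer E : Prop := forall (J : R^o -> Prop) (f : R^o -> E),
  submodP J -> linear_on J f -> exists e, forall x, J x -> f x = (x : R) *: e.

(** A partial extension defined on [N] and missing a point [b] meets the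
    multiples of [b] in an ideal, namely the scalars [r] with [r *: b] in [N];
    Baer's condition on that ideal supplies the value at [b]. *)
Lemma baer_injective E : baer E -> injective_module E.
Proof.
move=> baerE A B i f ii.
pose P (N : B -> Prop) (g : B -> E) := [/\ submodP N, linear_on N g &
  forall a, N (i a) /\ g (i a) = f a].
have [g0 g0E] : exists g0 : B -> E, forall b, (exists a, i a = b) ->
    exists a, i a = b /\ g0 b = f a.
  apply: (@choice_on B E (fun=> 0) _ (fun b e => exists a, i a = b /\ e = f a)).
  by move=> b [a ab]; exists (f a), a.
have g0i a : g0 (i a) = f a.
  by have [|a' [/ii-> //]] := g0E (i a); exists a.
have [||N [g [[subN lg gi] _ _ maxN]]] := @maximal_partial B E P (fun b => exists a, i a = b) g0.
- split=> [|a x y [x' <-] [y' <-]|a].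
  + split=> [|a x y [x' <-] [y' <-]]; first by exists 0; rewrite linear0.
    by exists (a *: x' + y'); rewrite linearP.
  + by rewrite -linearP !g0i linearP.
  + by split=> //; exists a.
- move=> N g loc; split=> [|a x y Nx Ny|a].
  + split=> [|a x y Nx Ny].
      have [//|N' [g' [[[N'0 _] _ _] N'N _ _]]] := loc [::]; exact: N'N.
    have [|N' [g' [[sub' _ _] N'N N'l _]]] := loc [:: x; y].
      by move=> z; rewrite !inE => /orP[]/eqP->.
    by apply/N'N/sub'.2; apply: N'l; rewrite !inE eqxx ?orbT.
  + have [|N' [g' [[sub' lg' _] N'N N'l g'E]]] := loc [:: x; y].
      by move=> z; rewrite !inE => /orP[]/eqP->.
    have N'x : N' x by apply: N'l; rewrite !inE eqxx.
    have N'y : N' y by apply: N'l; rewrite !inE eqxx orbT.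
    by rewrite -!g'E // ?lg' //; apply: sub'.2.
  + have [//|N' [g' [[_ _ gi'] N'N _ g'E]]] := loc [::].
    have [N'i <-] := gi' a; split; [exact: N'N|by rewrite g'E].
have [allN|] := pselect (forall b, N b).
  have [|h hE] := @linear_ex R B E g; first by move=> a x y; apply: lg.
  by exists h => a /=; rewrite hE; apply: (gi a).2.
move/existsNP => [b nNb]; case: nNb.
have [||e eE] := baerE (fun r : R => N (r *: b)) (fun r : R => g (r *: b)).
- split=> [|a x y Nx Ny]; first by rewrite scale0r; apply: submodP0.
  by rewrite scalerDl -scalerA; apply: subN.2.
- by move=> a x y Nx Ny; rewrite scalerDl -scalerA lg.
pose N' x := exists n (r : R), N n /\ x = n + r *: b.
have [g' g'E] : exists g' : B -> E, forall x, N' x ->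
    exists n r, [/\ N n, x = n + r *: b & g' x = g n + r *: e].
  apply: (@choice_on B E (fun=> 0) _ (fun x e' =>
    exists n r, [/\ N n, x = n + r *: b & e' = g n + r *: e])).
  by move=> x [n [r [Nn ->]]]; exists (g n + r *: e), n, r.
have gB x y : N x -> N y -> g (x - y) = g x - g y.
  by move=> Nx Ny; rewrite addrC -scaleN1r lg // scaleN1r addrC.
have g'nr n r : N n -> g' (n + r *: b) = g n + r *: e.
  move=> Nn; have [|n' [r' [Nn' eq_nr ->]]] := g'E (n + r *: b); first by exists n, r.
  have eq_b : n - n' = (r' - r) *: b.
    apply/eqP; rewrite subr_eq addrC scalerBl addrA -eq_nr addrK.
    by [].
  have Nrb : N ((r' - r) *: b) by rewrite -eq_b; apply: submodPB.
  have := eE _ Nrb; rewrite -eq_b gB // scalerBl => /eqP.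
  by rewrite subr_eq => /eqP->; rewrite addrAC subrK addrC.
have subN' : submodP N'.
  split=> [|a _ _ [n [r [Nn ->]]] [n' [r' [Nn' ->]]]].
    by exists 0, 0; rewrite scale0r addr0; split=> //; apply: submodP0.
  exists (a *: n + n'), (a * r + r'); split; first exact: subN.2.
  by rewrite scalerDr addrACA scalerDl scalerA.
apply: (maxN N' g') => [||n Nn|].
- split=> // [a _ _ [n [r [Nn ->]]] [n' [r' [Nn' ->]]]|a].
    rewrite scalerDr addrACA scalerA -scalerDl !g'nr ?lg //; last exact: subN.2.
    by rewrite scalerDr addrACA scalerDl scalerA.
  have [Nia gia] := gi a; split; first by exists (i a), 0; rewrite scale0r addr0.
  by rewrite -[i a]addr0 -(scale0r b) g'nr // scale0r addr0.
- by move=> n Nn; exists n, 0; rewrite scale0r addr0.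
- by rewrite -[n]addr0 -(scale0r b) g'nr // !scale0r !addr0.
- by exists 0, 1; rewrite add0r scale1r; split=> //; apply: submodP0.
Qed.

End Injective.

Lemma injective_retract (R : pzRingType) (E M : lmodType R)
    (s : {linear E -> M}) (r : {linear M -> E}) :
  (forall x, r (s x) = x) -> injective_module M -> injective_module E.
Proof.
move=> rs iM A B i f ii; have [g gE] := iM A B i (s \o f) ii.
by exists (r \o g) => x; have /= -> := gE x; rewrite rs.
Qed.

(** Coinduction turns an injective abelian group into an injective module,
    since maps into the coinduced module are additive maps into the group. *)
Section Coinduction.
Variables (R : pzRingType) (D : zmodType).

Record coind := Coind {
  coind_fun :> R -> D;
  coind_add : forall x y, coind_fun (x + y) = coind_fun x + coind_fun y }.

Lemma coind_ext (f g : coind) : (forall x, f x = g x) -> f = g.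
Proof.
case: f g => [f fD] [g gD] /= /funext fg; rewrite -{}fg in gD *.
by rewrite (Prop_irrelevance fD gD).
Qed.

HB.instance Definition _ := gen_eqMixin coind.
HB.instance Definition _ := gen_choiceMixin coind.

Lemma coind_zero_add (x y : R) : (0 : D) = 0 + 0.
Proof. by rewrite addr0. Qed.
Lemma coind_plus_add (f g : coind) x y : f (x + y) + g (x + y) = f x + g x + (f y + g y).
Proof. by rewrite !coind_add addrACA. Qed.
Lemma coind_opp_add (f : coind) x y : - f (x + y) = - f x + - f y.
Proof. by rewrite coind_add opprD. Qed.
Lemma coind_scale_add a (f : coind) x y : f ((x + y) * a) = f (x * a) + f (y * a).
Proof. by rewrite mulrDl coind_add. Qed.

Definition coind_zero := Coind coind_zero_add.
Definition coind_plus f g := Coind (coind_plus_add f g).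
Definition coind_opp f := Coind (coind_opp_add f).
Definition coind_scale a f := Coind (coind_scale_add a f).

Lemma coind_addA : associative coind_plus.
Proof. by move=> f g h; apply: coind_ext => x /=; rewrite addrA. Qed.
Lemma coind_addC : commutative coind_plus.
Proof. by move=> f g; apply: coind_ext => x /=; rewrite addrC. Qed.
Lemma coind_add0 : left_id coind_zero coind_plus.
Proof. by move=> f; apply: coind_ext => x /=; rewrite add0r. Qed.
Lemma coind_addN : left_inverse coind_zero coind_opp coind_plus.
Proof. by move=> f; apply: coind_ext => x /=; rewrite addNr. Qed.

HB.instance Definition _ :=
  GRing.isZmodule.Build coind coind_addA coind_addC coind_add0 coind_addN.

Lemma coind_scaleA a b (f : coind) :
  coind_scale a (coind_scale b f) = coind_scale (a * b) f.
Proof. by apply: coind_ext => x /=; rewrite mulrA. Qed.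
Lemma coind_scale1 : left_id 1 coind_scale.
Proof. by move=> f; apply: coind_ext => x /=; rewrite mulr1. Qed.
Lemma coind_scaleDr : right_distributive coind_scale +%R.
Proof. by move=> a f g; apply: coind_ext. Qed.
Lemma coind_scaleDl f : {morph coind_scale^~ f : a b / a + b}.
Proof. by move=> a b; apply: coind_ext => x /=; rewrite mulrDr coind_add. Qed.

HB.instance Definition _ := GRing.Zmodule_isLmodule.Build R coind
  coind_scaleA coind_scale1 coind_scaleDr coind_scaleDl.

End Coinduction.

Local Notation "M ^z" := (zmodule M) : type_scope.

Lemma additive_int_linear (U V : zmodType) (f : U -> V) :
  (forall x y, f (x + y) = f x + f y) -> linear (f : U^z -> V^z).
Proof.
move=> fD.
have f0 : f 0 = 0.
  by have /esym/eqP := fD 0 0; rewrite addr0 -subr_eq0 addrK => /eqP.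
have fN x : f (- x) = - f x.
  by apply/eqP; rewrite -addr_eq0 -fD addNr f0.
have fMn x n : f (x *+ n) = f x *+ n.
  by elim: n => [|n IH]; rewrite ?mulr0n // !mulrSr fD IH.
move=> a x y; rewrite fD; congr (_ + _); rewrite !scalezrE.
by case: a => n; rewrite ?NegzE ?mulrNz ?fN -!pmulrn fMn.
Qed.

Lemma coind_injective (R : pzRingType) (D : lmodType int) :
  injective_module D -> injective_module (coind R D).
Proof.
move=> iD A B i f ii.
pose i' : {linear A^z -> B^z} := lin_pack (additive_int_linear (linearD i)).
have fD (x y : A) : f (x + y) 1 = f x 1 + f y 1 by rewrite linearD.
have [|f' f'E] := @linear_ex _ A^z D (fun x => f x 1).
  move=> a x y; have := additive_int_linear (V := D) fD a x y.
  by rewrite !scalezrE => ->; rewrite -scaler_int intz.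
have [g gE] := iD _ _ i' f' ii.
have gD (b : B) x y : g ((x + y) *: b) = g (x *: b) + g (y *: b).
  by rewrite scalerDl linearD.
have [|h hE] := @linear_ex R B (coind R D) (fun b => Coind (gD b)).
  by move=> a x y; apply: coind_ext => r /=; rewrite scalerDr scalerA linearD.
exists h => a; apply: coind_ext => r; rewrite /= hE /=.
rewrite -linearZ; have /= -> := gE (r *: a); rewrite f'E linearZ.
by rewrite /GRing.scale /= mul1r.
Qed.

(** Ideals of the integers are principal, so Baer's condition for them amounts
    to a single division. *)
Lemma divisible_injective (D : lmodType int) :
  (forall (n : int) (d : D), n != 0 -> exists e, n *: e = d) -> injective_module D.
Proof.
move=> divD; apply: baer_injective => J f subJ lf.
have f0 : f 0 = 0.
  have J0 := submodP0 subJ.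
  by have /esym/eqP := lf 1 0 0 J0 J0; rewrite scaler0 addr0 scale1r -subr_eq0 addrK => /eqP.
have [[x [Jx x0]]|J0] := pselect (exists x, J x /\ x != 0); last first.
  exists 0 => x Jx; rewrite scaler0; have [->//|x0] := eqVneq x 0.
  by case: J0; exists x.
have ex_k : exists k : nat, `[< J k%:Z /\ (0 < k)%N >].
  exists `|x|%N; apply/asboolP; rewrite absz_gt0; split=> //.
  rewrite abszE; case: (ger0P x) => _ //; exact: (submodPN subJ Jx).
case: (ex_minnP ex_k) => k /asboolP[Jk k0] kmin.
have [e eE] : exists e, k%:Z *: e = f k%:Z by apply: divD; rewrite eqz_nat -lt0n.
exists e => y Jy.
have Jmul (n : int) : J (n * k%:Z) by apply: (submodPZ subJ n Jk).
have y_mod : (y %% k)%Z = 0.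
  have k_n0 : (k : int) != 0 by rewrite eqz_nat -lt0n.
  have Jmod : J (y %% k)%Z.
    have -> : (y %% k)%Z = y - (y %/ k)%Z * k by rewrite {2}(divz_eq y k) addrC addKr.
    exact: submodPB.
  have : (0 <= (y %% k)%Z) && ((y %% k)%Z < k) by rewrite modz_ge0 // ltz_pmod.
  case: (y %% k)%Z Jmod => // m Jm /andP[_]; rewrite ltz_nat => mk.
  case: m Jm mk => // m Jm mk; have := kmin m.+1 (asboolT (conj Jm isT)).
  by rewrite leqNgt mk.
have -> : y = (y %/ k)%Z * k by rewrite {1}(divz_eq y k) y_mod addr0.
have /= := lf (y %/ k)%Z k%:Z 0 Jk (submodP0 subJ).
by rewrite !addr0 f0 addr0 => ->; rewrite -eE scalerA.
Qed.

(** An abelian group is [Z^(X) / K], hence embeds in the divisible group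
    [Q^(X) / K]. *)
Lemma divisible_embedding (A : lmodType int) :
  exists (D : lmodType int) (i : {linear A -> D}), injective_module D /\ injective i.
Proof.
have [p pE] := @dsum_universal _ A (fun=> int^o : lmodType int) A (fun a => scale_on a).
have sp : surjective_map p.
  move=> a; exists (@dinj _ A (fun=> int^o : lmodType int) a 1).
  by rewrite pE /= scale1r.
pose Q_ (a : A) : lmodType int := zmodule rat.
have rat_lin : linear (fun n : int^o => (n : int)%:~R : zmodule rat).
  move=> c x y; have -> : c *: x + y = (c * (x : int) + (y : int))%R by [].
  by rewrite scalezrE intrD intrM mulrzl.
have [j jE] := @dsum_universal _ A (fun=> int^o : lmodType int) (dsum Q_)
  (fun a => @dinj _ A Q_ a \o lin_pack rat_lin).
have jcoord a x : dcoord a (j x) = ((dcoord a x : int)%:~R : rat).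
  pose c1 : {linear _ -> _} := @dcoord _ A Q_ a \o j.
  pose c2 : {linear _ -> _} := lin_pack rat_lin \o
    @dcoord _ A (fun=> int^o : lmodType int) a.
  apply: (dsum_map_ext (h := c1) (h' := c2)) => b n /=.
  rewrite jE /=; have [->|ab] := eqVneq a b; first by rewrite !dinj_same.
  by rewrite !dinj_other.
have ji : injective j.
  apply: lin_inj0 => x jx; apply: dsum_ext => a; rewrite linear0.
  by have := jcoord a x; rewrite jx linear0 => /esym/eqP; rewrite intr_eq0 => /eqP.
pose N y := exists x, p x = 0 /\ j x = y.
have [|D [pi [spi piE]]] := @quotient_ex _ _ N.
  split=> [|c _ _ [x [px <-]] [y [py <-]]]; first by exists 0; rewrite !linear0.
  by exists (c *: x + y); rewrite !linearP /= px py scaler0 addr0.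
have [|i iE] := @factor_surj _ _ _ _ p (pi \o j) sp.
  by move=> x px /=; apply/piE; exists x.
exists D, i; split.
  apply: divisible_injective => n d n0.
  have [y <-] := spi d; have [s [us ys]] := dsupp_ex y.
  have [|z zE] := @dsum_make _ _ Q_ (fun a => (dcoord a y : rat) / n%:~R) s.
    by move=> a /ys ->; rewrite mul0r.
  exists (pi z); rewrite -linearZ /=; congr (pi _); apply: dsum_ext => a.
  by rewrite linearZ /= zE scalezrE -mulrzr divfK ?intr_eq0.
apply: lin_inj0 => a ia; have [x xa] := sp a; rewrite -xa in ia *.
by move: ia; rewrite iE /= => /piE[x' [px' /ji <-]].
Qed.

(** A divisible group containing the additive group of [M] coinduces an
    injective module, which receives [M] through the orbit maps. *)
Theorem injective_embedding (R : pzRingType) (M : lmodType R) :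
  exists (E : lmodType R) (i : {linear M -> E}), injective_module E /\ injective i.
Proof.
have [D [i [iD ii]]] := divisible_embedding (zmodule M).
have iZ (m : M) (x y : R) : i ((x + y) *: m) = i (x *: m) + i (y *: m).
  by rewrite scalerDl linearD.
have [|h hE] := @linear_ex R M (coind R D) (fun m => Coind (iZ m)).
  by move=> a x y; apply: coind_ext => r /=; rewrite scalerDr scalerA linearD.
exists (coind R D), h; split; first exact: coind_injective.
move=> x y; rewrite !hE => /(congr1 (fun f : coind R D => f 1)) /=.
by rewrite !scale1r => /ii.
Qed.

Lemma cosyzygy_ex (R : pzRingType) (M : lmodType R) :
  exists (E C : lmodType R) (i : {linear M -> E}) (p : {linear E -> C}),
    injective_module E /\ ses i p.
Proof.
have [E [i [iE ii]]] := injective_embedding M.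
by have [C [p [sp ip]]] := cokernel_ex i; exists E, C, i, p.
Qed.

(** * Vanishing of Ext by dimension shifting *)

Section ExtVanishing.
Variable R : pzRingType.
Implicit Types A B C E I K M P : lmodType R.

(** The vanishing of Ext^1, tested on all short exact sequences ending in [M]
    and not only on projective presentations: in this form it is inherited
    from either variable without a choice of resolution. *)
Definition ext1_zero M E : Prop :=
  forall A B (i : {linear A -> B}) (p : {linear B -> M}), ses i p ->
  forall f : {linear A -> E}, exists g : {linear B -> E}, forall a, g (i a) = f a.

(** [ext_zero k M E] stands for the vanishing of Ext^(k+1)(M, E). *)
Fixpoint ext_zero k M E : Prop :=
  if k is k'.+1 then
    forall K P (i : {linear K -> P}) (p : {linear P -> M}),
      projective_module P -> ses i p -> ext_zero k' K E
  else ext1_zero M E.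

Lemma ses_factor_sub A B C M (i : {linear A -> B}) (p : {linear B -> C})
    (f : {linear M -> B}) : ses i p -> (forall m, p (f m) = 0) ->
  exists g : {linear M -> A}, forall m, i (g m) = f m.
Proof. by case=> ii ip _ pf; apply: factor_inj => // m; apply/ip. Qed.

Lemma ses_factor_quot A B C M (i : {linear A -> B}) (p : {linear B -> C})
    (f : {linear B -> M}) : ses i p -> (forall a, f (i a) = 0) ->
  exists g : {linear C -> M}, forall b, g (p b) = f b.
Proof. by case=> _ ip sp fi; apply: factor_surj => // b /ip[a <-]. Qed.

Lemma ext1_lift M E B C (i : {linear E -> B}) (p : {linear B -> C}) :
  ext1_zero M E -> ses i p -> forall f : {linear M -> C},
  exists g : {linear M -> B}, forall m, p (g m) = f m.
Proof.
move=> ME es f; have [ii ip sp] := es.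
(* extend the identity of E to the pullback of p along f *)
have [|d dE] := @linear_ex R (B * M)%type C (fun x => p x.1 - f x.2).
  by move=> a x y /=; rewrite !linearP /= scalerBr scalerN addrACA.
have [K [k [ki kd]]] := kernel_ex d.
have kP x : p (k x).1 = f (k x).2.
  by apply/subr0_eq; rewrite -dE; apply/kd; exists x.
have [|pr2 pr2E] := @linear_ex R K M (fun x => (k x).2).
  by move=> a x y; rewrite linearP.
have [|e0 e0E] := @linear_ex R E (B * M)%type (fun x => (i x, 0)).
  by move=> a x y; congr (_, _); rewrite ?linearP //= scaler0 addr0.
have [|e eE] := factor_inj (f := e0) ki.
  by move=> x; apply/kd; rewrite dE e0E /= linear0 subr0 (ses_comp0 ip).
have eses : ses e pr2.
  split.
  - apply: lin_inj0 => x ex; apply: ii; rewrite linear0.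
    by have := congr1 fst (eE x); rewrite ex linear0 e0E /= => <-.
  - move=> x; rewrite pr2E; split=> [x2|[y <-]]; last by rewrite eE e0E.
    have /ip[y yx] : p (k x).1 = 0 by rewrite kP x2 linear0.
    by exists y; apply: ki; rewrite eE e0E yx -x2; case: (k x).
  - move=> m; have [b bm] := sp (f m).
    have /kd[x xE] : d (b, m) = 0 by rewrite dE /= bm subrr.
    by exists x; rewrite pr2E xE.
have [g gE] := ME _ _ e pr2 eses idfun.
have [|h hE] := @linear_ex R K B (fun x => (k x).1 - i (g x)).
  by move=> a x y; rewrite !linearP /= scalerBr scalerN addrACA.
have [|h' h'E] := ses_factor_quot (f := h) eses.
  by move=> x; rewrite hE gE eE e0E subrr.
exists h' => m; have [x <-] : exists x, pr2 x = m by case: eses.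
by rewrite h'E hE linearB /= (ses_comp0 ip) subr0 kP pr2E.
Qed.

(** Conversely, lifting against one injective presentation of [E] suffices. *)
Lemma ext1_of_lift M E I C (i : {linear E -> I}) (p : {linear I -> C}) :
  injective_module I -> ses i p ->
  (forall f : {linear M -> C}, exists g : {linear M -> I}, forall m, p (g m) = f m) ->
  ext1_zero M E.
Proof.
move=> iI es lift A B u v uv f; have [ui vu _] := uv; have [ii ip _] := es.
have [F FE] := iI _ _ u (i \o f) ui; rewrite /= in FE.
have [|h hE] := ses_factor_quot (f := p \o F) uv.
  by move=> a /=; have /= -> := FE a; rewrite (ses_comp0 ip).
have [g gE] := lift h.
have [|G GE] := ses_factor_sub (f := F \- (g \o v)) es.
  by move=> b /=; rewrite linearB /= gE hE subrr.
exists G => a; apply: ii; rewrite GE /= (ses_comp0 vu) linear0 subr0.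
exact: FE.
Qed.

(** Extending along one projective presentation of [M] suffices: composed with
    an injective presentation of [E], extension problems over the syzygy become
    the lifting problems of the previous lemma. *)
Lemma ext1_of_extension K P M E (i : {linear K -> P}) (p : {linear P -> M}) :
  projective_module P -> ses i p ->
  (forall f : {linear K -> E}, exists g : {linear P -> E}, forall x, g (i x) = f x) ->
  ext1_zero M E.
Proof.
move=> pP es ext; have [I [C [u [v [iI uv]]]]] := cosyzygy_ex E.
apply: (ext1_of_lift iI uv) => f; have [_ vu sv] := uv; have [_ ip sp] := es.
have [l lE] := pP _ _ v (f \o p) sv; rewrite /= in lE.
have [|f' f'E] := ses_factor_sub (f := l \o i) uv.
  by move=> x /=; have /= -> := lE (i x); rewrite (ses_comp0 ip) linear0.
have [g gE] := ext f'.
have [|h hE] := ses_factor_quot (f := l \- (u \o g)) es.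
  by move=> x /=; rewrite gE f'E /= subrr.
exists h => m; have [x <-] := sp m; rewrite hE linearB /= (ses_comp0 vu) subr0.
exact: lE.
Qed.

(** Ext^2(M, E) can be computed from a syzygy of M or from a cosyzygy of E. *)
Lemma ext1_balance K P M E I C (i : {linear K -> P}) (p : {linear P -> M})
    (u : {linear E -> I}) (v : {linear I -> C}) :
  projective_module P -> injective_module I -> ses i p -> ses u v ->
  ext1_zero K E <-> ext1_zero M C.
Proof.
move=> pP iI ip uv; have [ii _ _] := ip; have [_ _ sv] := uv; split=> [KE|MC].
  apply: (ext1_of_extension pP ip) => f.
  have [g gE] := ext1_lift KE uv f.
  have [h hE] := iI _ _ i g ii.
  by exists (v \o h) => x /=; have /= -> := hE x.
apply: (ext1_of_lift iI uv) => f.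
have [g gE] := MC _ _ i p ip f.
have [h hE] := pP _ _ v g sv.
by exists (h \o i) => x /=; have /= -> := hE (i x).
Qed.

Lemma ext_zero_cosyzygy k M E I C (u : {linear E -> I}) (v : {linear I -> C}) :
  injective_module I -> ses u v -> ext_zero k.+1 M E <-> ext_zero k M C.
Proof.
move=> iI uv; elim: k M => [|k IH] M; last first.
  by split=> H K P i p pP ip; apply/IH/(H _ _ i p).
split=> [H|H K P i p pP ip]; last exact/(ext1_balance pP iI ip uv).
have [K [P [i [p [pP ip]]]]] := syzygy_ex M.
exact/(ext1_balance pP iI ip uv)/(H _ _ i p).
Qed.

(** One projective presentation decides what the definition asks of all of
    them: dimension shifting in [E] does not see the presentation. *)
Lemma ext_zero_syzygy k K P M E (i : {linear K -> P}) (p : {linear P -> M}) :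
  projective_module P -> ses i p -> ext_zero k.+1 M E <-> ext_zero k K E.
Proof.
move=> pP ip; split=> [H|]; first exact: (H _ _ i p).
have [I [C [u [v [iI uv]]]]] := cosyzygy_ex E.
elim: k E I C u v iI uv => [|k IH] E I C u v iI uv KE.
  by apply/(ext_zero_cosyzygy 0 M iI uv)/(ext1_balance pP iI ip uv).
have [I' [C' [u' [v' [iI' uv']]]]] := cosyzygy_ex C.
apply/(ext_zero_cosyzygy _ M iI uv)/(IH _ _ _ _ _ iI' uv').
exact/(ext_zero_cosyzygy _ K iI uv).
Qed.

(** In the long exact sequence of the second variable, the obstruction to
    lifting a map from a syzygy of [M] to [C] lies in Ext^2(M, A). *)
Lemma ext_zero_quot_r k M A B C (i : {linear A -> B}) (p : {linear B -> C}) :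
  ses i p -> ext_zero k M B -> ext_zero k.+1 M A -> ext_zero k M C.
Proof.
move=> ip; elim: k M => [|k IH] M MB MA.
  have [K [P [u [v [pP uv]]]]] := syzygy_ex M.
  apply: (ext1_of_extension pP uv) => f.
  have [g gE] := ext1_lift (MA _ _ u v pP uv) ip f.
  have [h hE] := MB _ _ u v uv g.
  by exists (p \o h) => x /=; rewrite hE gE.
move=> K P u v pP uv; apply: IH; first exact: (MB _ _ u v).
exact: (MA _ _ u v).
Qed.

Lemma ext_zero_sub_r k M A B C (i : {linear A -> B}) (p : {linear B -> C}) :
  ses i p -> ext_zero k.+1 M B -> ext_zero k M C -> ext_zero k.+1 M A.
Proof.
move=> ip; elim: k M => [|k IH] M MB MC; last first.
  move=> K P u v pP uv; apply: IH; [exact: (MB _ _ u v)|exact: (MC _ _ u v)].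
move=> K P u v pP uv X Y x y xy f; have [ii ipe sp] := ip.
have [F FE] := MB _ _ u v pP uv _ _ x y xy (i \o f).
have [|h hE] := ses_factor_quot (f := p \o F) xy.
  by move=> a /=; rewrite FE /= (ses_comp0 ipe).
have [h' h'E] := MC _ _ u v uv h.
have [l lE] := pP _ _ p h' sp.
have [|G GE] := ses_factor_sub (f := F \- (l \o (u \o y))) ip.
  by move=> b /=; rewrite linearB /=; have /= -> := lE (u (y b)); rewrite h'E hE subrr.
exists G => a; apply: ii; have [_ yx _] := xy.
by rewrite GE /= FE /= (ses_comp0 yx) !linear0 addr0.
Qed.

Lemma ext_zero_sub_l k E A B C (i : {linear A -> B}) (p : {linear B -> C}) :
  ses i p -> ext_zero k B E -> ext_zero k.+1 C E -> ext_zero k A E.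
Proof.
move=> ip; elim: k E => [|k IH] E BE CE;
  have [I [E' [u [v [iI uv]]]]] := cosyzygy_ex E.
  apply: (ext1_of_lift iI uv) => f.
  have [g gE] := (ext_zero_cosyzygy 0 C iI uv).1 CE _ _ i p ip f.
  have [h hE] := ext1_lift BE uv g.
  by exists (h \o i) => a /=; rewrite hE gE.
apply/(ext_zero_cosyzygy _ _ iI uv)/IH; exact/(ext_zero_cosyzygy _ _ iI uv).
Qed.

Definition pd_le n M : Prop := forall E, ext_zero n M E.
Definition id_le n E : Prop := forall M, ext_zero n M E.

Lemma ses_section A B C (i : {linear A -> B}) (p : {linear B -> C}) (s : {linear C -> B}) :
  ses i p -> (forall c, p (s c) = c) -> exists r : {linear B -> A}, forall a, r (i a) = a.
Proof.
move=> ip sE; have [ii ipe _] := ip.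
have [|r rE] := ses_factor_sub (f := idfun \- (s \o p)) ip.
  by move=> b /=; rewrite linearB /= sE subrr.
by exists r => a; apply: ii; rewrite rE /= (ses_comp0 ipe) linear0 subr0.
Qed.

Lemma ses_retraction A B C (i : {linear A -> B}) (p : {linear B -> C}) (r : {linear B -> A}) :
  ses i p -> (forall a, r (i a) = a) -> exists s : {linear C -> B}, forall c, p (s c) = c.
Proof.
move=> ip rE; have [ii ipe sp] := ip.
have [|s sE] := ses_factor_quot (f := idfun \- (i \o r)) ip.
  by move=> a /=; rewrite rE subrr.
by exists s => c; have [b <-] := sp c; rewrite sE linearB /= (ses_comp0 ipe) subr0.
Qed.

Lemma ext1_zero_projective P E : projective_module P -> ext1_zero P E.
Proof.
move=> pP A B i p ip f; have [_ _ sp] := ip.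
have [s sE] := projective_section pP sp.
by have [r rE] := ses_section ip sE; exists (f \o r) => a /=; rewrite rE.
Qed.

Lemma ext1_zero_injective M E : injective_module E -> ext1_zero M E.
Proof.
by move=> iE A B i p [ii _ _] f; have [g gE] := iE _ _ i f ii; exists g.
Qed.

Lemma pd_le0 M : pd_le 0 M <-> projective_module M.
Proof.
split=> [M0|pM E]; last exact: ext1_zero_projective.
have [K [P [i [p [pP ip]]]]] := syzygy_ex M.
have [s sE] := ext1_lift (M0 K) ip idfun.
exact: (projective_retract sE pP).
Qed.

Lemma id_le0 E : id_le 0 E <-> injective_module E.
Proof.
split=> [E0|iE M]; last exact: ext1_zero_injective.
have [I [C [i [p [iI ip]]]]] := cosyzygy_ex E.
have [r rE] := E0 C _ _ i p ip idfun.
exact: (injective_retract rE iI).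
Qed.

Lemma pd_leS n K P M (i : {linear K -> P}) (p : {linear P -> M}) :
  projective_module P -> ses i p -> pd_le n.+1 M <-> pd_le n K.
Proof. by move=> pP ip; split=> H E; apply/(ext_zero_syzygy n E pP ip). Qed.

Lemma id_leS n E I C (i : {linear E -> I}) (p : {linear I -> C}) :
  injective_module I -> ses i p -> id_le n.+1 E <-> id_le n C.
Proof. by move=> iI ip; split=> H M; apply/(ext_zero_cosyzygy n M iI ip). Qed.

Lemma pd_le_succ n M : pd_le n M -> pd_le n.+1 M.
Proof.
elim: n M => [|k IHk] M Mk; have [K [P [i [p [pP ip]]]]] := syzygy_ex M;
  apply/(pd_leS _ pP ip); last by apply/IHk/(pd_leS _ pP ip).
have [s sE] := ext1_lift (Mk K) ip idfun.
have [r rE] := ses_section ip sE.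
exact/pd_le0/(projective_retract rE).
Qed.

Lemma pd_le_mono n m M : (n <= m)%N -> pd_le n M -> pd_le m M.
Proof. by move=> /subnK <-; elim: (m - n)%N => [//|j IH] /IH/pd_le_succ. Qed.

Lemma id_le_succ n E : id_le n E -> id_le n.+1 E.
Proof.
elim: n E => [|k IHk] E Ek; have [I [C [i [p [iI ip]]]]] := cosyzygy_ex E;
  apply/(id_leS _ iI ip); last by apply/IHk/(id_leS _ iI ip).
have [r rE] := Ek C _ _ i p ip idfun.
have [s sE] := ses_retraction ip rE.
exact/id_le0/(injective_retract sE).
Qed.

Lemma id_le_mono n m E : (n <= m)%N -> id_le n E -> id_le m E.
Proof. by move=> /subnK <-; elim: (m - n)%N => [//|j IH] /IH/id_le_succ. Qed.

End ExtVanishing.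

(** * Pure exact complexes of projectives are contractible *)

(** Purity in equational form: finite systems of relations that hold after
    [p] can be solved before [p] without changing the images.  Since [p] need
    not be onto, this also applies to the differential of a complex. *)
Definition pure_map (R : pzRingType) (B C : lmodType R) (p : {linear B -> C}) : Prop :=
  forall s t (c : 'I_s -> 'I_t -> R) (u : 'I_t -> B),
  (forall a, \sum_i c a i *: p (u i) = 0) ->
  exists v, (forall i, p (v i) = p (u i)) /\ forall a, \sum_i c a i *: v i = 0.

(** Finite lists of natural numbers can be enumerated, so closing a point under
    an operation from finite lists to finite lists stays countable. *)
Lemma countable_closure (I : choiceType) (N : seq I -> seq I) (i0 : I) :
  exists en : nat -> I, (exists n, en n = i0) /\
    forall l, (forall i, i \in l -> exists n, en n = i) ->
    forall i, i \in N l -> exists n, en n = i.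
Proof.
pose next (f : nat -> I) (n : nat) : I :=
  if unpickle n is Some (s, m) then nth i0 (map f s ++ N (map f s)) m else i0.
pose f k := iter k next (fun=> i0).
have nextE g (s : seq nat) i : i \in map g s ++ N (map g s) -> exists n, next g n = i.
  move=> is_; exists (pickle (s, index i (map g s ++ N (map g s)))).
  by rewrite /next pickleK nth_index.
have f_mono k j n : exists m, f (j + k)%N m = f k n.
  elim: j => [|j [m <-]]; first by exists n.
  by rewrite addSn; apply: (nextE _ [:: m]); rewrite /= inE eqxx.
have f_le k k' n : (k <= k')%N -> exists m, f k' m = f k n.
  by move=> /subnK <-; apply: f_mono.
exists (fun n => if unpickle n is Some (k, m) then f k m else i0); split.
  by exists (pickle (0%N, 0%N)); rewrite pickleK.
move=> l lE i iN.
have [k [s ls]] : exists k s, l = map (f k) s.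
  elim: l lE {iN} => [|x l IH] lE; first by exists 0%N, [::].
  have [|k [s ->]] := IH; first by move=> y yl; apply: lE; rewrite inE yl orbT.
  have [k' [m xE]] : exists k' m, f k' m = x.
    have [|n <-] := lE x; first by rewrite inE eqxx.
    by case: (unpickle n) => [[k' m]|]; [exists k', m|exists 0%N, 0%N].
  have [g gE] := choice (fun n => f_le k (maxn k k') n (leq_maxl _ _)).
  have [m' m'E] := f_le k' (maxn k k') m (leq_maxr _ _).
  exists (maxn k k'), (m' :: map g s) => /=; rewrite m'E xE -map_comp.
  by congr (_ :: _); apply: eq_map => n /=; rewrite gE.
rewrite ls in iN.
have [n <-] : exists n, f k.+1 n = i by apply: (nextE _ s); rewrite mem_cat iN orbT.
by exists (pickle (k.+1, n)); rewrite pickleK.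
Qed.

(** A projective [Q], given by coordinates, with a differential [d] that is
    exact up to an endomorphism [kappa] fixing the boundaries.  In the
    application [Q] is a complex placed in degrees 0, 1, ..., exact in positive
    degrees, and [kappa] is the projection onto its positive part. *)
Record coord_complex (R : pzRingType) := CoordComplex {
  cc_mod :> lmodType R;
  cc_index : choiceType;
  cc_vec : cc_index -> cc_mod;
  cc_coord : cc_index -> {linear cc_mod -> R^o};
  cc_diff : {linear cc_mod -> cc_mod};
  cc_proj : {linear cc_mod -> cc_mod};
  cc_fin : forall q, exists s : seq cc_index,
    uniq s /\ forall i, i \notin s -> cc_coord i q = 0;
  cc_expand : forall q (s : seq cc_index), uniq s ->
    (forall i, i \notin s -> cc_coord i q = 0) ->
    q = \sum_(i <- s) (cc_coord i q : R) *: cc_vec i;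
  cc_diff2 : forall q, cc_diff (cc_diff q) = 0;
  cc_proj_diff : forall q, cc_proj (cc_diff q) = cc_diff q;
  cc_exact : forall q, cc_diff q = 0 -> exists z, cc_proj q = cc_diff z;
  cc_pure : pure_map cc_diff }.

Section CoordComplex.
Variables (R : pzRingType) (Q : coord_complex R).
Local Notation I := (cc_index Q).
Local Notation e := (@cc_vec R Q).
Local Notation phi := (@cc_coord R Q).
Local Notation d := (cc_diff Q).
Local Notation kappa := (cc_proj Q).

Definition supported (S : I -> Prop) (q : Q) : Prop := forall i, ~ S i -> phi i q = 0.

Definition boundary (x : Q) : Prop := exists z, d z = x.

Definition stable_index (S : I -> Prop) : Prop := forall i, S i ->
  [/\ supported S (e i), supported S (d (e i)) & supported S (kappa (e i))].

Definition boundary_section (S : I -> Prop) (s : Q -> Q) : Prop :=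
  linear_on (fun x => boundary x /\ supported S x) s /\
  forall x, boundary x -> supported S x -> supported S (s x) /\ d (s x) = x.

Lemma supported_submod S : submodP (supported S).
Proof.
split=> [i _|a x y Sx Sy i Si]; first by rewrite linear0.
by rewrite linearP /= Sx // Sy // scaler0 addr0.
Qed.

Lemma supportedW (S T : I -> Prop) q :
  (forall i, S i -> T i) -> supported S q -> supported T q.
Proof. by move=> ST Sq i Ti; apply: Sq => /ST. Qed.

Lemma supported_list (S : I -> Prop) q : supported S q -> exists s : seq I,
  [/\ uniq s, forall i, i \in s -> S i & q = \sum_(i <- s) (phi i q : R) *: e i].
Proof.
move=> Sq; have [s [us sq]] := cc_fin q.
exists [seq i <- s | `[< S i >]]; split; rewrite ?filter_uniq //.
  by move=> i; rewrite mem_filter => /andP[/asboolP].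
apply: cc_expand; first exact: filter_uniq.
move=> i; rewrite mem_filter negb_and => /orP[/asboolP/Sq //|/sq //].
Qed.

Lemma finite_support (r : seq Q) : exists s : seq I,
  forall q, q \in r -> supported (fun i => i \in s) q.
Proof.
elim: r => [|q r [s sr]]; first by exists [::].
have [t [_ tq]] := cc_fin q; exists (t ++ s) => q'; rewrite inE => /predU1P[->|/sr].
  by move=> i /negP; rewrite mem_cat negb_or => /andP[/tq].
by apply: supportedW => i si; rewrite mem_cat si orbT.
Qed.

Lemma boundary_submod : submodP boundary.
Proof.
split=> [|a _ _ [x <-] [y <-]]; first by exists 0; rewrite linear0.
by exists (a *: x + y); rewrite linearP.
Qed.

Lemma boundary_diff0 x : boundary x -> d x = 0.
Proof. by case=> z <-; apply: cc_diff2. Qed.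

Lemma boundary_proj x : boundary x -> kappa x = x.
Proof. by case=> z <-; apply: cc_proj_diff. Qed.

(** Purity gives, for finitely many basis vectors, a contraction [s] of finite
    rank: relations among their differentials lift to relations among
    preimages, and the defect of the lift consists of cycles. *)
Lemma local_contraction (l : seq I) : exists (N : seq I) (s : {linear Q -> Q}),
  (forall q, supported (fun i => i \in N) (s q)) /\
  forall i, i \in l ->
    [/\ d (s (d (e i))) = d (e i),
        exists w, supported (fun i => i \in N) w /\ kappa (e i - s (d (e i))) = d w &
        [/\ supported (fun i => i \in N) (e i), supported (fun i => i \in N) (d (e i))
          & supported (fun i => i \in N) (kappa (e i))]].
Proof.
have [J0 J0E] := finite_support [seq d (e i) | i <- l].
pose J := undup J0; have uJ : uniq J by apply: undup_uniq.
have JE i : i \in l -> d (e i) = \sum_(j <- J) (phi j (d (e i)) : R) *: e j.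
  move=> il; apply: cc_expand => // j jJ; apply: (J0E (d (e i))); first exact: map_f.
  by apply/negP; rewrite -mem_undup.
pose L := in_tuple l; pose JJ := in_tuple J.
pose c (a : 'I_(size l)) (j : 'I_(size J)) : R := phi (tnth JJ j) (d (e (tnth L a))).
have sumJ (V : lmodType R) (x : Q) (F : I -> V) : \sum_(j <- J) (phi j x : R) *: F j =
    \sum_(j < size J) (phi (tnth JJ j) x : R) *: F (tnth JJ j).
  exact: (big_tnth _ _ J xpredT (fun j => (phi j x : R) *: F j)).
have [|psi [dpsi cpsi]] := @cc_pure R Q _ _ c (fun j => e (tnth JJ j)).
  move=> a; rewrite -(sumJ Q (d (e (tnth L a))) (fun j => d (e j))).
  rewrite -[RHS](cc_diff2 (e (tnth L a))) [in RHS]JE ?mem_tnth // linear_sum.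
  by apply: eq_bigr => j _; rewrite linearZ.
have [v vE] : exists v : 'I_(size J) -> Q, forall j,
    kappa (e (tnth JJ j) - psi j) = d (v j).
  have [j|v vE] := choice (_ : forall j, exists z, kappa (e (tnth JJ j) - psi j) = d z).
    by apply: cc_exact; rewrite linearB /= dpsi subrr.
  by exists v.
have [|s sE] := @linear_ex R Q Q (fun q => \sum_j (phi (tnth JJ j) q : R) *: v j).
  move=> a x y; rewrite scaler_sumr -big_split; apply: eq_bigr => j _ /=.
  by rewrite linearP scalerDl scalerA.
have ds i : i \in l -> d (s (d (e i))) = d (e i).
  move=> il; have /tnthP[a /esym ai] : i \in L := il.
  transitivity (kappa (\sum_j c a j *: (e (tnth JJ j) - psi j))).
    rewrite sE !linear_sum; apply: eq_bigr => j _.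
    by rewrite !linearZ /= vE /c ai.
  under eq_bigr => j _ do rewrite scalerBr.
  rewrite sumrB cpsi subr0 /c ai -(sumJ Q (d (e i)) e) -JE //.
  exact: cc_proj_diff.
have [w wE] : exists w : I -> Q, forall i, i \in l -> kappa (e i - s (d (e i))) = d (w i).
  apply: (@choice_on I Q (fun=> 0) (fun i => i \in l)
    (fun i w => kappa (e i - s (d (e i))) = d w)) => i il.
  by apply: cc_exact; rewrite linearB /= ds // subrr.
have [N NE] := finite_support ([seq v j | j <- enum 'I_(size J)] ++ map w l ++
  map e l ++ [seq d (e i) | i <- l] ++ [seq kappa (e i) | i <- l]).
exists N, s; split=> [q|i il].
  rewrite sE; apply: (submodP_sum (supported_submod _)) => j _.
  apply: (submodPZ (supported_submod _)); apply: NE.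
  by rewrite mem_cat map_f // mem_enum.
split; [exact: ds|exists (w i); split; [apply: NE|exact: wE]|split; apply: NE].
- by rewrite !mem_cat (map_f w il) ?orbT.
- by rewrite !mem_cat (map_f e il) ?orbT.
- by rewrite !mem_cat (map_f (fun i => d (e i)) il) ?orbT.
- by rewrite !mem_cat (map_f (fun i => kappa (e i)) il) ?orbT.
Qed.

(** A countable set of indices closed under the local contractions carries a
    section: the contractions are corrected one basis vector at a time. *)
Lemma countable_section (i0 : I) : exists (T : I -> Prop) (s : Q -> Q),
  [/\ T i0, stable_index T & boundary_section T s].
Proof.
have [N NE] := choice local_contraction.
have [en [i0T NT]] := countable_closure N i0.
pose T i := exists n, en n = i.
have TN l q : (forall i, i \in l -> T i) -> supported (fun i => i \in N l) q -> supported T q.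
  by move=> lT; apply: supportedW; apply: NT.
have subT := supported_submod T.
have stabT : stable_index T.
  move=> i Ti; have [c [_ cE]] := NE [:: i].
  have [|_ _ [h1 h2 h3]] := cE i; first by rewrite inE.
  have Tl j : j \in [:: i] -> T j by rewrite inE => /eqP->.
  by split; apply: TN Tl _.
have lift1 w : supported T w -> exists c : {linear Q -> Q},
    (forall q, supported T (c q)) /\ d (c (d w)) = d w.
  move=> /supported_list[m [_ mT wE]]; have [c [cN cE]] := NE m.
  exists c; split=> [q|]; first exact: TN mT (cN q).
  rewrite wE !linear_sum; apply: eq_big_seq => i im.
  by rewrite !linearZ /=; have [-> _ _] := cE i im.
(* the defects of the contraction are boundaries of vectors supported on T,
   which is what makes the boundaries supported on T boundaries within T *)
have boundary_lift x : boundary x -> supported T x ->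
    exists q, supported T q /\ d q = x.
  move=> bx /supported_list[m [_ mT xE]]; have [c [cN cE]] := NE m.
  have [w wE] : exists w : I -> Q, forall i, i \in m ->
      supported T (w i) /\ kappa (e i - c (d (e i))) = d (w i).
    apply: (@choice_on I Q (fun=> 0) (fun i => i \in m)
      (fun i w => supported T w /\ kappa (e i - c (d (e i))) = d w)) => i im.
    by have [_ [w [Nw wE]] _] := cE i im; exists w; split=> //; apply: TN mT Nw.
  exists (\sum_(i <- m) (phi i x : R) *: w i); split.
    rewrite big_seq; apply: (submodP_sum subT) => i im.
    by apply: (submodPZ subT); have [] := wE i im.
  transitivity (kappa (\sum_(i <- m) (phi i x : R) *: (e i - c (d (e i))))).
    rewrite !linear_sum; apply: eq_big_seq => i im.
    by rewrite !linearZ; have [_ ->] := wE i im.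
  have cd0 : \sum_(i <- m) (phi i x : R) *: c (d (e i)) = 0.
    transitivity (c (d x)); last by rewrite (boundary_diff0 bx) linear0.
    rewrite [in RHS]xE !linear_sum; by apply: eq_bigr => i _; rewrite !linearZ.
  under eq_bigr => i _ do rewrite scalerBr.
  by rewrite sumrB cd0 subr0 -xE boundary_proj.
(* h + c (1 - d h) agrees with h on the vectors already fixed by d h, and c is
   chosen to fix the remaining defect of the next basis vector *)
have step (h : {linear Q -> Q}) n : exists h' : {linear Q -> Q},
    (forall q, supported T (h q)) -> [/\ forall q, supported T (h' q),
      forall y, d (h y) = y -> h' y = h y & d (h' (d (e (en n)))) = d (e (en n))].
  have [hT|nhT] := pselect (forall q, supported T (h q)); last by exists h.
  pose y := d (e (en n)).
  have [|c [cT cE]] := lift1 (e (en n) - h y).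
    by apply: (submodPB subT) => //; have [] := stabT (en n) (ex_intro _ n erefl).
  exists (h \+ (c \o (idfun \- (d \o h)))) => _; split=> [q|z hz|] /=.
  - exact: (submodPD subT).
  - by rewrite hz subrr linear0 addr0.
  - by rewrite linearD /= -/y -[y - d (h y)]linearB cE linearB /= addrC subrK.
have [next nextE] := choice (fun hn => step hn.1 hn.2).
pose h := fix h n := if n is n'.+1 then next (h n', n') else \0 : {linear Q -> Q}.
have hT n q : supported T (h n q).
  elim: n q => [|n IH] q; first exact: (submodP0 subT).
  by have [hT _ _] := nextE (h n, n) IH; apply: hT.
have hS n y : d (h n y) = y -> h n.+1 y = h n y.
  by have [_ hS _] := nextE (h n, n) (hT n); apply: hS.
have h_mono n m y : (n <= m)%N -> d (h n y) = y -> h m y = h n y.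
  move=> /subnK <-; elim: (m - n)%N => [//|j IH] hy.
  by rewrite addSn hS IH.
have hfix x : boundary x -> supported T x -> exists n, d (h n x) = x.
  move=> bx Tx; have [q [/supported_list[m [_ mT qE]] <-]] := boundary_lift x bx Tx.
  have [n nE] : exists n, forall i, i \in m -> d (h n (d (e i))) = d (e i).
    elim: m mT {qE} => [|i m IH] mT; first by exists 0%N.
    have [|n nE] := IH; first by move=> j jm; apply: mT; rewrite inE jm orbT.
    have [k ik] : T i by apply: mT; rewrite inE eqxx.
    have [_ _ kE] := nextE (h k, k) (hT k); rewrite /= ik in kE.
    exists (maxn n k.+1) => j; rewrite inE => /predU1P[->|/nE jn].
      by rewrite (@h_mono k.+1) // leq_maxr.
    by rewrite (@h_mono n) // leq_maxl.
  exists n; rewrite qE !linear_sum; apply: eq_big_seq => i im.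
  by rewrite !linearZ /= nE.
have [K KE] : exists K : Q -> nat, forall x, (boundary x /\ supported T x) ->
    d (h (K x) x) = x.
  by apply: (@choice_on Q nat (fun=> 0%N) _ (fun x n => d (h n x) = x)) => x [bx Tx]; apply: hfix.
have sE x n : boundary x -> supported T x -> d (h n x) = x -> h (K x) x = h n x.
  move=> bx Tx nx; have Kx := KE x (conj bx Tx).
  by have [le|/ltnW le] := leqP (K x) n; [rewrite (h_mono _ _ _ le)|rewrite (h_mono _ _ _ le)].
exists T, (fun x => h (K x) x); split=> //; split=> [a x y [bx Tx] [by_ Ty]|x bx Tx].
  have Kx := KE x (conj bx Tx); have Ky := KE y (conj by_ Ty).
  set k := maxn (K x) (K y).
  have kx : h k x = h (K x) x by apply: h_mono (leq_maxl _ _) Kx.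
  have ky : h k y = h (K y) y by apply: h_mono (leq_maxr _ _) Ky.
  rewrite -kx -ky -linearP; apply: sE.
  - exact: boundary_submod.2.
  - exact: subT.2.
  - by rewrite !linearP /= kx ky Kx Ky.
by split; [apply: hT|apply: KE].
Qed.

End CoordComplex.

Section Contraction.
Variables (R : pzRingType) (Q : coord_complex R).
Local Notation I := (cc_index Q).
Local Notation e := (@cc_vec R Q).
Local Notation phi := (@cc_coord R Q).
Local Notation d := (cc_diff Q).
Local Notation kappa := (cc_proj Q).

Lemma supported_map (S T : I -> Prop) (f : {linear Q -> Q}) q :
  (forall i, S i -> supported T (f (e i))) -> supported S q -> supported T (f q).
Proof.
move=> fS /supported_list[s [_ sS ->]]; rewrite linear_sum big_seq.
apply: (submodP_sum (supported_submod T)) => i /sS Si; rewrite linearZ.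
by apply: (submodPZ (supported_submod T)); apply: fS.
Qed.

Lemma index_projection (S : I -> Prop) : stable_index S ->
  exists pi : {linear Q -> Q}, (forall q, supported S (pi q)) /\
    (forall q, supported S q -> pi q = q).
Proof.
move=> stS.
pose F q i : Q := if `[< S i >] then (phi i q : R) *: e i else 0.
have [supp suppE] := choice (@cc_fin R Q).
have F0 q i : phi i q = 0 -> F q i = 0 by rewrite /F => ->; rewrite scale0r if_same.
pose f q := \sum_(i <- supp q) F q i.
have fE q s : uniq s -> (forall i, i \notin s -> phi i q = 0) -> f q = \sum_(i <- s) F q i.
  move=> us' sq'; have [us sq] := suppE q; apply: sum_support => // i.
    by move/sq/F0.
  by move/sq'/F0.
have [|pi piE] := @linear_ex R Q Q f.
  move=> a x y; have [s sE] := finite_support [:: x; y; a *: x + y].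
  have sz z : z \in [:: x; y; a *: x + y] -> forall i, i \notin undup s -> phi i z = 0.
    by move=> zin i; rewrite mem_undup => /negP; apply: sE.
  rewrite !(fE _ (undup s)) ?undup_uniq //; do ?by apply: sz; rewrite !inE eqxx ?orbT.
  rewrite scaler_sumr -big_split; apply: eq_bigr => i _ /=; rewrite /F.
  by case: ifP => _; rewrite ?scaler0 ?addr0 // linearP scalerDl scalerA.
exists pi; split=> q.
  rewrite piE; apply: (submodP_sum (supported_submod S)) => i _; rewrite /F.
  case: ifPn => [/asboolP Si|_]; last exact: (submodP0 (supported_submod S)).
  by apply: (submodPZ (supported_submod S)); have [] := stS i Si.
move=> Sq; have [us sq] := suppE q; rewrite piE [RHS](cc_expand us sq).
apply: eq_bigr => i _; rewrite /F; case: ifPn => // /asboolP /Sq ->.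
by rewrite scale0r.
Qed.

(** Dividing by the contractible subcomplex supported on [S] leaves a complex
    of the same kind, to which the countable construction applies again. *)
Lemma extend_section (S : I -> Prop) (s : Q -> Q) (i0 : I) :
  stable_index S -> boundary_section S s ->
  exists (T : I -> Prop) (s' : Q -> Q), [/\ forall i, S i -> T i, T i0, stable_index T,
    boundary_section T s' & forall x, boundary x -> supported S x -> s' x = s x].
Proof.
move=> stS [slin sE].
have subS := supported_submod S.
have [pi [piS piK]] := index_projection stS.
have dS q : supported S q -> supported S (d q).
  by apply: supported_map => i Si; have [] := stS i Si.
have kS q : supported S q -> supported S (kappa q).
  by apply: supported_map => i Si; have [] := stS i Si.
have [K [k [ki kpi]]] := kernel_ex pi.
have pik x : pi (k x) = 0 by apply/kpi; exists x.
have [|rho rhoE] := factor_inj (f := idfun \- pi) ki.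
  by move=> q; apply/kpi; rewrite /= linearB /= (piK (pi q)) // subrr.
rewrite /= in rhoE.
have rho0 q : supported S q -> rho q = 0.
  by move=> Sq; apply: ki; rewrite rhoE piK // subrr linear0.
have rhok x : rho (k x) = x by apply: ki; rewrite rhoE pik subr0.
have rho_split q : q = k (rho q) + pi q by rewrite rhoE subrK.
have S_rho q : rho q = 0 -> supported S q.
  by move=> q0; rewrite [q]rho_split q0 linear0 add0r.
pose d' : {linear K -> K} := rho \o (d \o k).
have rhod q : rho (d q) = d' (rho q).
  by rewrite [in LHS](rho_split q) linearD linearD /= (rho0 (d (pi q))) ?addr0 //; apply: dS.
have rhokap q : rho (kappa q) = rho (kappa (k (rho q))).
  by rewrite [in LHS](rho_split q) linearD linearD /= (rho0 (kappa (pi q))) ?addr0 //; apply: kS.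
(* a linear retraction of the boundaries onto those supported on S *)
have bd x : boundary (d x) by exists x.
have dpi x : boundary (d (pi x)) /\ supported S (d (pi x)) by split; [apply: bd|apply: dS].
have [|r rE] := @linear_ex R Q Q (fun x => kappa (pi x - s (d (pi x)))).
  move=> a x y; rewrite -linearP; congr (kappa _).
  by rewrite !linearP /= slin // scalerBr opprD addrACA.
have rS x : supported S (r x).
  by rewrite rE; apply/kS/(submodPB subS) => //; have [? ?] := dpi x; have [] := sE _ (bd (pi x)).
have rF x : boundary (r x).
  have [? ?] := dpi x; have [_ S2] := sE (d (pi x)) (bd _) (dS _ (piS x)).
  have [|z zE] := @cc_exact R Q (pi x - s (d (pi x))).
    by rewrite linearB /= S2 subrr.
  by exists z; rewrite rE zE.
have s0 : s 0 = 0.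
  have z0 : boundary (0 : Q) /\ supported S 0.
    by split; [apply: (submodP0 (@boundary_submod R Q))|apply: submodP0].
  by have /esym/eqP := slin 1 0 0 z0 z0; rewrite scaler0 addr0 scale1r -subr_eq0 addrK => /eqP.
have r_id x : boundary x -> rho x = 0 -> r x = x.
  move=> bx /S_rho/piK pix; rewrite rE pix (boundary_diff0 bx) s0 subr0.
  exact: boundary_proj.
(* the coordinates on S are redundant on the quotient, where the basis vectors
   of S vanish; setting them to zero makes supports over K and over Q agree *)
have phi_ex i : exists f : {linear K -> R^o},
    forall x, f x = if `[< S i >] then 0 else phi i (k x).
  case: `[< S i >]; last by exists (phi i \o k).
  by apply: (@linear_ex R K R^o (fun=> 0)) => a x y; rewrite scaler0 addr0.
have [phi' phi'E] := choice phi_ex.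
have fin' x : exists l : seq I, uniq l /\ forall i, i \notin l -> phi' i x = 0.
  have [l [ul lx]] := cc_fin (k x); exists l; split=> // i /lx; rewrite phi'E => ->.
  by rewrite if_same.
have expand' x (l : seq I) : uniq l -> (forall i, i \notin l -> phi' i x = 0) ->
    x = \sum_(i <- l) (phi' i x : R) *: rho (e i).
  move=> ul lx; have [l' [ul' lx']] := cc_fin (k x).
  transitivity (\sum_(i <- l') (phi' i x : R) *: rho (e i)).
    rewrite -[LHS]rhok [in LHS](cc_expand ul' lx') linear_sum; apply: eq_bigr => i _.
    rewrite linearZ /= phi'E; case: ifPn => // /asboolP Si.
    by rewrite rho0 ?scaler0 //; have [] := stS i Si.
  apply: sum_support => // i; last by move/lx => ->; rewrite scale0r.
  by move/lx'; rewrite phi'E => ->; rewrite if_same scale0r.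
have diff2' x : d' (d' x) = 0 by rewrite /= -[rho (d (k _))]rhod cc_diff2 linear0.
pose kappa' : {linear K -> K} := rho \o (kappa \o k).
have proj_diff' x : kappa' (d' x) = d' x by rewrite /= -rhokap cc_proj_diff.
have exact' x : d' x = 0 -> exists z, kappa' x = d' z.
  move=> /S_rho Sdx; have [Sy dy] := sE _ (bd (k x)) Sdx.
  have [|z zE] := @cc_exact R Q (k x - s (d (k x))).
    by rewrite linearB /= dy subrr.
  exists (rho z); rewrite -rhod -zE linearB linearB /=.
  by rewrite [rho (kappa (s _))]rho0 ?subr0 //; apply: kS.
have pure' : pure_map d'.
  move=> m t c u cu.
  have cr a : \sum_i c a i *: d (k (u i) - s (r (d (k (u i))))) = 0.
    have rX : r (\sum_i c a i *: d (k (u i))) = \sum_i c a i *: d (k (u i)).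
      apply: r_id; first by apply: (submodP_sum (@boundary_submod R Q)) => i _;
        apply: (submodPZ (@boundary_submod R Q)).
      by rewrite linear_sum -[RHS](cu a); apply: eq_bigr => i _; rewrite linearZ.
    under eq_bigr => i _ do rewrite linearB scalerBr.
    rewrite sumrB -[X in X - _]rX linear_sum -sumrB big1 // => i _ /=.
    by rewrite linearZ /= (sE _ (rF _) (rS _)).2 subrr.
  have [v [dv cv]] := cc_pure cr.
  exists (fun i => rho (v i)); split=> [i|a].
    rewrite -rhod dv linearB /= (sE _ (rF _) (rS _)).2 linearB /=.
    by rewrite [rho (r _)]rho0 ?subr0.
  rewrite -[RHS](linear0 rho) -(cv a) linear_sum; apply: eq_bigr => i _.
  by rewrite linearZ.
pose Q' := CoordComplex fin' expand' diff2' proj_diff' exact' pure'.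
have [T' [s' [T'i0 stT' [s'lin s'E]]]] := @countable_section R Q' i0.
pose T i := S i \/ T' i.
have subT := supported_submod T.
have ST q : supported S q -> supported T q by apply: supportedW => i; left.
have kT x : @supported R Q' T' x <-> supported T (k x).
  split=> xT i iT.
    have := xT i; rewrite /= phi'E; case: ifPn => [/asboolP Si|_]; first by case: iT; left.
    by apply=> T'i; apply: iT; right.
  rewrite /= phi'E; case: ifPn => // /asboolP Si; apply: xT.
  by case.
have rhoT q : supported T q <-> @supported R Q' T' (rho q).
  split=> [qT|/kT qT].
    by apply/kT; rewrite rhoE; apply: (submodPB subT) => //; apply: ST.
  by rewrite [q]rho_split; apply: (submodPD subT) => //; apply: ST.
have bd' x : boundary x -> @boundary R Q' (rho x).
  by case=> z <-; exists (rho z); rewrite [LHS]/= -[LHS]rhod.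
have FT x : boundary x -> supported T x -> boundary (x - d (k (s' (rho x)))) /\
    supported S (x - d (k (s' (rho x)))).
  move=> bx Tx; have [Ty dy] := s'E (rho x) (bd' _ bx) ((rhoT x).1 Tx).
  split; first by apply: (submodPB (@boundary_submod R Q)).
  by apply: S_rho; move: dy; rewrite linearB /= => ->; rewrite subrr.
have lin' a x y : boundary x -> supported T x -> boundary y -> supported T y ->
    s' (rho (a *: x + y)) = a *: s' (rho x) + s' (rho y).
  move=> bx Tx by_ Ty; rewrite linearP; apply: s'lin; split; first exact: bd'.
  - exact/rhoT.
  - exact: bd'.
  - exact/rhoT.
exists T, (fun x => k (s' (rho x)) + s (x - d (k (s' (rho x))))); split=> [i|||| x bx Sx].
- by left.
- by right.
- move=> i [Si|T'i]; first by have [h1 h2 h3] := stS i Si; split; apply: ST.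
  have [h1 h2 h3] := stT' i T'i; split; apply/rhoT => //; first by rewrite rhod.
  by rewrite rhokap.
- split=> [a x y [bx Tx] [by_ Ty]|x bx Tx].
    have [] := (FT x bx Tx, FT y by_ Ty) => Fx Fy.
    rewrite lin' // [k (_ + _)]linearP scalerDr addrACA -slin //; congr (_ + s _).
    by rewrite linearP /= scalerBr opprD addrACA.
  have [Fx Sx] := FT x bx Tx; have [Sy dy] := sE _ Fx Sx.
  have [Ty _] := s'E (rho x) (bd' _ bx) ((rhoT x).1 Tx).
  split; first by apply: (submodPD subT) => //; [apply/kT|apply: ST].
  by rewrite linearD /= dy addrC subrK.
have s'0 : s' 0 = 0.
  have z0 : @boundary R Q' 0 /\ @supported R Q' T' 0.
    by split; [apply: (submodP0 (@boundary_submod R Q'))|apply: (submodP0 (supported_submod _))].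
  by have /esym/eqP := s'lin 1 0 0 z0 z0; rewrite scaler0 addr0 scale1r -subr_eq0 addrK => /eqP.
by rewrite rho0 // s'0 !linear0 add0r addr0.
Qed.

(** A maximal partial section is defined everywhere, since otherwise a countable
    piece could be added to its domain. *)
Theorem boundary_splitting : exists s : Q -> Q, linear_on (@boundary R Q) s /\
  forall x, boundary x -> d (s x) = x.
Proof.
(* the domain of a partial section consists of a set of indices together with
   the vectors supported on it *)
pose P (N : (I + Q)%type -> Prop) (g : (I + Q)%type -> Q) :=
  let S i := N (inl i) in
  [/\ forall q, N (inr q) <-> supported S q, stable_index S &
      boundary_section S (fun q => g (inr q))].
pose N0 (z : (I + Q)%type) := if z is inr q then supported (fun=> False) q else False.
have supp0 (q : Q) : supported (fun=> False) q -> q = 0.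
  by move=> q0; rewrite (@cc_expand R Q q [::]) ?big_nil // => i _; apply: q0.
have [||N [g [[NQ stN secN] _ _ maxN]]] := @maximal_partial _ Q P N0 (fun=> 0).
- split=> //; split=> [a x y _ _|x _ /supp0->]; first by rewrite scaler0 addr0.
  by rewrite linear0; split=> // i _; apply: linear0.
- move=> N g loc.
  have NQ q : N (inr q) <-> supported (fun i => N (inl i)) q.
    split=> [Nq|/supported_list[m [_ mN ->]]].
      have [|N' [g' [[N'Q _ _] N'N N'l _]]] := loc [:: inr q].
        by move=> z; rewrite inE => /eqP->.
      have /N'Q : N' (inr q) by apply: N'l; rewrite inE.
      by apply: supportedW => i; apply: N'N.
    have [|N' [g' [[N'Q stN' _] N'N N'l _]]] := loc [seq inl i | i <- m].
      by move=> z /mapP[i /mN Ni ->].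
    apply/N'N/N'Q; rewrite big_seq.
    apply: (submodP_sum (supported_submod _)) => i im.
    apply: (submodPZ (supported_submod _)).
    by have [] := stN' i (N'l _ (map_f inl im)).
  split=> // [i Ni|].
    have [|N' [g' [[_ stN' _] N'N N'l _]]] := loc [:: inl i].
      by move=> z; rewrite inE => /eqP->.
    have [|h1 h2 h3] := stN' i; first by apply: N'l; rewrite inE.
    by split; [move: h1|move: h2|move: h3]; apply: supportedW => j; apply: N'N.
  split=> [a x y [bx /NQ Nx] [by_ /NQ Ny]|x bx /NQ Nx].
    have [|N' [g' [[N'Q _ [lin' _]] N'N N'l g'E]]] := loc [:: inr x; inr y].
      by move=> z; rewrite !inE => /orP[]/eqP->.
    have N'x : N' (inr x) by apply: N'l; rewrite !inE eqxx.
    have N'y : N' (inr y) by apply: N'l; rewrite !inE eqxx orbT.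
    rewrite -!g'E //; first by apply: lin'; split=> //; apply/N'Q.
    by apply/N'Q/(supported_submod _).2; apply/N'Q.
  have [|N' [g' [[N'Q _ [_ sec']] N'N N'l g'E]]] := loc [:: inr x].
    by move=> z; rewrite inE => /eqP->.
  have N'x : N' (inr x) by apply: N'l; rewrite inE.
  have [h1 h2] := sec' x bx ((N'Q x).1 N'x); rewrite -g'E //; split=> //.
  by move: h1; apply: supportedW => j; apply: N'N.
have allN i : N (inl i).
  have [T [s' [ST Ti stT secT s'E]]] := extend_section i stN secN.
  pose N' (z : (I + Q)%type) := match z with inl i => T i | inr q => supported T q end.
  pose g' (z : (I + Q)%type) := if z is inr q then if `[< boundary q >] then s' q else g z else g z.
  have g'E q : boundary q -> g' (inr q) = s' q by move=> bq; rewrite /g' asboolT.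
  apply: (maxN N' g') => //.
  - split=> //; split=> [a x y [bx Tx] [by_ Ty]|x bx Tx]; last by rewrite g'E //; apply: secT.2.
    by rewrite !g'E //; [apply: secT.1|apply: (@boundary_submod R Q).2].
  - by case=> [j /ST//|q /NQ]; apply: supportedW.
  - case=> // q /NQ Sq; have [bq|nbq] := pselect (boundary q).
      by rewrite g'E //; apply: s'E.
    by rewrite /g' asboolF.
exists (fun q => g (inr q)).
have all_supp q : supported (fun i => N (inl i)) q by move=> i /(_ (allN i)).
by split=> [a x y bx by_|x bx]; [apply: secN.1|apply: (secN.2 x bx _).2].
Qed.

End Contraction.

Section PureCoresolution.
Variable R : pzRingType.

(** The direct sum of all [Q j] is a complex to which the splitting theorem
    applies; in degree 1 the splitting is a section of [p 0], so [C 0] is a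
    direct summand of [Q 0].  This is the theorem of Benson-Goodearl and
    Neeman that flat cycles of an exact complex of projectives are
    projective, for complexes bounded on the left. *)
Theorem pure_projective_coresolution (C Q : nat -> lmodType R)
    (i : forall j, {linear C j -> Q j}) (p : forall j, {linear Q j -> C j.+1}) :
  (forall j, ses (i j) (p j)) -> (forall j, pure_map (p j)) ->
  (forall j, projective_module (Q j)) -> projective_module (C 0%N).
Proof.
move=> ip pp pQ.
have ii j : injective (i j) by case: (ip j).
have ipe j : exact_at (i j) (p j) by case: (ip j).
have sp j : surjective_map (p j) by case: (ip j).
have i0 j x : i j x = 0 -> x = 0 by move=> ix; apply: (ii j); rewrite linear0.
pose QQ := dsum Q.
have d_ex (f : QQ) : exists g : QQ, dcoord 0%N g = 0 /\
    forall j, dcoord j.+1 g = i j.+1 (p j (dcoord j f)).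
  have [s [_ fs]] := dsupp_ex f.
  pose g0 j : Q j := if j is j'.+1 then i j'.+1 (p j' (dcoord j' f)) else 0.
  have [|g gE] := @dsum_make _ _ Q g0 (map S s).
    by case=> // j; rewrite mem_map => [/fs /= ->|? ? []//]; rewrite !linear0.
  by exists g; split=> [|j]; rewrite gE.
have [d0 d0E] := choice d_ex.
have [|d dE0] := @linear_ex R QQ QQ d0.
  move=> a x y; apply: dsum_ext => -[|j]; rewrite linearP /=.
    by rewrite !(d0E _).1 scaler0 addr0.
  by rewrite !(d0E _).2 !linearP.
have dE f j : dcoord j.+1 (d f) = i j.+1 (p j (dcoord j f)) by rewrite dE0 (d0E _).2.
have dz f : dcoord 0%N (d f) = 0 by rewrite dE0 (d0E _).1.
have k_ex (f : QQ) : exists g : QQ, dcoord 0%N g = 0 /\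
    forall j, dcoord j.+1 g = dcoord j.+1 f.
  have [s [_ fs]] := dsupp_ex f.
  pose g0 j : Q j := if j is j'.+1 then dcoord j'.+1 f else 0.
  have [|g gE] := @dsum_make _ _ Q g0 s; first by case=> // j /fs.
  by exists g; split=> [|j]; rewrite gE.
have [k0 k0E] := choice k_ex.
have [|kap kE0] := @linear_ex R QQ QQ k0.
  move=> a x y; apply: dsum_ext => -[|j]; rewrite linearP /=.
    by rewrite !(k0E _).1 scaler0 addr0.
  by rewrite !(k0E _).2 !linearP.
have kE f j : dcoord j.+1 (kap f) = dcoord j.+1 f by rewrite kE0 (k0E _).2.
have kz f : dcoord 0%N (kap f) = 0 by rewrite kE0 (k0E _).1.
have [phi [phi_fin phi_expand]] := dual_basis (projective_dsum pQ).
have dd q : d (d q) = 0.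
  apply: dsum_ext => -[|[|j]]; rewrite linear0 ?dz // !dE.
    by rewrite dz !linear0.
  by rewrite (ses_comp0 (ipe _)) linear0.
have kd q : kap (d q) = d q.
  by apply: dsum_ext => -[|j]; rewrite ?kz ?dz ?kE.
have dexact q : d q = 0 -> exists z, kap q = d z.
  move=> dq.
  have z_ex j : exists z, i j.+1 (p j z) = dcoord j.+1 q /\ (dcoord j.+1 q = 0 -> z = 0).
    have [q0|q0] := pselect (dcoord j.+1 q = 0).
      by exists 0; rewrite !linear0 q0.
    have /(ipe j.+1)[c cE] : p j.+1 (dcoord j.+1 q) = 0.
      by apply/i0; rewrite -dE dq linear0.
    by have [z zE] := sp j c; exists z; rewrite zE cE.
  pose z j := projT1 (cid (z_ex j)).
  have zE j : i j.+1 (p j (z j)) = dcoord j.+1 q by rewrite /z; case: cid => ? [].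
  have z0 j : dcoord j.+1 q = 0 -> z j = 0 by rewrite /z; case: cid => ? [].
  have [s [_ qs]] := dsupp_ex q.
  have [|zz zzE] := @dsum_make _ _ Q z [seq n.-1 | n <- s].
    move=> j js; apply/z0/qs; apply: contra js => js; apply/mapP.
    by exists j.+1.
  by exists zz; apply: dsum_ext => -[|j]; rewrite ?kz ?dz // kE dE zzE zE.
have dpure : pure_map d.
  move=> m t c u cu.
  have v_ex j : exists v : 'I_t -> Q j, [/\ forall b, p j (v b) = p j (dcoord j (u b)),
      forall a, \sum_b c a b *: v b = 0 & (forall b, dcoord j (u b) = 0) -> forall b, v b = 0].
    have [u0|u0] := pselect (forall b, dcoord j (u b) = 0).
      by exists (fun=> 0); split=> [b|a|//]; [rewrite u0|rewrite big1 // => b _; rewrite scaler0].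
    have [|v [pv cv]] := pp j m t c (fun b => dcoord j (u b)).
      move=> a; apply: i0; rewrite linear_sum -[RHS](linear0 (@dcoord _ _ Q j.+1)) -(cu a).
      by rewrite linear_sum; apply: eq_bigr => b _; rewrite !linearZ /= dE.
    by exists v; split.
  pose v j := projT1 (cid (v_ex j)).
  have vE j : [/\ forall b, p j (v j b) = p j (dcoord j (u b)),
      forall a, \sum_b c a b *: v j b = 0 & (forall b, dcoord j (u b) = 0) -> forall b, v j b = 0].
    exact: projT2 (cid (v_ex j)).
  have [supp suppE] := choice (fun b => dsupp_ex (u b)).
  have vv_ex b : exists w : QQ, forall j, dcoord j w = v j b.
    apply: (@dsum_make _ _ Q (fun j => v j b) (flatten [seq supp b | b <- enum 'I_t])).
    move=> j js; have [_ _ v0] := vE j; apply: v0 => b'; apply: (suppE b').2.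
    apply: contra js => js; apply/flattenP; exists (supp b') => //.
    by apply: map_f; rewrite mem_enum.
  have [w wE] := choice vv_ex.
  exists w; split=> [b|a]; apply: dsum_ext => j.
    by case: j => [|j]; rewrite ?dz // !dE wE; have [-> _ _] := vE j.
  rewrite linear0 linear_sum; have [_ cv _] := vE j; rewrite -[RHS](cv a).
  by apply: eq_bigr => b _; rewrite linearZ /= wE.
pose cc := CoordComplex (cc_index := QQ) (cc_vec := id) phi_fin phi_expand dd kd dexact dpure.
have [s0 [slin0 sE0]] := @boundary_splitting R cc.
pose s : QQ -> QQ := s0.
have slin a (x y : QQ) : @boundary R cc x -> @boundary R cc y ->
  s (a *: x + y) = a *: s x + s y by apply: slin0.
have sE (x : QQ) : @boundary R cc x -> d (s x) = x by apply: sE0.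
pose x c : QQ := @dinj R nat Q 1%N (i 1%N c).
have xb c : @boundary R cc (x c).
  have [q qc] := sp 0%N c; exists (@dinj R nat Q 0%N q).
  apply: dsum_ext => -[|[|j]]; rewrite [LHS]/=.
  - by rewrite dz dinj_other.
  - by rewrite dE !dinj_same qc.
  - by rewrite dE !dinj_other // !linear0.
have [|s1 s1E] := @linear_ex R (C 1%N) (Q 0%N) (fun c => dcoord 0%N (s (x c))).
  by move=> a c c'; rewrite /x !linearP /= slin //; apply: xb.
have s1K c : p 0%N (s1 c) = c.
  apply: (ii 1%N); rewrite s1E -dE.
  by rewrite sE // dinj_same.
have [r rE] := ses_section (ip 0%N) s1K.
exact: (projective_retract rE).
Qed.

(** Purity passes to syzygies.  The middle term is resolved by the horseshoe
    construction; relations among elements of the projective cover of the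
    quotient are explained by finitely many coordinates, and purity is applied
    to the images of the latter. *)
Lemma pure_horseshoe (C I C' L L' : lmodType R) (i : {linear C -> I})
    (p : {linear I -> C'}) (q : {linear L -> C}) (q' : {linear L' -> C'})
    (K K' : lmodType R) (k : {linear K -> L}) (k' : {linear K' -> L'}) :
  ses i p -> pure_map p -> projective_module L -> projective_module L' ->
  ses k q -> ses k' q' ->
  exists (Q : lmodType R) (j : {linear K -> Q}) (r : {linear Q -> K'})
    (P : lmodType R) (m : {linear Q -> P}) (h : {linear P -> I}),
    [/\ ses j r, pure_map r, projective_module P & ses m h].
Proof.
move=> ip pp pL pL' kq kq'.
have [ii ipe sp] := ip; have [ki kqe sq] := kq; have [ki' kqe' sq'] := kq'.
have [sg sgE] := pL' _ _ p q' sp; rewrite /= in sgE.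
have [|h hE] := @linear_ex R (L * L')%type I (fun x => i (q x.1) + sg x.2).
  by move=> a x y /=; rewrite !linearP /= scalerDr addrACA.
have ph x : p (h x) = q' x.2 by rewrite hE linearD /= (ses_comp0 ipe) add0r; apply: sgE.
have sh : surjective_map h.
  move=> x; have [l' l'x] := sq' (p x).
  have /ipe[c cE] : p (x - sg l') = 0 by rewrite linearB /=; have /= -> := sgE l'; rewrite l'x subrr.
  by have [l lc] := sq c; exists (l, l'); rewrite hE /= lc cE subrK.
have [Q [m [mi mh]]] := kernel_ex h.
have mhs : ses m h by [].
have hm x : h (m x) = 0 by apply/mh; exists x.
have inlL : linear (fun x : K => (k x, 0) : L * L').
  by move=> a x y; congr (_, _); rewrite ?linearP //= scaler0 addr0.
have [|j jE] := ses_factor_sub (f := lin_pack inlL) mhs.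
  by move=> x; rewrite hE /= (ses_comp0 kqe) !linear0 addr0.
rewrite /= in jE.
have sndL : linear (fun x : Q => (m x).2) by move=> a x y; rewrite linearP.
have [|r rE] := ses_factor_sub (f := lin_pack sndL) kq'.
  by move=> x; rewrite -ph hm linear0.
rewrite /= in rE.
exists Q, j, r, (L * L')%type, m, h; split=> //; last exact: projective_prod.
  split.
  - apply: lin_inj0 => x jx; apply: ki; rewrite linear0.
    by have := congr1 fst (jE x); rewrite jx linear0 /= => <-.
  - move=> x; split=> [rx|[y <-]]; last by apply: ki'; rewrite rE jE linear0.
    have m2 : (m x).2 = 0 by rewrite -rE rx linear0.
    have /kqe[y yE] : q (m x).1 = 0.
      by apply: ii; rewrite linear0; have := hm x; rewrite hE m2 linear0 addr0.
    by exists y; apply: mi; rewrite jE yE -m2; case: (m x).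
  - move=> y; have /ipe[c cE] : p (sg (k' y)) = 0.
      by have /= -> := sgE (k' y); rewrite (ses_comp0 kqe').
    have [l lc] := sq c.
    have /mh[x xE] : h (- l, k' y) = 0 by rewrite hE /= !linearN /= lc cE addNr.
    by exists x; apply: ki'; rewrite rE xE.
move=> s t c u cu.
have [n [b [e [uE bE]]]] := projective_coordinates (fun a => (m (u a)).2) pL'.
have cu2 a : \sum_x c a x *: (m (u x)).2 = 0.
  rewrite -[RHS](linear0 k') -(cu a) linear_sum; apply: eq_bigr => x _.
  by rewrite linearZ /= rE.
have [|z [pz bz]] := pp t n b (fun y => sg (e y)).
  move=> a; transitivity (q' (m (u a)).2); last by rewrite -ph hm linear0.
  rewrite uE linear_sum; apply: eq_bigr => y _; rewrite linearZ /=.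
  by have /= -> := sgE (e y).
have [y yE] : exists y : 'I_n -> L, forall x, i (q (y x)) = z x - sg (e x).
  have [x|y yE] := choice (_ : forall x, exists l, i (q l) = z x - sg (e x)).
    have /ipe[c0 c0E] : p (z x - sg (e x)) = 0 by rewrite linearB /= pz subrr.
    by have [l lc] := sq c0; exists l; rewrite lc.
  by exists y.
have [v vE] : exists v : 'I_t -> Q, forall a, m (v a) = (\sum_x b a x *: y x, (m (u a)).2).
  have [a|v vE] := choice (_ : forall a, exists v, m v = (\sum_x b a x *: y x, (m (u a)).2)).
    apply/mh; rewrite hE /= uE !linear_sum -big_split /= -[RHS](bz a).
    apply: eq_bigr => x _; rewrite !linearZ /= -scalerDr yE subrK //.
  by exists v.
exists v; split=> [a|a]; first by apply: ki'; rewrite !rE vE.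
apply: mi; rewrite linear0 linear_sum.
have sum_pair (I0 : Type) (F : I0 -> L * L') (l : seq I0) :
    \sum_(a <- l) F a = (\sum_(a <- l) (F a).1, \sum_(a <- l) (F a).2).
  elim: l => [|x l IH]; first by rewrite !big_nil.
  by rewrite !big_cons IH.
rewrite sum_pair; congr (_, _); last first.
  by rewrite -[RHS](cu2 a); apply: eq_bigr => x _; rewrite linearZ /= vE.
transitivity (\sum_w (\sum_x c a x * b x w) *: y w); last first.
  by rewrite big1 // => w _; rewrite (bE (c a) (cu2 a)) scale0r.
under [RHS]eq_bigr => w _ do rewrite scaler_suml.
rewrite exchange_big; apply: eq_bigr => x _ /=; rewrite linearZ /= vE /= scaler_sumr.
by apply: eq_bigr => w _; rewrite scalerA.
Qed.

(** Taking syzygies of the whole coresolution lowers the projective dimensions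
    of the [I j] and keeps exactness and purity. *)
Theorem pure_coresolution_pd (n : nat) (C I : nat -> lmodType R)
    (i : forall j, {linear C j -> I j}) (p : forall j, {linear I j -> C j.+1}) :
  (forall j, ses (i j) (p j)) -> (forall j, pure_map (p j)) ->
  (forall j, pd_le n (I j)) -> pd_le n (C 0%N).
Proof.
elim: n C I i p => [|n IH] C I i p ip pp pdI.
  by apply/pd_le0/(pure_projective_coresolution ip pp) => j; apply/pd_le0.
pose KE j := cid (syzygy_ex (C j)); pose K j := projT1 (KE j).
pose LE j := cid (projT2 (KE j)); pose L j := projT1 (LE j).
pose kE j := cid (projT2 (LE j)); pose k j : {linear K j -> L j} := projT1 (kE j).
pose qE j := cid (projT2 (kE j)); pose q j : {linear L j -> C j} := projT1 (qE j).
have pL j : projective_module (L j) by have [] := projT2 (qE j).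
have kq j : ses (k j) (q j) by have [] := projT2 (qE j).
pose QE j := cid (pure_horseshoe (ip j) (pp j) (pL j) (pL j.+1) (kq j) (kq j.+1)).
pose jE j := cid (projT2 (QE j)); pose rE j := cid (projT2 (jE j)).
have horse j : pd_le n (projT1 (QE j)) /\
    ses (projT1 (jE j)) (projT1 (rE j)) /\ pure_map (projT1 (rE j)).
  have [P [m [h [jr pr pP mh]]]] := projT2 (rE j); split=> //.
  exact/(pd_leS n pP mh).
apply/(pd_leS n (pL 0%N) (kq 0%N)).
by apply: (IH K (fun j => projT1 (QE j)) (fun j => projT1 (jE j))
  (fun j => projT1 (rE j))) => j; have [? []] := horse j.
Qed.

End PureCoresolution.

(** * Resolutions and dimensions *)

Section Resolutions.
Variable R : pzRingType.
Implicit Types K M P E I : lmodType R.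

Definition zero_mod : lmodType R := 'rV[R]_0.

Lemma zero_modP : zero_module zero_mod.
Proof. by move=> x; apply/rowP => -[]. Qed.

Lemma zero_mod_eq (x y : zero_mod) : x = y.
Proof. by rewrite [x]zero_modP [y]zero_modP. Qed.

Section Cons.
Variables (K P M : lmodType R) (i : {linear K -> P}) (p : {linear P -> M}).
Hypothesis ip : ses i p.

Definition res_cons_obj (C : resolution K) n : lmodType R :=
  if n is j.+1 then C j else P.

Definition res_cons_diff (C : resolution K) n :
    {linear res_cons_obj C n.+1 -> res_cons_obj C n} :=
  match n return {linear res_cons_obj C n.+1 -> res_cons_obj C n} with
  | 0%N => i \o res_aug C
  | j.+1 => res_diff C j
  end.

Lemma res_cons_surj : surjective_map p. Proof. by case: ip. Qed.

Lemma res_cons_exact0 (C : resolution K) : exact_at (@res_cons_diff C 0) p.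
Proof.
have [_ ipe _] := ip; move=> y; split=> [/ipe[x <-]|[x <-]]; last first.
  by rewrite /= (ses_comp0 ipe).
by have [z <-] := res_aug_surj C x; exists z.
Qed.

Lemma res_cons_exactS (C : resolution K) n :
  exact_at (@res_cons_diff C n.+1) (@res_cons_diff C n).
Proof.
have [ii _ _] := ip; case: n => [|n] y; last exact: res_exactS.
split=> [/= iy|[x <-]] /=.
  by apply/res_exact0/ii; rewrite iy linear0.
by rewrite (ses_comp0 (@res_exact0 _ _ C)) linear0.
Qed.

Definition res_cons (C : resolution K) : resolution M :=
  Resolution res_cons_surj (@res_cons_exact0 C) (@res_cons_exactS C).

End Cons.

Lemma resolution_syzygy M (C : resolution M) :
  exists K (i : {linear K -> C 0%N}) (D : resolution K),
    [/\ ses i (res_aug C), forall j, res_obj D j = C j.+1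
      & exists e : {linear C 1%N -> K}, surjective_map e /\
          forall x, i (e x) = res_diff C 0 x].
Proof.
have [K [i [ii ipe]]] := kernel_ex (res_aug C).
have ip : ses i (res_aug C) by split=> //; apply: res_aug_surj.
have [|e eE] := ses_factor_sub (f := res_diff C 0) ip.
  by move=> x; apply: (ses_comp0 (@res_exact0 _ _ C)).
have se : surjective_map e.
  move=> x; have /res_exact0[y yx] : res_aug C (i x) = 0 by apply/ipe; exists x.
  by exists y; apply: ii; rewrite eE yx.
have ex0 : exact_at (res_diff C 1) e.
  move=> y; split=> [ey|[x <-]]; first by apply/res_exactS; rewrite -eE ey linear0.
  by apply: ii; rewrite eE (ses_comp0 (@res_exactS _ _ C 0)) linear0.
exists K, i, (@Resolution R K (fun j => C j.+1) (fun j => res_diff C j.+1) e se ex0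
  (fun j => @res_exactS _ _ C j.+1)).
by split=> //; exists e.
Qed.

Lemma zero_resolution_ex : exists C : resolution zero_mod, forall j, zero_module (C j).
Proof.
have s0 : surjective_map (idfun : {linear zero_mod -> zero_mod}) by move=> x; exists x.
have ex0 (f g : {linear zero_mod -> zero_mod}) : exact_at f g.
  by move=> y; split=> _; [exists 0|]; apply: zero_mod_eq.
exists (@Resolution R zero_mod (fun=> zero_mod) (fun=> idfun) idfun s0 (ex0 _ _) (fun=> ex0 _ _)).
by move=> j; apply: zero_modP.
Qed.

Lemma ses_zero_l M (i : {linear zero_mod -> M}) : ses i (idfun : {linear M -> M}).
Proof.
split; [by move=> x y _; apply: zero_mod_eq| |by move=> y; exists y].
move=> y; split=> [/= ->|[x <-]]; first by exists 0; rewrite linear0.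
by rewrite [x]zero_modP !linear0.
Qed.

Lemma zero_map_ex M (N : lmodType R) : exists f : {linear M -> N}, forall x, f x = 0.
Proof. by apply: (@linear_ex R M N (fun=> 0)) => a x y; rewrite scaler0 addr0. Qed.

Lemma has_resolution_pd M n : has_resolution (@projective_module R) M n <-> pd_le n M.
Proof.
split; elim: n M => [|n IH] M.
- case=> C [pC zC]; have [K [i [D [ip DE [e [se eE]]]]]] := resolution_syzygy C.
  apply/pd_le0.
  have K0 (x : K) : x = 0.
    by have [y <-] := se x; rewrite (zC 1%N isT y) linear0.
  have [|g gE] := ses_factor_quot (f := idfun) ip.
    by move=> x; rewrite /= [x]K0 linear0.
  have pC0 := pC 0%N isT.
  apply: (projective_retract (s := g) (r := res_aug C)) pC0 => m.
  by have [x <-] := res_aug_surj C m; rewrite gE.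
- case=> C [pC zC]; have [K [i [D [ip DE _]]]] := resolution_syzygy C.
  apply/(pd_leS n (pC 0%N isT) ip)/IH; exists D; split=> j jn.
    by rewrite DE; apply: pC.
  by rewrite DE; apply: zC.
- move=> /pd_le0 pM; have [Z Z0] := zero_resolution_ex.
  have [f _] := zero_map_ex zero_mod M.
  exists (res_cons (ses_zero_l f) Z); split; first by case.
  by case=> // j _; apply: Z0.
- have [K [P [i [p [pP ip]]]]] := syzygy_ex M.
  move=> /(pd_leS n pP ip)/IH[C [pC zC]].
  exists (res_cons ip C); split; first by case=> // j; apply: pC.
  by case=> // j; apply: zC.
Qed.

Lemma projective_resolution_ex M :
  exists C : resolution M, forall j, projective_module (C j).
Proof.
pose KE N := cid (@syzygy_ex R N); pose K N := projT1 (KE N).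
pose PE N := cid (projT2 (KE N)); pose P N := projT1 (PE N).
pose iE N := cid (projT2 (PE N)); pose i N : {linear K N -> P N} := projT1 (iE N).
pose pE N := cid (projT2 (iE N)); pose p N : {linear P N -> N} := projT1 (pE N).
have pP N : projective_module (P N) by have [] := projT2 (pE N).
have ip N : ses (i N) (p N) by have [] := projT2 (pE N).
pose S n := iter n K M.
pose d n : {linear P (S n.+1) -> P (S n)} := i (S n) \o p (S n.+1).
have ex_aug N (x : P N) : p N x = 0 <-> exists y, (i N \o p (K N)) y = x.
  have [_ ipe _] := ip N; have [_ _ sp] := ip (K N).
  split=> [/ipe[z <-]|[y <-]]; last by rewrite /= (ses_comp0 ipe).
  by have [y <-] := sp z; exists y.
have ex0 : exact_at (d 0%N) (p M) by move=> x; apply: ex_aug.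
have exS n : exact_at (d n.+1) (d n).
  have [ii _ _] := ip (S n) => x; split=> [/= dx|].
    by apply/ex_aug/ii; rewrite dx linear0.
  by move/ex_aug => /= ->; rewrite linear0.
have sM : surjective_map (p M) by case: (ip M).
exists (@Resolution R M (fun n => P (S n)) d (p M) sM ex0 exS) => j; exact: pP.
Qed.

(** A projective resolution of a syzygy prolongs to one of the module with the
    same differentials one degree higher, so cocycles and coboundaries match. *)
Lemma Ext_vanishes_ext_zero k M E : Ext_vanishes k.+1 M E -> ext_zero k M E.
Proof.
elim: k M => [|k IH] M ME; last first.
  move=> K P i p pP ip; apply: IH => C pC f fd.
  have pcons j : projective_module (res_cons ip C j) by case: j.
  exact: (ME (res_cons ip C) pcons f fd).
have [C pC] := projective_resolution_ex M.
have [K [i [D [ip DE [e [se eE]]]]]] := resolution_syzygy C.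
have [ii _ _] := ip.
apply: (ext1_of_extension (pC 0%N) ip) => f.
have [|g gE] := ME C pC (f \o e).
  move=> x /=; suff -> : e (res_diff C 1 x) = 0 by rewrite linear0.
  by apply: ii; rewrite eE (ses_comp0 (@res_exactS _ _ C 0)) linear0.
by exists g => x; have [y <-] := se x; rewrite eE; have /= -> := gE y.
Qed.

Section CoCons.
Variables (M I K : lmodType R) (i : {linear M -> I}) (p : {linear I -> K}).
Hypothesis ip : ses i p.

Definition cores_cons_obj (C : coresolution K) n : lmodType R :=
  if n is j.+1 then C j else I.

Definition cores_cons_diff (C : coresolution K) n :
    {linear cores_cons_obj C n -> cores_cons_obj C n.+1} :=
  match n return {linear cores_cons_obj C n -> cores_cons_obj C n.+1} with
  | 0%N => cores_aug C \o p
  | j.+1 => cores_diff C j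
  end.

Lemma cores_cons_inj : injective i. Proof. by case: ip. Qed.

Lemma cores_cons_exact0 (C : coresolution K) : exact_at i (@cores_cons_diff C 0).
Proof.
have [_ ipe _] := ip; move=> y; split=> [/= y0|[x <-]] /=; last first.
  by rewrite (ses_comp0 ipe) linear0.
by apply/ipe/(@cores_aug_inj _ _ C); rewrite y0 linear0.
Qed.

Lemma cores_cons_exactS (C : coresolution K) n :
  exact_at (@cores_cons_diff C n) (@cores_cons_diff C n.+1).
Proof.
have [_ _ sp] := ip; case: n => [|n] y; last exact: cores_exactS.
split=> [/cores_exact0[z <-]|[x <-]].
  by have [x <-] := sp z; exists x.
by rewrite /= (ses_comp0 (@cores_exact0 _ _ C)).
Qed.

Definition cores_cons (C : coresolution K) : coresolution M :=
  Coresolution cores_cons_inj (@cores_cons_exact0 C) (@cores_cons_exactS C).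

End CoCons.

Lemma coresolution_cosyzygy M (C : coresolution M) :
  exists K (p : {linear C 0%N -> K}) (D : coresolution K),
    [/\ ses (cores_aug C) p, forall j, cores_obj D j = C j.+1
      & exists e : {linear K -> C 1%N}, injective e].
Proof.
have [K [p [sp ipe]]] := cokernel_ex (cores_aug C).
have ip : ses (cores_aug C) p by split=> //; apply: cores_aug_inj.
have [|e eE] := ses_factor_quot (f := cores_diff C 0) ip.
  by move=> x; apply: (ses_comp0 (@cores_exact0 _ _ C)).
have ie : injective e.
  apply: lin_inj0 => x; have [y <-] := sp x; rewrite eE => /cores_exact0 yz.
  exact/ipe.
have ex0 : exact_at e (cores_diff C 1).
  move=> y; split=> [/cores_exactS[x <-]|[x <-]]; first by exists (p x).
  by have [z <-] := sp x; rewrite eE (ses_comp0 (@cores_exactS _ _ C 0)).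
exists K, p, (@Coresolution R K (fun j => C j.+1) (fun j => cores_diff C j.+1) e ie ex0
  (fun j => @cores_exactS _ _ C j.+1)).
by split=> //; exists e.
Qed.

Lemma zero_coresolution_ex : exists C : coresolution zero_mod, forall j, zero_module (C j).
Proof.
have i0 : injective (idfun : {linear zero_mod -> zero_mod}) by [].
have ex0 (f g : {linear zero_mod -> zero_mod}) : exact_at f g.
  by move=> y; split=> _; [exists 0|]; apply: zero_mod_eq.
exists (@Coresolution R zero_mod (fun=> zero_mod) (fun=> idfun) idfun i0 (ex0 _ _) (fun=> ex0 _ _)).
by move=> j; apply: zero_modP.
Qed.

Lemma ses_zero_r M (p : {linear M -> zero_mod}) : ses (idfun : {linear M -> M}) p.
Proof.
split=> // [y|y]; last by exists 0; apply: zero_mod_eq.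
by split=> _; [exists y|apply: zero_modP].
Qed.

(** Induction on the length of a finite coresolution; at length 0 the
    coresolution only says that [M] is a direct summand of a module in [X]. *)
Lemma has_coresolution_ind (X Y : lmodType R -> Prop) :
  (forall M E (i : {linear M -> E}) (r : {linear E -> M}),
     X E -> (forall x, r (i x) = x) -> Y M) ->
  (forall M E K (i : {linear M -> E}) (p : {linear E -> K}),
     ses i p -> X E -> Y K -> Y M) ->
  forall n M, has_coresolution X M n -> Y M.
Proof.
move=> Ybase Ystep; elim=> [|n IH] M [C [XC zC]];
  have [K [p [D [ip DE [e ie]]]]] := coresolution_cosyzygy C.
  have K0 (x : K) : x = 0 by apply: ie; rewrite (zC 1%N isT (e x)) linear0.
  have [|r rE] := ses_factor_sub (f := idfun) ip.
    by move=> x /=; apply: K0.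
  apply: (Ybase M (C 0%N) (cores_aug C) r (XC 0%N isT)) => x.
  by apply: (@cores_aug_inj _ _ C); rewrite rE.
apply: (Ystep _ _ _ _ _ ip (XC 0%N isT)); apply: IH; exists D; split=> j jn.
  by rewrite DE; apply: XC.
by rewrite DE; apply: zC.
Qed.

Lemma has_coresolution_id E n : has_coresolution (@injective_module R) E n <-> id_le n E.
Proof.
split; elim: n E => [|n IH] E.
- case=> C [iC zC]; have [K [p [D [ip DE [e ie]]]]] := coresolution_cosyzygy C.
  apply/id_le0.
  have K0 (x : K) : x = 0 by apply: ie; rewrite (zC 1%N isT (e x)) linear0.
  have [|r rE] := ses_factor_sub (f := idfun) ip.
    by move=> x /=; apply: K0.
  have iC0 := iC 0%N isT.
  apply: (injective_retract (s := cores_aug C) (r := r)) iC0 => x.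
  by apply: (@cores_aug_inj _ _ C); rewrite rE.
- case=> C [iC zC]; have [K [p [D [ip DE _]]]] := coresolution_cosyzygy C.
  apply/(id_leS n (iC 0%N isT) ip)/IH; exists D; split=> j jn.
    by rewrite DE; apply: iC.
  by rewrite DE; apply: zC.
- move=> /id_le0 iE; have [Z Z0] := zero_coresolution_ex.
  have [f _] := zero_map_ex E zero_mod.
  exists (cores_cons (ses_zero_r f) Z); split; first by case.
  by case=> // j _; apply: Z0.
- have [I [C [i [p [iI ip]]]]] := cosyzygy_ex E.
  move=> /(id_leS n iI ip)/IH[D [iD zD]].
  exists (cores_cons ip D); split; first by case=> // j; apply: iD.
  by case=> // j; apply: zD.
Qed.

End Resolutions.

(** * Dimensions as extended natural numbers *)

Section ExtendedNaturals.
Local Open Scope ereal_scope.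
Local Open Scope classical_set_scope.
Implicit Types (x : \bar rat) (S : set (\bar rat)) (A : nat -> Prop).

Definition enat x : Prop := x = +oo \/ exists n : nat, x = n%:R%:E.

Lemma enat_le (m n : nat) : ((m%:R%:E : \bar rat) <= n%:R%:E) = (m <= n)%N.
Proof. by rewrite lee_fin ler_nat. Qed.

(** The rationals are not complete, so suprema must be exhibited. *)
Lemma ereal_sup_eq S x : S x -> (forall y, S y -> y <= x) -> ereal_sup S = x.
Proof.
move=> Sx ubx; rewrite /ereal_sup /supremum; case: ifPn => [/eqP S0|_].
  by rewrite S0 in Sx.
have supx : supremums S x by split=> // y; apply.
by case: xgetP => [y -> supy|/(_ x)//]; apply: is_subset1_supremums supy supx.
Qed.

Lemma ereal_inf_eq S x : S x -> (forall y, S y -> x <= y) -> ereal_inf S = x.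
Proof.
move=> Sx lbx; rewrite /ereal_inf (@ereal_sup_eq _ (- x)) ?oppeK //; first by exists x.
by move=> _ [y Sy <-]; rewrite leeN2; apply: lbx.
Qed.

Lemma ereal_inf_nat A : let x := ereal_inf [set n%:R%:E | n in A] : \bar rat in
  (x = +oo /\ forall n, ~ A n) \/
  (exists n : nat, [/\ x = n%:R%:E, A n & forall m, A m -> (n <= m)%N]).
Proof.
move=> x; have [[n0 An0]|nA] := pselect (exists n, A n).
  right; have ex : exists n, `[< A n >] by exists n0; apply/asboolP.
  case: (ex_minnP ex) => n /asboolP An nmin; exists n; split=> // [|m Am].
    apply: ereal_inf_eq; first by exists n.
    by move=> _ [m Am <-]; rewrite enat_le; apply/nmin/asboolP.
  exact/nmin/asboolP.
left; split=> [|n An]; last by apply: nA; exists n.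
have -> : x = ereal_inf set0.
  congr ereal_inf; rewrite predeqE => y; split=> // -[n An _].
  by apply: nA; exists n.
exact: ereal_inf0.
Qed.

Lemma ereal_inf_nat_le A n : (forall m k, (m <= k)%N -> A m -> A k) ->
  (ereal_inf [set n%:R%:E | n in A] <= (n%:R%:E : \bar rat)) <-> A n.
Proof.
move=> upA; have [[-> nA]|[k [-> Ak kmin]]] := ereal_inf_nat A.
  by split=> [|/nA//]; rewrite leye_eq.
by rewrite enat_le; split=> [kn|/kmin//]; apply: upA Ak.
Qed.

Lemma enat_inf A : enat (ereal_inf [set n%:R%:E | n in A]).
Proof.
by have [[-> _]|[n [-> _ _]]] := ereal_inf_nat A; [left|right; exists n].
Qed.

Lemma ereal_sup_enat S : S !=set0 -> (forall x, S x -> enat x) ->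
  let x := ereal_sup S in enat x /\
    forall n : nat, (x <= n%:R%:E) <-> (forall y, S y -> y <= n%:R%:E).
Proof.
move=> [x0 Sx0] enS x.
suff [[n [nx ub Sn]]|[xoo nub]] : (exists n : nat, [/\ x = n%:R%:E,
    forall y, S y -> y <= n%:R%:E & S n%:R%:E]) \/
    (x = +oo /\ forall n : nat, ~ (forall y, S y -> y <= n%:R%:E)).
- split; first by right; exists n.
  move=> m; rewrite nx; split=> [nm y Sy|]; last by apply.
  exact: le_trans (ub y Sy) nm.
- by split; [left|move=> n; rewrite xoo; split=> [|/nub//]; rewrite leye_eq].
have [[n0 ub0]|nub] := pselect (exists n : nat, forall y, S y -> y <= n%:R%:E).
  left; have ex : exists n : nat, `[< forall y, S y -> y <= n%:R%:E >].
    by exists n0; apply/asboolP.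
  case: (ex_minnP ex) => n /asboolP ubn nmin; exists n.
  suff Sn : S n%:R%:E by split=> //; apply: ereal_sup_eq.
  apply: contrapT => nSn; case: n => [|n] in ubn nmin nSn *.
    have [x0oo|[m x0m]] := enS _ Sx0; have := ubn _ Sx0.
      by rewrite x0oo leye_eq.
    by rewrite x0m enat_le leqn0 => /eqP m0; apply: nSn; rewrite -m0 -x0m.
  have := nmin n; rewrite ltnn => /(_ _)/negP; apply=> //; apply/asboolP => y Sy.
  have [yoo|[m ym]] := enS _ Sy; have := ubn _ Sy.
    by rewrite yoo leye_eq.
  rewrite ym !enat_le leq_eqVlt => /predU1P[mn|//].
  by case: nSn; rewrite -mn -ym.
right; split=> [|n ubn]; last by apply: nub; exists n.
rewrite /x /ereal_sup /supremum; case: ifPn => [/eqP S0|_].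
  by rewrite S0 in Sx0.
have supoo : supremums S +oo.
  split=> [y _|y uby]; first exact: leey.
  case: y uby => [r|//|] uby; last first.
    have [x0oo|[m x0m]] := enS _ Sx0; have := uby _ Sx0; rewrite ?x0oo ?x0m //.
  case: nub; exists (Num.bound r) => y Sy; apply: le_trans (uby y Sy) _.
  rewrite lee_fin; apply: le_trans (ler_norm r) _; apply: ltW.
  by have := archi_boundP (normr_ge0 r); rewrite /Num.bound normr_id.
by case: xgetP => [y -> supy|/(_ +oo)//]; apply: is_subset1_supremums supy supoo.
Qed.

Lemma enat_eq x y : enat x -> enat y ->
  (forall n : nat, x <= n%:R%:E <-> y <= n%:R%:E) -> x = y.
Proof.
move=> [->|[n ->]] [->|[m ->]] // E.
- by have := (E m).2 (lexx _); rewrite leye_eq.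
- by have := (E n).1 (lexx _); rewrite leye_eq.
- by apply/eqP; rewrite eq_le; apply/andP; split; [apply/E|apply/(E n).1].
Qed.

End ExtendedNaturals.

Section Dimensions.
Variable R : pzRingType.
Local Open Scope ereal_scope.
Implicit Types M E P I : lmodType R.

Lemma proj_dim_le M (n : nat) : (proj_dim M <= n%:R%:E) <-> pd_le n M.
Proof.
rewrite -has_resolution_pd; apply: ereal_inf_nat_le => m k mk.
by rewrite !has_resolution_pd; apply: pd_le_mono.
Qed.

Lemma inj_dim_le M (n : nat) : (inj_dim M <= n%:R%:E) <-> id_le n M.
Proof.
rewrite -has_coresolution_id; apply: ereal_inf_nat_le => m k mk.
by rewrite !has_coresolution_id; apply: id_le_mono.
Qed.

Lemma zero_mod_injective : injective_module (zero_mod R).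
Proof.
move=> A B i f _; have [g _] := zero_map_ex B (zero_mod R).
by exists g => x; apply: zero_mod_eq.
Qed.

Lemma spli_enat : enat (spli R) /\ forall n : nat,
  (spli R <= n%:R%:E) <-> (forall I, injective_module I -> pd_le n I).
Proof.
have [||en le] := @ereal_sup_enat
  [set d | exists2 I : lmodType R, injective_module I & d = proj_dim I]%classic.
- by exists (proj_dim (zero_mod R)), (zero_mod R) => //; apply: zero_mod_injective.
- by move=> _ [I _ ->]; apply: enat_inf.
split=> // n; rewrite le; split=> [H I iI|H _ [I iI ->]]; last exact/proj_dim_le/H.
by apply/proj_dim_le/H; exists I.
Qed.

Lemma silp_enat : enat (silp R) /\ forall n : nat,
  (silp R <= n%:R%:E) <-> (forall P, projective_module P -> id_le n P).
Proof.
have [||en le] := @ereal_sup_enat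
  [set d | exists2 P : lmodType R, projective_module P & d = inj_dim P]%classic.
- by exists (inj_dim (R^o : lmodType R)), (R^o : lmodType R) => //; apply: projective_regular.
- by move=> _ [P _ ->]; apply: enat_inf.
split=> // n; rewrite le; split=> [H P pP|H _ [P pP ->]]; last exact/inj_dim_le/H.
by apply/inj_dim_le/H; exists P.
Qed.

End Dimensions.

(** * Strongly FP-injective modules over rings with finite spli *)

Section RowMaps.
Variable R : pzRingType.
Implicit Types M : lmodType R.

Lemma row_map_ex M t (u : 'I_t -> M) :
  exists f : {linear 'rV[R]_t -> M}, forall y, f y = \sum_i y 0 i *: u i.
Proof.
apply: linear_ex => a x y; rewrite scaler_sumr -big_split; apply: eq_bigr => i _ /=.
by rewrite !mxE scalerDl scalerA.
Qed.

Definition row_map M t (u : 'I_t -> M) := projT1 (cid (row_map_ex u)).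

Lemma row_mapE M t (u : 'I_t -> M) y : row_map u y = \sum_i y 0 i *: u i.
Proof. by rewrite /row_map; case: cid => f /= ->. Qed.

Definition unit_row t (i : 'I_t) : 'rV[R]_t := \row_j (i == j)%:R.

Lemma row_map_unit M t (u : 'I_t -> M) i : row_map u (unit_row i) = u i.
Proof.
rewrite row_mapE (bigD1 i) //= mxE eqxx scale1r big1 ?addr0 // => j ji.
by rewrite mxE eq_sym (negPf ji) scale0r.
Qed.

Lemma row_expand t (y : 'rV[R]_t) : y = \sum_i y 0 i *: unit_row i.
Proof.
apply/rowP => j; rewrite summxE (bigD1 j) //= !mxE eqxx mulr1 big1 ?addr0 // => i ij.
by rewrite !mxE (negPf ij) mulr0.
Qed.

Lemma linear_row M t (f : {linear 'rV[R]_t -> M}) y :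
  f y = \sum_i y 0 i *: f (unit_row i).
Proof. by rewrite {1}[y]row_expand linear_sum; apply: eq_bigr => i _; rewrite linearZ. Qed.

End RowMaps.

Section StronglyFPInjective.
Variable R : pzRingType.
Implicit Types M E P I F C K : lmodType R.

Definition sfi E : Prop := forall k F, finitely_presented F -> ext_zero k F E.

Lemma strongly_FP_injective_sfi E : strongly_FP_injective E -> sfi E.
Proof. by move=> sE k F fpF; apply/Ext_vanishes_ext_zero/sE. Qed.

Lemma sfi_cosyzygy E I C (i : {linear E -> I}) (p : {linear I -> C}) :
  injective_module I -> ses i p -> sfi E -> sfi C.
Proof.
by move=> iI ip sE k F fpF; apply/(ext_zero_cosyzygy _ _ iI ip)/sE.
Qed.

(** A finite system of relations is a finitely presented module. *)
Lemma ext1_fp_pure E I C (i : {linear E -> I}) (p : {linear I -> C}) :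
  ses i p -> (forall F, finitely_presented F -> ext1_zero F E) -> pure_map p.
Proof.
move=> ip fpE s t c u cu.
pose r := row_map (fun a => \row_j c a j : 'rV[R]_t).
have rE a j : r (unit_row R a) 0 j = c a j by rewrite row_map_unit mxE.
have [F [pi [spi rpi]]] := cokernel_ex r.
have fpF : finitely_presented F by exists s, t, r, pi.
have [|h hE] := factor_surj (f := p \o row_map u) spi.
  move=> b /rpi[y <-]; rewrite (linear_row r) !linear_sum big1 // => a _.
  rewrite !linearZ /= row_mapE linear_sum.
  under eq_bigr => j _ do rewrite linearZ rE /=.
  by rewrite cu scaler0.
have [g gE] := ext1_lift (fpE F fpF) ip h.
exists (fun j => g (pi (unit_row R j))); split=> [j|a].
  by rewrite gE hE /= row_map_unit.
have <- : g (pi (r (unit_row R a))) = \sum_j c a j *: g (pi (unit_row R j)).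
  rewrite [r _]row_expand !linear_sum; apply: eq_bigr => j _.
  by rewrite !linearZ rE.
by rewrite (ses_comp0 rpi) linear0.
Qed.

Section FiniteSpli.
Variable n : nat.
Hypothesis pdI : forall I, injective_module I -> pd_le n I.

(** An injective coresolution of a strongly FP-injective module is pure, since
    all its cosyzygies are strongly FP-injective. *)
Lemma sfi_pd E : sfi E -> pd_le n E.
Proof.
move=> sE.
pose IE N := cid (@cosyzygy_ex R N); pose I N := projT1 (IE N).
pose CE N := cid (projT2 (IE N)); pose C N := projT1 (CE N).
pose iE N := cid (projT2 (CE N)); pose i (N : lmodType R) : {linear N -> I N} := projT1 (iE N).
pose pE N := cid (projT2 (iE N)); pose p (N : lmodType R) : {linear I N -> C N} := projT1 (pE N).
have iI N : injective_module (I N) by have [] := projT2 (pE N).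
have ip N : ses (i N) (p N) by have [] := projT2 (pE N).
pose D j := iter j C E.
have sD j : sfi (D j) by elim: j => [//|j IH]; apply: (sfi_cosyzygy (iI (D j)) (ip (D j))).
apply: (@pure_coresolution_pd R n D (fun j => I (D j)) (fun j => i (D j))
  (fun j => p (D j))) => j.
- exact: ip.
- by apply: (ext1_fp_pure (ip (D j))) => F fpF; apply: (sD j 0%N).
- exact/pdI/iI.
Qed.

(** Since every cosyzygy has projective dimension at most [n], the [n]-th one
    is a direct summand of an injective module. *)
Lemma sfi_id E : sfi E -> id_le n E.
Proof.
suff H j E' : sfi E' -> (forall M, sfi M -> ext_zero j M E') -> id_le j E'.
  by move=> sE; apply: H => // M sM; apply: sfi_pd.
elim: j E' => [|j IH] E' sE' ME'; have [I [C [i [p [iI ip]]]]] := cosyzygy_ex E'.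
  have [s sp] := ext1_lift (ME' C (sfi_cosyzygy iI ip sE')) ip idfun.
  have [r rE] := ses_section ip sp.
  exact/id_le0/(injective_retract rE).
apply/(id_leS _ iI ip)/IH; first exact: sfi_cosyzygy ip sE'.
by move=> M sM; apply/(ext_zero_cosyzygy _ _ iI ip)/ME'.
Qed.

Lemma ext_zero_retract_r k M E E' (s : {linear E -> E'}) (r : {linear E' -> E}) :
  (forall x, r (s x) = x) -> ext_zero k M E' -> ext_zero k M E.
Proof.
move=> rs; elim: k M => [|k IH] M ME'.
  move=> A B i p ip f; have [g gE] := ME' A B i p ip (s \o f).
  by exists (r \o g) => a /=; rewrite gE /= rs.
by move=> K P i p pP ip; apply/IH/(ME' _ _ i p).
Qed.

Lemma id_le_ses k l M E K (i : {linear M -> E}) (p : {linear E -> K}) :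
  ses i p -> id_le k E -> id_le l K -> id_le (maxn k l).+1 M.
Proof.
move=> ip kE lK X; apply: (ext_zero_sub_r ip).
  by apply: id_le_mono kE X; apply: leqW; apply: leq_maxl.
by apply: id_le_mono lK X; apply: leq_maxr.
Qed.

(** Embedding a module in an injective one shifts the degree of Ext by one as
    long as that degree exceeds [n]. *)
Lemma id_le_descend m E : id_le m E -> id_le n E.
Proof.
have [mn|/ltnW nm] := leqP m n; first exact: id_le_mono.
rewrite -(subnK nm); elim: (m - n)%N => [//|j IH] idE; apply: IH => M.
have [I [C [i [p [iI ip]]]]] := cosyzygy_ex M.
apply: (ext_zero_sub_l ip); last exact: idE.
exact: (pd_le_mono (leq_addl j n) (pdI iI)).
Qed.

Lemma SFI_vee_id M : SFI_vee M -> id_le n M.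
Proof.
case=> m; suff H M' : has_coresolution (@strongly_FP_injective R) M' m ->
    exists k, id_le k M' by move=> /H[k /id_le_descend].
apply: (has_coresolution_ind (X := @strongly_FP_injective R) (Y := fun M => exists k, id_le k M)).
  move=> N E i r /strongly_FP_injective_sfi/sfi_id idE rE; exists n => X.
  exact: ext_zero_retract_r rE (idE X).
move=> N E K i p ip /strongly_FP_injective_sfi/sfi_id idE [k idK].
by exists (maxn n k).+1; apply: id_le_ses ip idE idK.
Qed.

(** In its top degree Ext(I, -) is right exact, so it vanishes as soon as it
    vanishes on the projective modules. *)
Lemma pd_le_descend m I : (forall P, projective_module P -> id_le m P) ->
  injective_module I -> pd_le m I.
Proof.
move=> idP iI; have [nm|/ltnW mn] := leqP n m; first exact: pd_le_mono nm (pdI iI).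
have := pdI iI; rewrite -(subnK mn); elim: (n - m)%N => [//|j IH] pdIj; apply: IH => M.
have [K [P [i [p [pP ip]]]]] := syzygy_ex M.
apply: (ext_zero_quot_r ip); last exact: pdIj.
exact: (id_le_mono (leq_addl j m) (idP P pP)).
Qed.

End FiniteSpli.

Theorem spli_eq_silp :
  (forall P, projective_module P -> SFI_vee P) -> (spli R < +oo)%E ->
  spli R = silp R /\ exists n, spli R = (n%:R%:E)%E.
Proof.
move=> hP spli_fin; have [en_spli spli_le] := spli_enat R.
have [en_silp silp_le] := silp_enat R.
have [spli_oo|[N spliN]] := en_spli; first by rewrite spli_oo in spli_fin.
split; last by exists N.
have pdN : forall I, injective_module I -> pd_le N I by apply/spli_le; rewrite spliN.
apply: enat_eq => // n; rewrite spli_le silp_le; split=> [pdn P pP|idn I iI].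
  exact/(SFI_vee_id pdn)/hP.
exact: (pd_le_descend pdN idn iI).
Qed.

End StronglyFPInjective.

(** * Chain conditions *)

Section ChainConditions.
Variable R : pzRingType.
Implicit Types A B C M V : lmodType R.

Definition span V (l : seq V) (x : V) : Prop :=
  forall N : V -> Prop, submodP N -> (forall y, y \in l -> N y) -> N x.

Definition fg_sub V (N : V -> Prop) : Prop :=
  exists l : seq V, (forall y, y \in l -> N y) /\ forall x, N x -> span l x.

Definition dcc V : Prop := forall N : nat -> V -> Prop,
  (forall n, submodP (N n)) -> (forall n x, N n.+1 x -> N n x) ->
  exists m, forall n x, (m <= n)%N -> N m x -> N n x.

Definition noetherian V : Prop := forall N : V -> Prop, submodP N -> fg_sub N.

Lemma span_submod V (l : seq V) : submodP (span l).
Proof.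
split=> [N subN _|a x y lx ly N subN lN]; first exact: submodP0.
by apply: subN.2; [apply: lx|apply: ly].
Qed.

Lemma mem_span V (l : seq V) x : x \in l -> span l x.
Proof. by move=> xl N _; apply. Qed.

Lemma spanS V (l l' : seq V) x : {subset l <= l'} -> span l x -> span l' x.
Proof. by move=> ll' lx N subN l'N; apply: lx => // y /ll'/l'N. Qed.

Lemma span_image V M (f : {linear V -> M}) (l : seq V) z :
  span (map f l) z -> exists2 x, span l x & z = f x.
Proof.
move=> lz; apply: (lz (fun z => exists2 x, span l x & z = f x)).
  split=> [|a _ _ [x lx ->] [y ly ->]].
- by exists 0; [apply: (submodP0 (span_submod l))|rewrite linear0].
- by exists (a *: x + y); [apply: (span_submod l).2|rewrite linearP].
- by move=> _ /mapP[x xl ->]; exists x => //; apply: mem_span.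
Qed.

Lemma submodP_inter V (N N' : V -> Prop) :
  submodP N -> submodP N' -> submodP (fun x => N x /\ N' x).
Proof.
move=> sN sN'; split=> [|a x y [Nx N'x] [Ny N'y]]; first by split; apply: submodP0.
by split; [apply: sN.2|apply: sN'.2].
Qed.

Lemma submodP_preimage V M (f : {linear V -> M}) (N : M -> Prop) :
  submodP N -> submodP (fun x => N (f x)).
Proof.
move=> sN; split=> [|a x y Nx Ny]; first by rewrite linear0; apply: submodP0.
by rewrite linearP; apply: sN.2.
Qed.

Lemma submodP_image V M (f : {linear V -> M}) (N : V -> Prop) :
  submodP N -> submodP (fun y => exists2 x, N x & f x = y).
Proof.
move=> sN; split=> [|a _ _ [x Nx <-] [y Ny <-]].
  by exists 0; [apply: submodP0|rewrite linear0].
by exists (a *: x + y); [apply: sN.2|rewrite linearP].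
Qed.

(** A property that passes to quotients and extensions and holds for the
    regular module holds for all finitely generated modules. *)
Lemma finitely_generated_ind (Phi : lmodType R -> Prop) :
  Phi (zero_mod R) -> Phi (R^o : lmodType R) ->
  (forall A B (p : {linear A -> B}), surjective_map p -> Phi A -> Phi B) ->
  (forall A B C (i : {linear A -> B}) (p : {linear B -> C}),
     ses i p -> Phi A -> Phi C -> Phi B) ->
  forall V t (a : 'I_t -> V),
  (forall x, exists c : 'I_t -> R, x = \sum_i c i *: a i) -> Phi V.
Proof.
move=> Phi0 Phi1 Phi_surj Phi_ses V t a genV.
suff [W [f [PhiW fW]]] : exists (W : lmodType R) (f : {linear W -> V}), Phi W /\
    forall c : 'I_t -> R, exists w, f w = \sum_i c i *: a i.
  by apply: (Phi_surj W V f) => // x; have [c ->] := genV x.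
elim: t a {genV} => [|t IH] a.
  have [f f0] := zero_map_ex (zero_mod R) V.
  by exists (zero_mod R), f; split=> // c; exists 0; rewrite f0 big_ord0.
have [W [f [PhiW fW]]] := IH (fun i => a (lift ord0 i)).
have [|g gE] := @linear_ex R (R^o * W)%type V (fun x => (x.1 : R) *: a ord0 + f x.2).
  by move=> b x y /=; rewrite linearP scalerDl -scalerA scalerDr addrACA.
have inl_lin : linear (fun c : R^o => (c, 0) : R^o * W).
  by move=> b x y; congr (_, _); rewrite /= scaler0 addr0.
have snd_lin : linear (fun x : R^o * W => x.2) by [].
exists (R^o * W)%type, g; split=> [|c]; last first.
  have [w wE] := fW (fun i => c (lift ord0 i)).
  by exists (c ord0, w); rewrite gE /= wE big_ord_recl.
apply: (Phi_ses _ _ _ (lin_pack inl_lin) (lin_pack snd_lin)) Phi1 PhiW; split.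
- by move=> x y [].
- by move=> [x w] /=; split=> [->|[y [_ <-]]]; first exists x.
- by move=> w; exists (0, w).
Qed.

Lemma dcc_surj A B (p : {linear A -> B}) : surjective_map p -> dcc A -> dcc B.
Proof.
move=> sp dccA N subN decN.
have [||m mE] := dccA (fun n x => N n (p x)).
- by move=> n; apply: submodP_preimage.
- by move=> n x; apply: decN.
exists m => n x mn; have [y <-] := sp x; exact: mE.
Qed.

Lemma dcc_ses A B C (i : {linear A -> B}) (p : {linear B -> C}) :
  ses i p -> dcc A -> dcc C -> dcc B.
Proof.
move=> [_ ipe _] dccA dccC N subN decN.
have [||m mE] := dccA (fun n x => N n (i x)).
- by move=> n; apply: submodP_preimage.
- by move=> n x; apply: decN.
have [||m' m'E] := dccC (fun n z => exists2 x, N n x & p x = z).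
- by move=> n; apply: submodP_image.
- by move=> n _ [x Nx <-]; exists x => //; apply: decN.
have dec k n x : (k <= n)%N -> N n x -> N k x.
  by move=> /subnK <-; elim: (n - k)%N x => [//|j IH] x /decN/IH.
exists (maxn m m') => n x; rewrite geq_max => /andP[mn m'n] Nx.
have [|y Ny pyx] := m'E n (p x) m'n.
  by exists x => //; apply: dec Nx; apply: leq_maxr.
have /ipe[a aE] : p (x - y) = 0 by rewrite linearB /= pyx subrr.
rewrite -(subrK y x) -aE; apply: (submodPD (subN n)) => //; apply: mE => //.
rewrite aE; apply: (submodPB (subN m)); first by apply: dec Nx; apply: leq_maxl.
exact: dec Ny.
Qed.

Lemma dcc_minimal V (P : (V -> Prop) -> Prop) N0 : dcc V -> submodP N0 -> P N0 ->
  exists N, [/\ submodP N, P N & forall N', submodP N' -> P N' ->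
    (forall x, N' x -> N x) -> forall x, N x -> N' x].
Proof.
move=> dccV sub0 P0; apply: contrapT => nmin.
pose T := {N : V -> Prop | submodP N /\ P N}.
have next_ex (N : T) : exists N' : T, (forall x, sval N' x -> sval N x) /\
    ~ forall x, sval N x -> sval N' x.
  apply: contrapT => nN; apply: nmin; exists (sval N); case: (svalP N) => sN PN.
  split=> // N' sN' PN' N'N; apply: contrapT => NN'; apply: nN.
  by exists (exist _ N' (conj sN' PN')).
have [next nextE] := choice next_ex.
pose chain n := iter n next (exist _ N0 (conj sub0 P0) : T).
have [||m mE] := dccV (fun n => sval (chain n)).
- by move=> n; case: (svalP (chain n)).
- by move=> n x; apply: (nextE (chain n)).1.
by have [_] := nextE (chain m); apply=> x; apply: (mE m.+1).
Qed.

Lemma noetherian_surj A B (p : {linear A -> B}) :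
  surjective_map p -> noetherian A -> noetherian B.
Proof.
move=> sp nA N sN; have [l [lN Nl]] := nA _ (submodP_preimage p sN).
exists (map p l); split=> [_ /mapP[x xl ->]|y]; first exact: lN.
have [x <-] := sp y => /Nl xl M sM lM.
apply: (xl (fun x => M (p x))); first exact: submodP_preimage.
by move=> z zl; apply/lM/map_f.
Qed.

Lemma noetherian_ses A B C (i : {linear A -> B}) (p : {linear B -> C}) :
  ses i p -> noetherian A -> noetherian C -> noetherian B.
Proof.
move=> [_ ipe _] nA nC N sN.
have [l1 [l1N Nl1]] := nA _ (submodP_preimage i sN).
have [l2 [l2N Nl2]] := nC _ (submodP_image p sN).
have [l3 [l3N pl3]] : exists l3, (forall x, x \in l3 -> N x) /\ map p l3 = l2.
  elim: l2 l2N {Nl2} => [|z l2 IH] l2N; first by exists [::].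
  have [|l3 [l3N <-]] := IH; first by move=> y yl; apply: l2N; rewrite inE yl orbT.
  have [|x Nx px] := l2N z; first by rewrite inE eqxx.
  by exists (x :: l3); rewrite /= px; split=> // y; rewrite inE => /predU1P[->|/l3N].
exists (map i l1 ++ l3); split=> [x|x Nx].
  by rewrite mem_cat => /orP[/mapP[y /l1N ? ->]|/l3N].
have : span l2 (p x) by apply: Nl2; exists x.
rewrite -pl3 => /span_image[y l3y pxy].
have Ny : N y by apply: l3y.
have /ipe[a aE] : p (x - y) = 0 by rewrite linearB /= pxy subrr.
have l1a : span l1 a by apply: Nl1; rewrite aE; apply: (submodPB sN).
rewrite -(subrK y x) -aE; apply: (submodPD (span_submod _)).
  apply: (l1a (fun a => span (map i l1 ++ l3) (i a))).
    exact/submodP_preimage/span_submod.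
  by move=> b bl; apply: mem_span; rewrite mem_cat map_f.
by apply: spanS l3y => z zl; rewrite mem_cat zl orbT.
Qed.

Lemma noetherian_zero : noetherian (zero_mod R).
Proof.
move=> N sN; exists [::]; split=> // x _.
by rewrite (zero_mod_eq x 0); apply: (submodP0 (span_submod _)).
Qed.

Lemma dcc_zero : dcc (zero_mod R).
Proof.
by move=> N sN _; exists 0%N => n x _ _; rewrite (zero_mod_eq x 0); apply: (submodP0 (sN _)).
Qed.

Lemma noetherian_row t : noetherian (R^o : lmodType R) -> noetherian ('rV[R]_t : lmodType R).
Proof.
move=> nR; apply: (finitely_generated_ind noetherian_zero nR noetherian_surj noetherian_ses
  (a := @unit_row R t)) => y.
by exists (fun i => y 0 i); apply: row_expand.
Qed.

Lemma span_row V (l : seq V) x : span l x ->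
  exists y, row_map (tnth (in_tuple l)) y = x.
Proof.
move=> lx; apply: (lx (fun x => exists y, row_map (tnth (in_tuple l)) y = x)).
  split=> [|a _ _ [y <-] [z <-]].
- by exists 0; rewrite linear0.
- by exists (a *: y + z); rewrite linearP.
by move=> z /(tnthP (in_tuple l))[i ->]; exists (unit_row R i); rewrite row_map_unit.
Qed.

Lemma noetherian_kernel t M (f : {linear 'rV[R]_t -> M}) :
  noetherian (R^o : lmodType R) ->
  exists s (g : {linear 'rV[R]_s -> 'rV[R]_t}), exact_at g f.
Proof.
move=> nR.
have [|l [lN Nl]] := noetherian_row nR (N := fun y : 'rV[R]_t => f y = 0).
  split=> [|a x y fx fy]; first by rewrite linear0.
  by rewrite linearP /= fx fy scaler0 addr0.
exists (size l), (row_map (tnth (in_tuple l))) => y; split=> [/Nl/span_row//|[z <-]].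
rewrite row_mapE linear_sum big1 // => i _; rewrite linearZ /= lN ?scaler0 //.
exact: mem_tnth.
Qed.

End ChainConditions.

(** ** The Hopkins-Levitzki theorem in the commutative case *)

Section Artinian.
Variable k : comPzRingType.
Hypothesis artk : artinian_ring k.

Lemma artinian_dcc : dcc (k^o : lmodType k).
Proof.
move=> N sN decN; have [||m mE] := artk (I := fun n => sub_pred (N n)).
- by move=> n; apply: sub_pred_closed.
- by move=> n x /asboolP/decN Nx; apply/asboolP.
exists m => n x mn Nx; have : x \in sub_pred (N m) by apply/asboolP.
by rewrite -(mE n mn) => /asboolP.
Qed.

Lemma scale_lin (V : lmodType k) (c : k) : linear (fun x : V => c *: x).
Proof. by move=> a x y; rewrite scalerDr !scalerA mulrC. Qed.

(** A minimal submodule [N] that is not finitely generated is killed or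
    reproduced by every scalar, since multiplication by the scalar would
    otherwise exhibit [N] as an extension of finitely generated modules.  Hence
    the scalars act on [N] through a field, so [N] has a hyperplane; the
    hyperplane is finitely generated by minimality, and so is [N]. *)
Lemma dcc_noetherian (V : lmodType k) : dcc V -> noetherian V.
Proof.
move=> dccV N0 sN0; apply: contrapT => nfg0.
have [N [sN nfgN minN]] := dcc_minimal (P := fun N => ~ fg_sub N) dccV sN0 nfg0.
have proper_fg N' : submodP N' -> (forall x, N' x -> N x) ->
    ~ (forall x, N x -> N' x) -> fg_sub N'.
  by move=> sN' N'N nNN'; apply: contrapT => nfg; exact: nNN' (minN N' sN' nfg N'N).
pose mul c : {linear V -> V} := lin_pack (@scale_lin V c).
have kill_or_onto c : (forall x, N x -> c *: x = 0) \/
    (forall x, N x -> exists2 y, N y & c *: y = x).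
  apply: contrapT => /not_orP[nkill nonto].
  have [|||l1 [l1N Nl1]] := proper_fg (fun x => N x /\ c *: x = 0).
  - apply: submodP_inter => //; split=> [|a x y cx cy]; first by rewrite scaler0.
    by rewrite (scale_lin (V := V) c) cx cy scaler0 addr0.
  - by move=> x [].
  - by move=> H; apply: nkill => x /H[].
  have [|x [y Ny <-]||l2 [l2N Nl2]] := proper_fg (fun x => exists2 y, N y & c *: y = x).
  - exact: (submodP_image (mul c)).
  - exact: (submodPZ sN).
  - by [].
  have [w wE] : exists w : V -> V, forall x, x \in l2 -> N (w x) /\ c *: w x = x.
    apply: (@choice_on V V id _ (fun x y => N y /\ c *: y = x)) => x /l2N[y Ny <-].
    by exists y.
  apply: nfgN; exists (l1 ++ map w l2); split=> [x|x Nx].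
    by rewrite mem_cat => /orP[/l1N[]//|/mapP[y /wE[Nw _] ->]].
  have : span l2 (c *: x) by apply: Nl2; exists x.
  have l2E : l2 = map (mul c) (map w l2).
    rewrite -map_comp -[LHS]map_id; apply/eq_in_map => y yl /=.
    by have [_ ->] := wE y yl.
  rewrite {1}l2E => /span_image[y l2y /= cxy].
  have Ny : N y by apply: l2y => // z /mapP[z' /wE[Nw _] ->].
  have l1xy : span l1 (x - y).
    by apply: Nl1; split; [apply: (submodPB sN)|rewrite scalerBr cxy subrr].
  rewrite -(subrK y x); apply: (submodPD (span_submod _)).
    by apply: spanS l1xy => z zl; rewrite mem_cat zl.
  by apply: spanS l2y => z zl; rewrite mem_cat zl orbT.
have invertible c : ~ (forall x, N x -> c *: x = 0) ->
    exists b, forall x, N x -> (b * c) *: x = x.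
  move=> nkill; have [//|onto] := kill_or_onto c.
  have onto_pow m x : N x -> exists2 y, N y & (c ^+ m) *: y = x.
    elim: m x => [|m IH] x Nx; first by exists x; rewrite ?expr0 ?scale1r.
    have [y Ny <-] := onto x Nx; have [z Nz <-] := IH y Ny.
    by exists z; rewrite // scalerA exprS.
  have [||m mE] := artinian_dcc
    (N := fun m (a : k^o) => exists b : k, forall x, N x -> (a : k) *: x = (c ^+ m * b) *: x).
  - move=> m; split=> [|a x y [b bE] [b' b'E]].
      by exists 0 => x _; rewrite mulr0 !scale0r.
    exists (a * b + b') => z Nz; have -> : a *: x + y = (a * (x : k) + (y : k))%R by [].
    by rewrite scalerDl -[in LHS]scalerA bE // b'E // scalerA -scalerDl mulrDr mulrCA.
  - move=> m a [b bE]; exists (c * b) => x Nx.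
    by rewrite bE // exprSr mulrA.
  have [|b bE] := mE m.+1 (c ^+ m) (leqnSn m).
    by exists 1 => x _; rewrite mulr1.
  exists b => x Nx; have [y Ny <-] := onto_pow m x Nx.
  by rewrite [RHS]bE // scalerA exprS -mulrA mulrC.
have [[x0 [Nx0 x0n]]|N_zero] := pselect (exists x0, N x0 /\ x0 != 0); last first.
  apply: nfgN; exists [::]; split=> // x Nx.
  have -> : x = 0; last by apply: (submodP0 (span_submod _)).
  by apply/eqP; apply: contrapT => /negP xn; apply: N_zero; exists x.
(* a submodule maximal among those avoiding x0 is a hyperplane *)
pose P (H : V -> Prop) (_ : V -> unit) := [/\ submodP H, forall x, H x -> N x & ~ H x0].
have [||H [g0 [[sH HN nHx0] _ _ maxH]]] :=
    @maximal_partial V unit P (fun x => x = 0) (fun=> tt).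
- split=> [|x ->|/eqP]; last by rewrite (negPf x0n).
    by split=> // a x y -> ->; rewrite scaler0 addr0.
  exact: submodP0.
- move=> H g loc; split=> [|x Hx|Hx0].
  + split=> [|a x y Hx Hy].
      have [//|H' [g' [[sH' _ _] H'H _ _]]] := loc [::].
      exact: H'H _ (submodP0 sH').
    have [|H' [g' [[sH' _ _] H'H H'l _]]] := loc [:: x; y].
      by move=> z; rewrite !inE => /orP[]/eqP->.
    by apply/H'H/sH'.2; apply: H'l; rewrite !inE eqxx ?orbT.
  + have [|H' [g' [[_ H'N _] _ H'l _]]] := loc [:: x].
      by move=> z; rewrite inE => /eqP->.
    by apply/H'N/H'l; rewrite inE.
  + have [|H' [g' [[_ _ nH'] _ H'l _]]] := loc [:: x0].
      by move=> z; rewrite inE => /eqP->.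
    by apply/nH'/H'l; rewrite inE.
have NH y : N y -> exists h c, H h /\ y = h + c *: x0.
  move=> Ny; have [Hy|nHy] := pselect (H y).
    by exists y, 0; rewrite scale0r addr0.
  pose H' x := exists h c, H h /\ x = h + c *: y.
  have [[h [c [Hh x0E]]]|nH'x0] := pselect (H' x0); last first.
    case: nHy; apply: (maxH H' (fun=> tt)) => //; first split=> //.
    - split=> [|a _ _ [h [c [Hh ->]]] [h' [c' [Hh' ->]]]].
        by exists 0, 0; rewrite scale0r addr0; split=> //; apply: submodP0.
      exists (a *: h + h'), (a * c + c'); split; first exact: sH.2.
      by rewrite scalerDr addrACA scalerA -scalerDl.
    - move=> _ [h [c [Hh ->]]]; apply: (submodPD sN); first exact: HN.
      exact: (submodPZ sN).
    - by move=> h Hh; exists h, 0; rewrite scale0r addr0.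
    - by move=> h _; case: (g0 h).
    - by exists 0, 1; rewrite scale1r add0r; split=> //; apply: submodP0.
  have [|b bE] := invertible c.
    by move=> c0; apply: nHx0; rewrite x0E c0 // addr0.
  exists (- (b *: h)), b; split; first by apply: (submodPN sH); apply: (submodPZ sH).
  by rewrite [in RHS]x0E scalerDr addKr scalerA bE.
have [|l [lH Hl]] := proper_fg H sH HN; first by move=> NH'; exact: nHx0 (NH' _ Nx0).
apply: nfgN; exists (x0 :: l); split=> [x|x /NH[h [c [/Hl lh ->]]]].
  by rewrite inE => /predU1P[->|/lH/HN].
apply: (submodPD (span_submod _)).
  by apply: spanS lh => z zl; rewrite inE zl orbT.
by apply: (submodPZ (span_submod _)); apply: mem_span; rewrite inE eqxx.
Qed.

Lemma artinian_fg_chains (V : lmodType k) t (a : 'I_t -> V) :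
  (forall x, exists c : 'I_t -> k, x = \sum_i c i *: a i) -> dcc V /\ noetherian V.
Proof.
move=> genV; have dccV : dcc V.
  exact: (@finitely_generated_ind k (@dcc k) (@dcc_zero k) artinian_dcc (@dcc_surj k)
    (@dcc_ses k) V t a genV).
by split=> //; apply: dcc_noetherian.
Qed.

End Artinian.

(** * Artin algebras *)

Section ArtinAlgebra.
Variables (k : comPzRingType) (R : pzRingType) (phi : {rmorphism k -> R}).
Hypothesis artk : artinian_ring k.
Hypothesis central : forall c x, phi c * x = x * phi c.
Variables (n : nat) (a : 'I_n -> R).
Hypothesis gen : forall x, exists c : 'I_n -> k, x = \sum_(i < n) phi (c i) * a i.

(** [R] as a module over the scalars: left ideals, right ideals and groups of
    solutions of linear systems are all submodules of it. *)
Definition scalar_mod & {rmorphism k -> R} : Type := R.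
Local Notation V := (scalar_mod phi).

HB.instance Definition _ := GRing.Zmodule.on V.

Definition scalar_scale (c : k) (x : V) : V := phi c * (x : R).

Lemma scalar_scaleA b c (x : V) : scalar_scale b (scalar_scale c x) = scalar_scale (b * c) x.
Proof. by rewrite /scalar_scale rmorphM mulrA. Qed.
Lemma scalar_scale1 : left_id 1 scalar_scale.
Proof. by move=> x; rewrite /scalar_scale rmorph1 mul1r. Qed.
Lemma scalar_scaleDr : right_distributive scalar_scale +%R.
Proof. by move=> c x y; apply: mulrDr. Qed.
Lemma scalar_scaleDl x : {morph scalar_scale^~ x : b c / b + c}.
Proof. by move=> b c; rewrite /scalar_scale rmorphD; apply: mulrDl. Qed.

HB.instance Definition _ := GRing.Zmodule_isLmodule.Build k V
  scalar_scaleA scalar_scale1 scalar_scaleDr scalar_scaleDl.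

Lemma scalar_chains : dcc (V : lmodType k) /\ noetherian (V : lmodType k).
Proof. exact: (artinian_fg_chains artk (V := V : lmodType k) (a := a) gen). Qed.

Lemma artin_noetherian_l : noetherian (R^o : lmodType R).
Proof.
move=> N sN; have sub_kR (M : R^o -> Prop) : submodP M -> submodP (M : V -> Prop).
  by case=> M0 MD; split=> // c x y; apply: (MD (phi c)).
have [l [lN Nl]] := scalar_chains.2 N (sub_kR N sN).
by exists l; split=> // x /Nl lx M sM; apply: lx; apply: sub_kR.
Qed.

Lemma artin_noetherian_r : noetherian (R^c^o : lmodType R^c).
Proof.
move=> N sN; have sub_kR (M : R^c^o -> Prop) : submodP M -> submodP (M : V -> Prop).
  case=> M0 MD; split=> // c x y Mx My.
  have : M ((x : R) * phi c + (y : R)) := MD (phi c) x y Mx My.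
  by rewrite -central.
have [l [lN Nl]] := scalar_chains.2 N (sub_kR N sN).
by exists l; split=> // x /Nl lx M sM; apply: lx; apply: sub_kR.
Qed.

End ArtinAlgebra.

(** * Ext of finitely generated modules over Noetherian rings *)

Section NoetherianExt.
Variable R : pzRingType.
Implicit Types E F K M P : lmodType R.

Lemma projective_row t : projective_module ('rV[R]_t : lmodType R).
Proof.
move=> B C p f sp; have [u uE] := choice (fun i : 'I_t => sp (f (unit_row R i))).
exists (row_map u) => y /=; rewrite row_mapE linear_sum [RHS]linear_row.
by apply: eq_bigr => i _; rewrite linearZ /= uE.
Qed.

Lemma noetherian_syzygy F t (p : {linear 'rV[R]_t -> F}) :
  noetherian (R^o : lmodType R) -> surjective_map p ->
  exists K (i : {linear K -> 'rV[R]_t}) s (e : {linear 'rV[R]_s -> K}),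
    ses i p /\ surjective_map e.
Proof.
move=> nR sp; have [K [i [ii ip]]] := kernel_ex p.
have [s [g gp]] := noetherian_kernel p nR.
have kip : ses i p by [].
have [|e eE] := ses_factor_sub (f := g) kip; first exact: ses_comp0.
exists K, i, s, e; split=> // x.
have /gp[y yx] : p (i x) = 0 by apply/ip; exists x.
by exists y; apply: ii; rewrite eE.
Qed.

(** Over a Noetherian ring, Ext(F, -) of a finitely generated module commutes
    with direct sums, so its vanishing on [R] implies that on projectives. *)
Lemma noetherian_ext_projective k F t (p : {linear 'rV[R]_t -> F}) P :
  noetherian (R^o : lmodType R) -> surjective_map p -> projective_module P ->
  ext_zero k F (R^o : lmodType R) -> ext_zero k F P.
Proof.
move=> nR sp pP; elim: k F t p sp => [|k IH] F t p sp FR;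
  have [K [i [s [e [ip se]]]]] := noetherian_syzygy nR sp; last first.
  have KR := FR _ _ i p (@projective_row t) ip.
  exact: (ext_zero_syzygy k P (@projective_row t) ip).2 (IH _ _ e se KR).
apply: (ext1_of_extension (@projective_row t) ip) => f.
(* the finitely many generators of K only involve finitely many coordinates *)
have [m [b [v [vE bE]]]] := projective_coordinates (fun j => f (e (unit_row R j))) pP.
have feE y : f (e y) = \sum_j y 0 j *: f (e (unit_row R j)).
  exact: (linear_row (f \o e)).
have ext_coord l : exists g : {linear 'rV[R]_t -> R^o},
    forall y, g (i (e y)) = \sum_j y 0 j * b j l.
  pose c := row_map (fun j => b j l : R^o).
  have [|h hE] := factor_surj (f := c) se.
    by move=> y ey; rewrite row_mapE; apply: bE; rewrite -feE ey linear0.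
  have [g gE] := FR _ _ i p ip h; exists g => y.
  by rewrite gE hE row_mapE.
have [g gE] := choice ext_coord.
have [|h hE] := @linear_ex R 'rV[R]_t P (fun x => \sum_l (g l x : R) *: v l).
  move=> r x y; rewrite scaler_sumr -big_split; apply: eq_bigr => l _ /=.
  by rewrite linearP scalerDl -scalerA.
exists h => x; have [y <-] := se x; rewrite hE feE.
under eq_bigr => l _ do rewrite gE scaler_suml.
rewrite exchange_big; apply: eq_bigr => j _ /=; rewrite vE scaler_sumr.
by apply: eq_bigr => l _; rewrite scalerA.
Qed.

(** Baer's criterion applied to a cosyzygy of [E]. *)
Lemma id_le_cyclic k E :
  (forall F (p : {linear R^o -> F}), surjective_map p -> ext_zero k F E) -> id_le k E.
Proof.
elim: k E => [|k IH] E cycE; last first.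
  have [I [C [i [p [iI ip]]]]] := cosyzygy_ex E.
  apply/(id_leS k iI ip)/IH => F q sq.
  exact/(ext_zero_cosyzygy k F iI ip)/(cycE F q).
apply/id_le0/baer_injective => J f sJ lf.
have [F [p [sp pJ]]] := quotient_ex sJ.
have [K [i [ii iJ]]] := submodule_ex sJ.
have Ji x : J (i x) by apply/iJ; exists x.
have [|h hE] := @linear_ex R K E (fun x => f (i x)).
  by move=> r x y; rewrite linearP lf.
have ip : ses i p by split=> // x; rewrite pJ iJ.
have [g gE] := cycE F p sp _ _ i p ip h.
exists (g 1) => x /iJ[y <-]; rewrite -hE -gE -linearZ /=; congr (g _).
by rewrite /GRing.scale /= mulr1.
Qed.

Lemma row_cover F (p : {linear R^o -> F}) : surjective_map p ->
  exists q : {linear 'rV[R]_1 -> F}, surjective_map q.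
Proof.
move=> sp; exists (row_map (fun=> p 1)) => x; have [r <-] := sp x.
exists (r *: unit_row R ord0); rewrite linearZ /= row_map_unit -linearZ /=.
by rewrite /GRing.scale /= mulr1.
Qed.

Lemma noetherian_id_projective k P : noetherian (R^o : lmodType R) ->
  projective_module P -> id_le k (R^o : lmodType R) -> id_le k P.
Proof.
move=> nR pP idR; apply: id_le_cyclic => F p /row_cover[q sq].
exact: (noetherian_ext_projective nR sq pP (idR F)).
Qed.

End NoetherianExt.

(** * Tor against finitely presented right modules, by matrices *)

Section MatrixTor.
Variable R : pzRingType.
Implicit Types M K P I E : lmodType R.

(** A matrix [A : 'I_s -> 'I_t -> R] sends a family [h] indexed by ['I_s] in a
    left module to the family of the combinations [\sum_i A i j *: h i]; on
    [R] itself this is a map of right modules, and [rexact] says that [B]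
    generates its kernel. *)
Definition rexact s t u (A : 'I_s -> 'I_t -> R) (B : 'I_u -> 'I_s -> R) : Prop :=
  forall h : 'I_s -> R, (forall j, \sum_i A i j * h i = 0) <->
    exists g : 'I_u -> R, forall i, h i = \sum_l B l i * g l.

Definition mexact M s t u (A : 'I_s -> 'I_t -> R) (B : 'I_u -> 'I_s -> R) : Prop :=
  forall h : 'I_s -> M, (forall j, \sum_i A i j *: h i = 0) ->
    exists g : 'I_u -> M, forall i, h i = \sum_l B l i *: g l.

Definition coexact s t u (A : 'I_s -> 'I_t -> R) (B : 'I_u -> 'I_s -> R) : Prop :=
  forall a : 'I_s -> R, (forall l, \sum_i a i * B l i = 0) ->
    exists b : 'I_t -> R, forall i, a i = \sum_j b j * A i j.

(** If [X] is the cokernel of [A] as a map of right modules, these express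
    that Tor_(n+1)(X, M) = 0 and Ext^(n+1)(X, R) = 0; the resolution of [X] is
    continued by successive choices of generators of kernels. *)
Fixpoint tor_zero n s t (A : 'I_s -> 'I_t -> R) M : Prop :=
  forall u (B : 'I_u -> 'I_s -> R), rexact A B ->
  if n is n'.+1 then tor_zero n' B M else mexact M A B.

Fixpoint coext_zero n s t (A : 'I_s -> 'I_t -> R) : Prop :=
  forall u (B : 'I_u -> 'I_s -> R), rexact A B ->
  if n is n'.+1 then coext_zero n' B else coexact A B.

Hypothesis nRc : noetherian (R^c^o : lmodType R^c).

Lemma rexact_ex s t (A : 'I_s -> 'I_t -> R) : exists u (B : 'I_u -> 'I_s -> R), rexact A B.
Proof.
pose f := @row_map R^c 'rV[R^c]_t s (fun i => \row_j A i j).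
have [u [g gf]] := noetherian_kernel f nRc.
exists u, (fun l i => g (unit_row R^c l) 0 i) => h.
have fh (y : 'rV[R^c]_s) j : f y 0 j = \sum_i A i j * (y 0 i : R).
  by rewrite row_mapE summxE; apply: eq_bigr => i _; rewrite !mxE.
have gE (z : 'rV[R^c]_u) i : g z 0 i = \sum_l (g (unit_row R^c l) 0 i : R) * (z 0 l : R).
  by rewrite linear_row summxE; apply: eq_bigr => l _; rewrite !mxE.
pose y : 'rV[R^c]_s := \row_i h i.
split=> [Ah|[c hE] j].
  have /gf[z zy] : f y = 0.
    apply/rowP => j; rewrite fh mxE -[RHS](Ah j).
    by apply: eq_bigr => i _; rewrite mxE.
  exists (fun l => z 0 l) => i; have := gE z i; rewrite zy mxE => ->.
  by [].
have fy : f y = 0.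
  apply/gf; exists (\row_l c l); apply/rowP => i; rewrite gE mxE hE.
  by apply: eq_bigr => l _; rewrite mxE.
have := fh y j; rewrite fy mxE => E; rewrite [RHS]E.
by apply: eq_bigr => i _; rewrite mxE.
Qed.

Lemma rexact_comp s t u (A : 'I_s -> 'I_t -> R) (B : 'I_u -> 'I_s -> R) M (g : 'I_u -> M) j :
  rexact A B -> \sum_i A i j *: (\sum_l B l i *: g l) = 0.
Proof.
move=> AB; under eq_bigr => i _ do rewrite scaler_sumr.
rewrite exchange_big big1 // => l _ /=.
under eq_bigr => i _ do rewrite scalerA.
rewrite -scaler_suml [X in X *: _](_ : _ = 0) ?scale0r //.
apply: (AB (fun i => B l i)).2; exists (fun l' => (l == l')%:R) => i.
rewrite (bigD1 l) //= eqxx mulr1 big1 ?addr0 // => l' ll'.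
by rewrite eq_sym (negPf ll') mulr0.
Qed.

(** Projective modules are flat. *)
Lemma mexact_projective s t u (A : 'I_s -> 'I_t -> R) (B : 'I_u -> 'I_s -> R) P :
  projective_module P -> rexact A B -> mexact P A B.
Proof.
move=> pP AB h Ah; have [m [b [e [hE bE]]]] := projective_coordinates h pP.
have [g gE] : exists g : 'I_m -> 'I_u -> R, forall x i, b i x = \sum_l B l i * g x l.
  have [x|g gE] := choice (_ : forall x, exists c : 'I_u -> R, forall i, b i x = \sum_l B l i * c l).
    by apply: (AB (b^~ x)).1 => j; apply: bE (Ah j) x.
  by exists g.
exists (fun l => \sum_x g x l *: e x) => i; rewrite hE.
under eq_bigr => x _ do rewrite gE scaler_suml.
rewrite exchange_big; apply: eq_bigr => l _ /=; rewrite scaler_sumr.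
by apply: eq_bigr => x _; rewrite scalerA.
Qed.

Section SyzygyShift.
Variables (K P M : lmodType R) (i : {linear K -> P}) (p : {linear P -> M}).
Hypotheses (pP : projective_module P) (ip : ses i p).

Let ii : injective i. Proof. by case: ip. Qed.
Let ipe : exact_at i p. Proof. by case: ip. Qed.

Lemma lift_family s (h : 'I_s -> M) : exists g, forall x, p (g x) = h x.
Proof. by have [_ _ sp] := ip; have [g] := choice (fun x => sp (h x)); exists g. Qed.

Lemma restrict_family s (h : 'I_s -> P) : (forall x, p (h x) = 0) ->
  exists g, forall x, i (g x) = h x.
Proof.
by move=> ph; have [g gE] := choice (fun x => (ipe (h x)).1 (ph x)); exists g.
Qed.

(** Both directions are the connecting map between Tor_(n+2)(X, M) and
    Tor_(n+1)(X, K), computed by lifting families to [P]. *)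
Lemma tor_zero_syzygy n s t (A : 'I_s -> 'I_t -> R) :
  tor_zero n.+1 A M <-> tor_zero n A K.
Proof.
elim: n s t A => [|n IH] s t A; last first.
  by split=> H u B AB; apply/IH/(H u B AB).
split=> [H u B AB h Ah|H u B AB v C BC h Bh].
  have [v [C BC]] := rexact_ex B.
  have [g gE] : exists g : 'I_u -> P, forall x, i (h x) = \sum_l B l x *: g l.
    have [|g gE] := mexact_projective pP AB (h := fun x => i (h x)); last by exists g.
    move=> j; rewrite -[RHS](linear0 i) -(Ah j) linear_sum.
    by apply: eq_bigr => x _; rewrite linearZ.
  have [|z zE] := H u B AB v C BC (fun l => p (g l)).
    move=> x; rewrite -[RHS](ses_comp0 ipe (h x)) gE linear_sum.
    by apply: eq_bigr => l _; rewrite linearZ.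
  have [z' z'E] := lift_family z.
  have [|c cE] := restrict_family (h := fun l => g l - \sum_m C m l *: z' m).
    move=> l; rewrite linearB /= zE linear_sum -sumrB big1 // => m _.
    by rewrite linearZ /= z'E subrr.
  exists c => x; apply: ii; rewrite gE linear_sum.
  under [RHS]eq_bigr => l _ do rewrite linearZ /= cE scalerBr.
  by rewrite sumrB rexact_comp // subr0.
have [g gE] := lift_family h.
have [|w wE] := restrict_family (h := fun x => \sum_l B l x *: g l).
  move=> x; rewrite linear_sum -[RHS](Bh x).
  by apply: eq_bigr => l _; rewrite linearZ /= gE.
have [|c cE] := H u B AB w.
  move=> j; apply: ii; rewrite linear0 linear_sum -[RHS](@rexact_comp _ _ _ A B P g j AB).
  by apply: eq_bigr => x _; rewrite linearZ /= wE.
have [|z zE] := mexact_projective pP BC (h := fun l => g l - i (c l)).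
  move=> x; under eq_bigr => l _ do rewrite scalerBr.
  rewrite sumrB -wE cE linear_sum -sumrB big1 // => l _.
  by rewrite linearZ subrr.
exists (fun m => p (z m)) => l.
have -> : h l = p (g l - i (c l)) by rewrite linearB /= gE (ses_comp0 ipe) subr0.
by rewrite zE linear_sum; apply: eq_bigr => m _; rewrite linearZ.
Qed.

End SyzygyShift.

Lemma pd_le_tor n M s t (A : 'I_s -> 'I_t -> R) : pd_le n M -> tor_zero n A M.
Proof.
elim: n M s t A => [|n IH] M s t A pdM.
  by move=> u B AB; apply: mexact_projective => //; apply/pd_le0.
have [K [P [i [p [pP ip]]]]] := syzygy_ex M.
by apply/(tor_zero_syzygy pP ip)/IH/(pd_leS n pP ip).
Qed.

(** The dual with respect to [I] of the complex of rows computing Ext(X, R) is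
    the complex of families in [I] computing Tor(X, I), and injective modules
    detect exactness. *)
Lemma coexact_injective s t u (A : 'I_s -> 'I_t -> R) (B : 'I_u -> 'I_s -> R) :
  coexact A B <-> forall I, injective_module I -> mexact I A B.
Proof.
split=> [AB I iI h Ah|AB a aB].
  pose beta := row_map (fun i => \row_l B l i : 'rV[R]_u).
  have betaE a l : beta a 0 l = \sum_i a 0 i * B l i.
    by rewrite row_mapE summxE; apply: eq_bigr => i _; rewrite !mxE.
  have [|Q [q [sq qE]]] := @quotient_ex R _ (fun a => beta a = 0).
    by split=> [|c x y bx byy]; rewrite ?linear0 // linearP /= bx byy scaler0 addr0.
  have [|beta' bE'] := factor_surj (f := beta) sq; first by move=> a /qE.
  have ib : injective beta'.
    by apply: lin_inj0 => x; have [y <-] := sq x; rewrite bE' => /qE.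
  have [|h' h'E] := factor_surj (f := row_map h) sq.
    move=> a /qE ba; have [l|b bE] := AB (fun i => a 0 i).
      by rewrite -betaE ba mxE.
    rewrite row_mapE; under eq_bigr => i _ do rewrite bE scaler_suml.
    rewrite exchange_big big1 // => j _ /=.
    under eq_bigr => i _ do rewrite -scalerA.
    by rewrite -scaler_sumr Ah scaler0.
  have [g gE] := iI _ _ beta' h' ib.
  exists (fun l => g (unit_row R l)) => i.
  rewrite -(row_map_unit h i) -h'E; have /= <- := gE (q (unit_row R i)).
  rewrite bE' row_map_unit linear_row; apply: eq_bigr => l _.
  by rewrite mxE.
pose rows := row_map (fun j => \row_i A i j : 'rV[R]_s).
have [C [c [sc rc]]] := cokernel_ex rows.
have [I [e [iI ie]]] := injective_embedding C.
have [|g gE] := AB I iI (fun i => e (c (unit_row R i))).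
  move=> j; have <- : e (c (rows (unit_row R j))) = \sum_i A i j *: e (c (unit_row R i)).
    rewrite row_map_unit [\row_i _]row_expand !linear_sum.
    by apply: eq_bigr => i _; rewrite !linearZ mxE.
  by rewrite (ses_comp0 rc) linear0.
pose y := \row_i a i : 'rV[R]_s.
have /rc[b bE] : c y = 0.
  apply: ie; rewrite linear0 [y]row_expand !linear_sum.
  under eq_bigr => i _ do rewrite !linearZ mxE /= gE scaler_sumr.
  rewrite exchange_big big1 // => l _ /=.
  under eq_bigr => i _ do rewrite scalerA.
  by rewrite -scaler_suml aB scale0r.
exists (fun j => b 0 j) => i.
have -> : a i = rows b 0 i by rewrite bE mxE.
by rewrite row_mapE summxE; apply: eq_bigr => j _; rewrite !mxE.
Qed.

Lemma coext_zero_injective n s t (A : 'I_s -> 'I_t -> R) :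
  coext_zero n A <-> forall I, injective_module I -> tor_zero n A I.
Proof.
elim: n s t A => [|n IH] s t A.
  split=> [H I iI u B AB|H u B AB]; first exact: (coexact_injective A B).1 (H u B AB) I iI.
  by apply/coexact_injective => I iI; apply: H.
split=> [H I iI u B AB|H u B AB]; first exact: (IH _ _ B).1 (H u B AB) I iI.
by apply/IH => I iI; apply: H.
Qed.

(** Rows over the converse ring are free right modules. *)
Definition converse_map s t (A : 'I_s -> 'I_t -> R) :
    {linear 'rV[R^c]_s -> 'rV[R^c]_t} :=
  @row_map R^c 'rV[R^c]_t s (fun i => \row_j A i j).

Lemma converse_mapE s t (A : 'I_s -> 'I_t -> R) (y : 'rV[R^c]_s) j :
  converse_map A y 0 j = \sum_i A i j * (y 0 i : R).
Proof. by rewrite row_mapE summxE; apply: eq_bigr => i _; rewrite !mxE. Qed.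

Lemma rexact_converse s t u (A : 'I_s -> 'I_t -> R) (B : 'I_u -> 'I_s -> R) :
  rexact A B -> exact_at (converse_map B) (converse_map A).
Proof.
move=> AB y; split=> [Ay|[z <-]].
  have [|g gE] := (AB (fun i => y 0 i)).1.
    by move=> j; rewrite -converse_mapE Ay mxE.
  exists (\row_l g l); apply/rowP => i; rewrite converse_mapE gE.
  by apply: eq_bigr => l _; rewrite mxE.
apply/rowP => j; rewrite converse_mapE mxE.
apply: (AB (fun i => converse_map B z 0 i)).2; exists (fun l => z 0 l) => i.
exact: converse_mapE.
Qed.

Lemma converse_row_unit (E : lmodType R^c) s t (A : 'I_s -> 'I_t -> R)
    (f : {linear 'rV[R^c]_t -> E}) i :
  f (converse_map A (unit_row R^c i)) = \sum_j (A i j : R^c) *: f (unit_row R^c j).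
Proof.
rewrite row_map_unit linear_row; apply: eq_bigr => j _; congr (_ *: _).
by rewrite mxE.
Qed.

(** Right linear forms on finitely generated free right modules are rows. *)
Lemma ext_zero_coext n s t (A : 'I_s -> 'I_t -> R) (X : lmodType R^c)
    (p : {linear 'rV[R^c]_t -> X}) : surjective_map p -> exact_at (converse_map A) p ->
  ext_zero n X (R^c^o : lmodType R^c) <-> coext_zero n A.
Proof.
elim: n s t A X p => [|n IH] s t A X p sp dAp;
  have [K [i [ii ipe]]] := kernel_ex p;
  have ip : ses i p by [].
all: have [|e eE] := ses_factor_sub (f := converse_map A) ip; first exact: (ses_comp0 dAp).
all: have se : surjective_map e by
  (move=> x; have /dAp[y yx] : p (i x) = 0 by apply/ipe; exists x);
  exists y; apply: ii; rewrite eE.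
all: have eB u (B : 'I_u -> 'I_s -> R) : rexact A B -> exact_at (converse_map B) e by
  (move=> /rexact_converse AB y; rewrite -AB -eE; split=> [->|ey]; first rewrite linear0);
  last (apply: ii; rewrite linear0).
all: have pt := @projective_row R^c t.
  split=> [H u B AB a aB|H].
    pose f := @row_map R^c R^c^o s (fun i => a i).
    have [|h hE] := factor_surj (f := f) se.
      move=> y /(eB u B AB)[z <-]; rewrite [z]row_expand !linear_sum big1 // => l _.
      rewrite !linearZ /= converse_row_unit.
      under eq_bigr => j _ do rewrite row_map_unit.
      by rewrite [\sum_j _](aB l) scaler0.
    have [g gE] := H _ _ i p ip h.
    exists (fun j => g (unit_row R^c j)) => j.
    rewrite -[LHS](row_map_unit (M := R^c^o) (fun i => a i) j) -[LHS]hE -gE eE.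
    by rewrite converse_row_unit.
  have [u [B AB]] := rexact_ex A.
  apply: (ext1_of_extension pt ip) => f.
  have [|b bE] := H u B AB (fun j => f (e (unit_row R^c j))).
    move=> l; have := converse_row_unit B (f \o e) l.
    by rewrite /= (ses_comp0 (eB u B AB)) linear0 => /esym.
  pose g := @row_map R^c R^c^o t (fun j => b j).
  exists g => x; have [y <-] := se x; rewrite eE.
  rewrite -[LHS]/((g \o converse_map A) y) -[RHS]/((f \o e) y).
  rewrite (linear_row (g \o converse_map A)) (linear_row (f \o e)).
  apply: eq_bigr => j _; congr (_ *: _); rewrite /= [RHS]bE converse_row_unit.
  by apply: eq_bigr => l _; rewrite row_map_unit.
split=> [H u B AB|H].
  by apply/(IH _ _ B K e se (eB u B AB))/(H _ _ i p).
have [u [B AB]] := rexact_ex A.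
by apply/(ext_zero_syzygy n _ pt ip)/(IH _ _ B K e se (eB u B AB))/H.
Qed.

End MatrixTor.

(** * Artin algebras are pure-injective *)

Section PureInjective.
Variables (k : comPzRingType) (R : pzRingType) (phi : {rmorphism k -> R}).
Hypothesis central : forall c x, phi c * x = x * phi c.
Hypothesis dccR : dcc (scalar_mod phi : lmodType k).
Implicit Types K M P : lmodType R.

(** A relation among elements of [P] is a list of coefficients and elements;
    purity solves finite systems of relations that hold modulo the kernel. *)
Lemma pure_relations P M (p : {linear P -> M}) (L : seq (seq (R * P))) :
  pure_map p -> (forall r, r \in L -> \sum_(x <- r) x.1 *: p x.2 = 0) ->
  exists w : P -> P, (forall y, p (w y) = p y) /\
    forall r, r \in L -> \sum_(x <- r) x.1 *: w x.2 = 0.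
Proof.
move=> pp pL.
pose ys := undup (map snd (flatten L)); have uys : uniq ys by apply: undup_uniq.
pose c (r : seq (R * P)) y := \sum_(x <- r | x.2 == y) x.1.
have collect (V : lmodType R) (F : P -> V) r : r \in L ->
    \sum_(x <- r) x.1 *: F x.2 = \sum_(y <- ys) c r y *: F y.
  move=> rL; under [RHS]eq_bigr => y _ do rewrite scaler_suml.
  rewrite (exchange_big_dep xpredT) //=; apply: eq_big_seq => x xr.
  have xys : x.2 \in ys.
    by rewrite mem_undup; apply/map_f/flattenP; exists r.
  rewrite -big_filter (_ : [seq y <- ys | x.2 == y] = [:: x.2]) ?big_seq1 //.
  rewrite -(filter_pred1_uniq uys xys); apply: eq_filter => y /=.
  by rewrite eq_sym.
pose A (a : 'I_(size L)) (j : 'I_(size ys)) := c (tnth (in_tuple L) a) (tnth (in_tuple ys) j).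
have sumA (V : lmodType R) (F : P -> V) a :
    \sum_(x <- tnth (in_tuple L) a) x.1 *: F x.2 = \sum_j A a j *: F (tnth (in_tuple ys) j).
  rewrite collect ?mem_tnth //.
  exact: (big_tnth _ _ ys xpredT (fun y => c (tnth (in_tuple L) a) y *: F y)).
have [|v [pv Av]] := pp _ _ A (tnth (in_tuple ys)).
  by move=> a; rewrite -(sumA M p); apply/pL/mem_tnth.
have [w [wys wE]] : exists w : P -> P, (forall j, w (tnth (in_tuple ys) j) = v j) /\
    forall y, p (w y) = p y.
  have [w wE] : exists w : P -> P, forall y,
      (forall j, tnth (in_tuple ys) j = y -> w y = v j) /\ p (w y) = p y.
    have [y|w wE] := choice (_ : forall y, exists z,
        (forall j, tnth (in_tuple ys) j = y -> z = v j) /\ p z = p y); last by exists w.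
    have [/(tnthP (in_tuple ys))[j ->]|nys] := boolP (y \in ys).
      exists (v j); split=> // j' /(tuple_uniqP (in_tuple ys) uys) -> //.
    exists y; split=> // j jy; case/negP: nys; rewrite -jy; exact: mem_tnth.
  by exists w; split=> [j|y]; [apply: (wE _).1|apply: (wE _).2].
exists w; split=> // r /(tnthP (in_tuple L))[a ->].
by rewrite (sumA P w) -[RHS](Av a); apply: eq_bigr => j _; rewrite wys.
Qed.

Variables (K P M : lmodType R) (i : {linear K -> P}) (p : {linear P -> M}).
Hypothesis ip : ses i p.

Definition valid_relations (L : seq (seq (R * P))) : Prop :=
  forall r, r \in L -> \sum_(x <- r) x.1 *: x.2 = 0.

Definition solves (L : seq (seq (R * P))) (rho : P -> R) : Prop :=
  forall r, r \in L -> \sum_(x <- r) x.1 * rho x.2 = 0.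

(** The partial functions that agree, on finite parts of their domain, with
    solutions of any given finite set of relations. *)
Definition locally_linear (N : P -> Prop) (g : P -> R) : Prop :=
  forall L (B : seq P), valid_relations L -> (forall b, b \in B -> N b) ->
  exists rho, solves L rho /\ forall b, b \in B -> rho b = g b.

Lemma locally_linear_start (f : {linear K -> R^o}) (g : P -> R) : pure_map p ->
  (forall x, g (i x) = f x) -> locally_linear (fun y => exists x, i x = y) g.
Proof.
move=> pp gf L B validL BN; have [_ ipe _] := ip.
have [|w [pw wL]] := @pure_relations P M p (L ++ [seq [:: (1, b)] | b <- B]) pp.
  move=> r; rewrite mem_cat => /orP[/validL r0|/mapP[b /BN[x <-] ->]].
    rewrite -[RHS](linear0 p) -r0 linear_sum; apply: eq_bigr => x _.
    by rewrite linearZ.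
  by rewrite big_seq1 /= (ses_comp0 ipe) scaler0.
have [ka kaE] : exists ka : P -> K, forall y, i (ka y) = y - w y.
  have [y|ka kaE] := choice (_ : forall y, exists x, i x = y - w y); last by exists ka.
  by apply/ipe; rewrite linearB /= pw subrr.
exists (fun y => f (ka y)); split=> [r rL|b bB].
  have -> : \sum_(x <- r) x.1 * f (ka x.2) = f (\sum_(x <- r) x.1 *: ka x.2).
    by rewrite linear_sum; apply: eq_bigr => x _; rewrite linearZ.
  suff -> : \sum_(x <- r) x.1 *: ka x.2 = 0 by rewrite linear0.
  have [ii _ _] := ip; apply: ii; rewrite linear0 linear_sum.
  under eq_bigr => x _ do rewrite linearZ /= kaE scalerBr.
  by rewrite sumrB validL // wL ?subrr // mem_cat rL.
have wb : w b = 0.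
  have := wL [:: (1, b)]; rewrite big_seq1 scale1r; apply.
  by rewrite mem_cat (map_f (fun b => [:: (1, b)])) ?orbT.
by rewrite -gf kaE wb subr0.
Qed.

(** Among the groups of values at [y0] of solutions of finite systems with
    zero boundary data there is a least one; a value compatible with the
    corresponding system is compatible with all of them. *)
Lemma locally_linear_extend N g y0 : locally_linear N g -> ~ N y0 ->
  exists r, locally_linear (fun y => N y \/ y = y0) (fun y => if y == y0 then r else g y).
Proof.
move=> locg nNy0.
pose W L (B : seq P) (r : scalar_mod phi) := exists rho,
  [/\ solves L rho, forall b, b \in B -> rho b = 0 & rho y0 = r :> R].
have sW L B : submodP (W L B).
  split=> [|c _ _ [rho [rL rB <-]] [rho' [rL' rB' <-]]].
    by exists (fun=> 0); split=> // r _; rewrite big1 // => x _; rewrite mulr0.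
  exists (fun y => phi c * rho y + rho' y); split=> [r rin|b bB|//].
    under eq_bigr => x _ do rewrite mulrDr mulrA -central -mulrA.
    by rewrite big_split /= -mulr_sumr rL // rL' // mulr0 addr0.
  by rewrite rB // rB' // mulr0 addr0.
have [||U [sU [L [B [[validL BN] UW]]] minU]] := dcc_minimal
  (P := fun U => exists L (B : seq P), (valid_relations L /\ forall b, b \in B -> N b) /\
    forall x, U x <-> W L B x) (N0 := W [::] [::]) dccR.
- exact: sW.
- by exists [::], [::].
have [rho0 [rho0L rho0B]] := locg L B validL BN.
exists (rho0 y0) => L' B' validL' B'N.
pose B'' := [seq b <- B' | b != y0].
have B''N b : b \in B ++ B'' -> N b.
  rewrite mem_cat => /orP[/BN//|]; rewrite mem_filter => /andP[/eqP by0 /B'N[//|/by0//]].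
have validLL : valid_relations (L ++ L').
  by move=> r; rewrite mem_cat => /orP[/validL|/validL'].
have [rho1 [rho1L rho1B]] := locg (L ++ L') (B ++ B'') validLL B''N.
have [||||delta [deltaL deltaB deltay]] := minU (W (L ++ L') (B ++ B'')) _ _ _ (rho1 y0 - rho0 y0).
- exact: sW.
- by exists (L ++ L'), (B ++ B'').
- move=> x [rho [rL rB <-]]; apply/UW; exists rho; split=> // [r rin|b bB].
    by apply: rL; rewrite mem_cat rin.
  by apply: rB; rewrite mem_cat bB.
- apply/UW; exists (fun y => rho1 y - rho0 y); split=> // [r rin|b bB].
    under eq_bigr => x _ do rewrite mulrBr.
    by rewrite sumrB rho0L // rho1L ?subrr // mem_cat rin.
  by rewrite rho0B // rho1B ?subrr // mem_cat bB.
exists (fun y => rho1 y - delta y); split=> [r rin|b bB'].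
  under eq_bigr => x _ do rewrite mulrBr.
  by rewrite sumrB rho1L ?deltaL ?subrr // mem_cat rin orbT.
have [->|by0] := eqVneq b y0; first by rewrite deltay opprB addrC subrK.
by rewrite rho1B ?deltaB ?subr0 // mem_cat mem_filter by0 bB' orbT.
Qed.

Lemma pure_extension (f : {linear K -> R^o}) : pure_map p ->
  exists g : {linear P -> R^o}, forall x, g (i x) = f x.
Proof.
move=> pp; have [g0 g0E] : exists g0 : P -> R, forall y, (exists x, i x = y) ->
    exists x, i x = y /\ g0 y = f x.
  apply: (@choice_on P R (fun=> 0) _ (fun y r => exists x, i x = y /\ r = f x)).
  by move=> y [x xy]; exists (f x), x.
have [ii _ _] := ip.
have g0f x : g0 (i x) = f x by have [|x' [/ii-> //]] := g0E (i x); exists x.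
have [||N [g [locg N0N gg0 maxN]]] := @maximal_partial P R locally_linear
    (fun y => exists x, i x = y) g0.
- exact: locally_linear_start pp g0f.
- move=> N g loc L B validL BN.
  have [N' [g' [locg' _ N'B g'g]]] := loc B BN.
  have [rho [rhoL rhoB]] := locg' L B validL N'B.
  by exists rho; split=> // b bB; rewrite rhoB // g'g //; apply: N'B.
have allN y : N y.
  apply: contrapT => nNy; have [r locr] := locally_linear_extend locg nNy.
  apply: (nNy); apply: (maxN _ _ locr); [by left| |by right].
  by move=> x Nx; case: eqP => // xy; rewrite xy in Nx.
have [|h hE] := @linear_ex R P R^o g; last first.
  by exists h => x; rewrite hE gg0 ?g0f //; exists x.
move=> a x y.
have [|b _|rho [rhoL rhoB]] := locg
  [:: [:: (1, a *: x + y); (- a, x); (- 1, y)]] [:: a *: x + y; x; y].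
- move=> r; rewrite inE => /eqP->; rewrite !big_cons big_nil /= addr0 scale1r scaleN1r.
  by rewrite scaleNr -opprD subrr.
- exact: allN.
have := rhoL _ (mem_head _ _); rewrite !big_cons big_nil /= addr0 mul1r mulN1r mulNr -opprD.
by rewrite !rhoB ?inE ?eqxx ?orbT // => /subr0_eq.
Qed.

End PureInjective.

(** * The two self-injective dimensions of an Artin algebra *)

Section SelfInjectiveDimensions.
Variable R : pzRingType.
Hypothesis nRc : noetherian (R^c^o : lmodType R^c).

Lemma flat_cover_pure (K P M : lmodType R) (i : {linear K -> P}) (p : {linear P -> M}) :
  ses i p -> (forall s t (A : 'I_s -> 'I_t -> R), tor_zero 0 A M) -> pure_map p.
Proof.
move=> ip flatM s t c u cu.
have [v [B AB]] := rexact_ex nRc (fun i a => c a i).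
have [g gE] := flatM _ _ _ v B AB (fun i => p (u i)) cu.
have [g' g'E] := lift_family ip g.
exists (fun i => \sum_l B l i *: g' l); split=> [j|a]; last exact: (rexact_comp (A := fun i a => c a i) g' a AB).
by rewrite gE linear_sum; apply: eq_bigr => l _; rewrite linearZ /= g'E.
Qed.

(** A module with vanishing Tor_(n+1) has a flat n-th syzygy, and there is no
    Ext from flat modules to a pure-injective module. *)
Lemma tor_zero_ext (k : comPzRingType) (phi : {rmorphism k -> R}) n M :
  (forall c x, phi c * x = x * phi c) -> dcc (scalar_mod phi : lmodType k) ->
  (forall s t (A : 'I_s -> 'I_t -> R), tor_zero n A M) -> ext_zero n M (R^o : lmodType R).
Proof.
move=> central dccR; elim: n M => [|n IH] M torM;
  have [K [P [i [p [pP ip]]]]] := syzygy_ex M.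
  apply: (ext1_of_extension pP ip) => f.
  exact: (pure_extension central dccR ip f (flat_cover_pure ip torM)).
apply/(ext_zero_syzygy n _ pP ip)/IH => s t A.
exact/(tor_zero_syzygy nRc pP ip).
Qed.

Lemma tor_zero_mono n m M : (n <= m)%N ->
  (forall s t (A : 'I_s -> 'I_t -> R), tor_zero n A M) ->
  forall s t (A : 'I_s -> 'I_t -> R), tor_zero m A M.
Proof.
move=> /subnK <-; elim: (m - n)%N => [//|j IH] torM s t A u B _.
exact: IH.
Qed.

(** Tor_(n+1)(X, I) vanishes for all injective left modules [I], hence so does
    Ext^(n+1)(X, R) for all cyclic right modules [X]. *)
Lemma id_right_le n : (forall I : lmodType R, injective_module I -> pd_le n I) ->
  id_le n (R^c^o : lmodType R^c).
Proof.
move=> pdI; apply: id_le_cyclic => X p0 /row_cover[p sp].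
have [s [g gp]] := noetherian_kernel p nRc.
pose A i j : R := g (unit_row R^c i) 0 j.
have gA y : converse_map A y = g y.
  by apply/rowP => j; rewrite converse_mapE linear_row summxE; apply: eq_bigr => i _; rewrite !mxE.
apply/(ext_zero_coext nRc n (A := A) sp).
  by move=> y; rewrite gp; split=> -[x <-]; exists x; rewrite gA.
by apply/coext_zero_injective => I iI; apply: (pd_le_tor nRc); apply: pdI.
Qed.

Lemma id_right_tor n I s t (A : 'I_s -> 'I_t -> R) :
  id_le n (R^c^o : lmodType R^c) -> injective_module I -> tor_zero n A I.
Proof.
move=> idR iI; have [X [p [sp Ap]]] := cokernel_ex (converse_map A).
have : coext_zero n A by apply/(ext_zero_coext nRc n sp Ap)/idR.
by move/coext_zero_injective; apply.
Qed.

(** If the right injective dimension is at most [n], then the injective left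
    modules have flat [n]-th syzygies, so Ext^(j+1)(I, R) vanishes for all
    [j >= n].  As the left injective dimension is finite, embedding modules in
    injective ones brings it down to [n]. *)
Lemma id_left_le (k : comPzRingType) (phi : {rmorphism k -> R}) n m :
  (forall c x, phi c * x = x * phi c) -> dcc (scalar_mod phi : lmodType k) ->
  id_le m (R^o : lmodType R) -> id_le n (R^c^o : lmodType R^c) ->
  id_le n (R^o : lmodType R).
Proof.
move=> central dccR idl idr.
have [mn|/ltnW nm] := leqP m n; first exact: id_le_mono idl.
move: idl; rewrite -(subnK nm); elim: (m - n)%N => [//|j IH] idl; apply: IH => M.
have [I [C [i [p [iI ip]]]]] := cosyzygy_ex M.
apply: (ext_zero_sub_l ip); last exact: idl.
apply: (tor_zero_ext central dccR); apply: (tor_zero_mono (leq_addl j n)) => s t A.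
exact: id_right_tor.
Qed.

End SelfInjectiveDimensions.

Theorem proposition3p8 (R : pzRingType)
    (hP : forall P : lmodType R, projective_module P -> SFI_vee P)
    (hspli : (spli R < +oo)%E) :
  spli R = silp R /\
  (artin_algebra R -> left_self_inj_dim R = right_self_inj_dim R).
Proof.
have [eq_dim [N spliN]] := spli_eq_silp hP hspli; split=> //.
move=> [k [phi [artk central [t [a gen]]]]].
have nRl := artin_noetherian_l artk gen.
have nRr := artin_noetherian_r artk central gen.
have [dccR _] := scalar_chains artk gen.
have [_ spli_le] := spli_enat R; have [_ silp_le] := silp_enat R.
have idN : id_le N (R^o : lmodType R).
  by apply: (silp_le N).1; [rewrite -eq_dim spliN|apply: projective_regular].
apply: enat_eq; [exact: enat_inf|exact: enat_inf|] => n.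
rewrite /left_self_inj_dim /right_self_inj_dim !inj_dim_le; split=> [idl|idr].
  apply: (id_right_le nRr); apply/spli_le; rewrite eq_dim; apply/silp_le => P pP.
  exact: noetherian_id_projective.
exact: (id_left_le nRr central dccR idN idr).
Qed.
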